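(* Let $M,K,r\colon\mathbb{R}_+\to(0,\infty)$ be non-decreasing functions and assume that $M,K$ are continuous and such that $M(s)=O(e^{\alpha s})$ and $K(s)=O(\exp(e^{\alpha s}))$ as $s\to\infty$ for some $\alpha>0$. Let $$\Omega_M=\left\{\lambda\in\mathbb{C}:\operatorname{Re}\lambda>-\frac{1}{M(|\operatorname{Im}\lambda|)}\right\},\qquad M_K(s)=M(s)\big(\log(1+s)+\log(1+K(s))\big),\quad s\ge0.$$ (1) Suppose that $$|f(t)|=O\big(r(t)^{-1}\big),\quad t\to\infty,$$ for every bounded Lipschitz continuous function $f\colon\mathbb{R}_+\to\mathbb{C}$ whose Laplace transform $\widehat f$ extends analytically to the region $\Omega_M$ and satisfies $$\sup_{\lambda\in\Omega_M}\frac{|\widehat f(\lambda)|}{K(|\operatorname{Im}\lambda|)}<\infty.$$ Then $$r(t)=O\big(M_K^{-1}(t)\big),\quad t\to\infty.$$ (2) Assume in addition that there are $b,\beta>0$ such that $K(s)\ge bs^\beta$ for all sufficiently large $s\ge0$, but suppose only that $|f(t)|=O(r(t)^{-1})$ as $t\to\infty$ holds for all bounded Lipschitz continuous functions $f\colon\mathbb{R}_+\to\mathbb{C}$ such that $f'$ is uniformly continuous and the Laplace transform of $f$ extends analytically to the region $\Omega_M$ and satisfies $$\sup_{\lambda\in\Omega_M}\frac{|\lambda\widehat f(\lambda)|}{K(|\operatorname{Im}\lambda|)}<\infty.$$ Then $$r(t)=O\big(M_K^{-1}(ct)\big),\quad t\to\infty,$$ where $c=1+\beta^{-1}$.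
   Context: $\mathbb{R}_+=[0,\infty)$. For a bounded continuous $f\colon\mathbb{R}_+\to\mathbb{C}$ the Laplace transform is $\widehat f(\lambda)=\int_0^\infty e^{-\lambda t}f(t)\,\mathrm{d}t$ for $\operatorname{Re}\lambda>0$; its analytic extension to $\Omega_M$ (which contains the open right half-plane) is denoted by the same symbol. $r(t)^{-1}$ denotes the reciprocal $1/r(t)$, whereas $M_K^{-1}$ denotes the inverse function of the continuous strictly increasing function $M_K$, which is defined for all sufficiently large arguments. ''$f'$ is uniformly continuous'' means that $f$ is differentiable with uniformly continuous derivative. *)

(* Defs.v *)
From Stdlib Require Import Reals.
From Coquelicot Require Import Coquelicot.
Open Scope R_scope.

(** Functions on [0, +oo) are total functions on [R] of which only the values
    at nonnegative arguments matter. *)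
Definition Rplus_set (t : R) : Prop := 0 <= t.

Definition positive_on_Rplus (g : R -> R) : Prop :=
  forall s, 0 <= s -> 0 < g s.

Definition nondecreasing_on_Rplus (g : R -> R) : Prop :=
  forall s t, 0 <= s -> s <= t -> g s <= g t.

(** [f = O(g)] at [+oo]. *)
Definition bigO_infty (f g : R -> R) : Prop :=
  exists A : R, Rbar_locally p_infty (fun t => Rabs (f t) <= A * Rabs (g t)).

Definition bounded_on_Rplus (f : R -> C) : Prop :=
  exists B : R, forall t, 0 <= t -> Cmod (f t) <= B.

Definition Lipschitz_on_Rplus (f : R -> C) : Prop :=
  exists L : R, forall s t, 0 <= s -> 0 <= t ->
    Cmod (f t - f s) <= L * Rabs (t - s).

(** The derivative is taken relative to [0, +oo), hence is one-sided at [0]. *)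
Definition is_derive_on_Rplus (f : R -> C) (t : R) (l : C) : Prop :=
  filterdiff (U := R_NormedModule) (V := C_R_NormedModule)
    f (within Rplus_set (locally t)) (fun h => scal h l).

Definition uniformly_continuous_on_Rplus (g : R -> C) : Prop :=
  forall eps : posreal, exists delta : posreal,
    forall s t, 0 <= s -> 0 <= t -> Rabs (t - s) < delta ->
      Cmod (g t - g s) < eps.

Definition has_uniformly_continuous_derivative (f : R -> C) : Prop :=
  exists f' : R -> C,
    (forall t, 0 <= t -> is_derive_on_Rplus f t (f' t)) /\
    uniformly_continuous_on_Rplus f'.

Definition Cexp (z : C) : C :=
  (exp (Re z) * cos (Im z), exp (Re z) * sin (Im z)).

Definition laplace (f : R -> C) (lambda : C) : C :=
  RInt_gen (V := C_R_CompleteNormedModule)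
    (fun t => (Cexp (- (lambda * RtoC t)) * f t)%C)
    (at_point 0) (Rbar_locally p_infty).

(** Complex differentiability at every point; used on open sets only. *)
Definition analytic_on (D : C -> Prop) (F : C -> C) : Prop :=
  forall z, D z -> ex_derive (K := C_AbsRing) (V := C_NormedModule) F z.

Definition laplace_extension (D : C -> Prop) (f : R -> C) (F : C -> C) : Prop :=
  analytic_on D F /\ forall lambda, 0 < Re lambda -> F lambda = laplace f lambda.

Definition Omega (M : R -> R) (lambda : C) : Prop :=
  Re lambda > - (1 / M (Rabs (Im lambda))).

Definition MK (M K : R -> R) (s : R) : R :=
  M s * (ln (1 + s) + ln (1 + K s)).

(** The unique [s >= 0] with [MK M K s = t]; junk when there is none, i.e. for
    [t < MK M K 0] under the standing assumptions on [M] and [K]. *)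
Definition MK_inv (M K : R -> R) (t : R) : R :=
  iota (fun s : R => 0 <= s /\ MK M K s = t).

(* Main.v *)
Require Import Defs.
From Stdlib Require Import Reals Lra Lia Psatz Classical ClassicalEpsilon.
From Coquelicot Require Import Coquelicot.
Open Scope R_scope.

(** The conclusion is a uniform boundedness statement. If [r] were not
    [O(MK_inv (kappa t))], there would be points [t_n] at which [r]
    exceeds [rho_n = MK_inv (kappa t_n)] times the [n]-th term of a prescribed
    geometric sequence; here [kappa] is 1 in the first statement and
    [1 + 1 / beta] in the second. A function [f_n] of the admissible class, of uniformly
    bounded size in that class, with [|f_n (t_n)|] comparable to [1 / rho_n], is
    built for every [n]; a sum of the [f_n] with geometric coefficients, selected
    by a gliding hump argument ([gliding_hump]), is admissible and contradicts
    the assumed decay ([optimality]).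

    The [f_n] are wave packets. Let [bump z = exp (- 2 cosh (z / eta))] with
    [eta = 1 / M 0 + 1]. On [|Im z| <= eta] it is bounded by
    [exp (- cosh (Re z / eta))], and it is entire, so its Fourier transform decays like
    [exp (- eta |v|)], while the bump itself is doubly exponentially small at
    distance [X] from the origin. The packet of frequency [rho] at time [t] is
    [(1 / rho)] times the integral of [exp (i (z + Y) (s - t)) bump z] over the
    segment from [- X + i eta] to [X + i eta]. Here [X = N rho] for a large
    constant [N], and [Y = X + 2 rho], so that all frequencies of the packet
    are at least [2 rho]. Its Laplace transform is the integral of
    [exp (- i (z + Y) t) bump z / (rho (lam - i (z + Y)))] over the segment,
    analytic for [Re lam > - eta], hence on [Omega M]. There are two regimes.

    - If [|Im lam| >= rho], only the size of the packet in time matters: a packet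
      living near [t] has transform at most [exp (t / M rho) / rho] up to a
      constant, and [t] of size [MK rho / kappa] turns this into a bound by
      [K rho], hence by [K |Im lam|] ([wave_high], [transform_estimate] and
      [multiplied_transform_estimate]).
    - If [|Im lam| < rho], the pole of the integrand is at distance at least
      [rho] from the rectangle between the lines of height [eta] and [- eta].
      Moving the contour down to [Im z = - eta] gains [exp (- eta t)]; what is
      left are the vertical sides, where the bump, at most
      [exp (- exp (X / eta) / 2)], beats the factor [exp (eta t)] because
      [t <= MK rho] is at most exponential in [rho] ([MK_growth]). This is where
      the growth conditions on [M] and [K] enter. The transform is therefore
      bounded there, with no loss from the much smaller values of [M] at low
      frequencies ([bump_integral_bound], [packet_wave]).

    As [rho_n] tends to infinity, every fixed [lam] is eventually in the second
    regime, where the transforms also have uniformly controlled second order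
    Taylor remainders; this makes the sum of the transforms analytic
    ([total_transform_cderiv]). *)

(** * The complex exponential *)

Lemma Cmod_le_Re_Im : forall z : C, Cmod z <= Rabs (Re z) + Rabs (Im z).
Proof.
  intros [x y]; simpl.
  replace (x, y) with (RtoC x + Ci * RtoC y)%C
    by (unfold RtoC, Ci, Cmult, Cplus; simpl; f_equal; ring).
  eapply Rle_trans; [apply Cmod_triangle|].
  rewrite Cmod_mult, !Cmod_R, Cmod_Ci; lra.
Qed.

Lemma im_le_Cmod : forall z : C, Rabs (Im z) <= Cmod z.
Proof.
  intros z; eapply Rle_trans; [|apply Rmax_Cmod]; apply Rmax_r.
Qed.

Lemma C_eq : forall z w : C, Re z = Re w -> Im z = Im w -> z = w.
Proof. intros [a b] [c d]; simpl; congruence. Qed.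

Lemma Cexp_plus : forall z w, Cexp (z + w)%C = (Cexp z * Cexp w)%C.
Proof.
  intros [a b] [c d]; unfold Cexp, Cmult; simpl.
  rewrite exp_plus, cos_plus, sin_plus; f_equal; ring.
Qed.

Lemma Cexp_0 : Cexp 0 = 1%C.
Proof. unfold Cexp; simpl; rewrite exp_0, cos_0, sin_0; apply C_eq; simpl; ring. Qed.

Lemma Cmod_Cexp : forall z, Cmod (Cexp z) = exp (Re z).
Proof.
  intros [a b]; unfold Cexp, Cmod; simpl.
  replace (_ + _) with (exp a * exp a * ((sin b)² + (cos b)²))
    by (unfold Rsqr; ring).
  rewrite sin2_cos2, Rmult_1_r; apply sqrt_square, Rlt_le, exp_pos.
Qed.

Lemma exp_quad_bound : forall x, Rabs x <= 1 -> Rabs (exp x - 1 - x) <= 2 * x ^ 2.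
Proof.
  intros x Hx; apply Rabs_le_between in Hx.
  assert (H1 := exp_ineq1_le x).
  assert (H2 := exp_ineq1_le (- x / 2)).
  rewrite Rabs_pos_eq by lra.
  assert (Hp := exp_pos (- x / 2)).
  assert (E : exp x * (exp (- x / 2) * exp (- x / 2)) = 1)
    by (rewrite <- !exp_plus; replace (x + (- x / 2 + - x / 2)) with 0 by field; apply exp_0).
  assert (Hxp := exp_pos x).
  assert (Hle : exp x * ((1 - x / 2) * (1 - x / 2)) <= 1).
  { rewrite <- E. apply Rmult_le_compat_l; [lra|]. apply Rmult_le_compat; lra. }
  assert (H4 : 1 <= (1 + x + 2 * x ^ 2) * ((1 - x / 2) * (1 - x / 2))).
  { assert (0 <= x ^ 2 * ((1 - x) * (5 - 2 * x)))
      by (apply Rmult_le_pos; [apply pow2_ge_0|]; apply Rmult_le_pos; lra).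
    nra. }
  assert (0 < (1 - x / 2) * (1 - x / 2)) by nra.
  nra.
Qed.

Lemma Rabs_sin_le : forall y, Rabs (sin y) <= Rabs y.
Proof.
  intros y. destruct (MVT_cor4 sin cos 0 (Rabs y)) with (b := y) as (c & Hc & _).
  - intros; auto_derive; auto; ring.
  - rewrite Rminus_0_r; lra.
  - rewrite sin_0, !Rminus_0_r in Hc. rewrite Hc, Rabs_mult.
    assert (Rabs (cos c) <= 1) by (apply Rabs_le_between, COS_bound).
    assert (H0 := Rabs_pos y). nra.
Qed.

Lemma exp_le_compat : forall x y, x <= y -> exp x <= exp y.
Proof.
  intros x y [H| ->]; [apply Rlt_le, exp_increasing; assumption|apply Rle_refl].
Qed.

(** Both components reduce to one-variable estimates by writing
    [exp x cos y - 1 - x] as [(exp x - 1 - x) cos y + (1 + x) (cos y - 1)] and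
    [exp x sin y - y] as [(exp x - 1) sin y + (sin y - y)]. *)
Lemma Cexp_quad_bound : forall h : C, Cmod h <= 1 ->
  Cmod (Cexp h - 1 - h)%C <= 12 * Cmod h ^ 2.
Proof.
  intros h Hh.
  assert (Hx := re_le_Cmod h); assert (Hy := im_le_Cmod h).
  assert (Hm := Cmod_ge_0 h).
  eapply Rle_trans; [apply Cmod_le_Re_Im|].
  destruct h as [x y]; cbn [Re Im fst snd] in *; set (m := Cmod (x, y)) in *; clearbody m.
  assert (Ex := exp_quad_bound x ltac:(lra)).
  assert (Hx2 : x ^ 2 <= m ^ 2) by (apply pow_maj_Rabs; assumption).
  assert (Hy2 : y ^ 2 <= m ^ 2) by (apply pow_maj_Rabs; assumption).
  assert (Hcos : Rabs (cos y - 1) <= m ^ 2).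
  { replace y with (2 * (y / 2)) by field. rewrite cos_2a_sin.
    assert (Hs : (sin (y / 2)) ^ 2 <= Rabs (y / 2) ^ 2).
    { apply pow_maj_Rabs, Rabs_sin_le. }
    rewrite pow2_abs in Hs. rewrite Rabs_left1; nra. }
  assert (Hsin : Rabs (sin y) <= m).
  { eapply Rle_trans; [apply Rabs_sin_le|assumption]. }
  assert (Hsy : Rabs (sin y - y) <= m ^ 2).
  { destruct (MVT_cor4 (fun u => sin u - u) (fun u => cos u - 1) 0 (Rabs y)) with (b := y) as (c & Hc & Hcy).
    - intros; auto_derive; auto; ring.
    - rewrite Rminus_0_r; lra.
    - rewrite sin_0, !Rminus_0_r in *. rewrite Hc, Rabs_mult.
      destruct (MVT_cor4 cos (fun u => - sin u) 0 (Rabs c)) with (b := c) as (d & Hd & _).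
      + intros; auto_derive; auto; ring.
      + rewrite Rminus_0_r; lra.
      + rewrite cos_0, !Rminus_0_r in Hd. rewrite Hd, Rabs_mult.
        assert (Rabs (- sin d) <= 1) by (rewrite Rabs_Ropp; apply Rabs_le_between, SIN_bound).
        assert (H0 := Rabs_pos c). assert (H3 := Rabs_pos y).
        assert (H4 := Rabs_pos (- sin d)).
        assert (Rabs (- sin d) * Rabs c <= m) by nra. nra. }
  assert (Hr : Re (Cexp (x, y) - 1 - (x, y))%C = (exp x - 1 - x) * cos y + (1 + x) * (cos y - 1))
    by (unfold Cexp; simpl; ring).
  assert (Hi : Im (Cexp (x, y) - 1 - (x, y))%C = (exp x - 1 - x + x) * sin y + (sin y - y))
    by (unfold Cexp; simpl; ring).
  rewrite Hr, Hi.
  assert (Rabs ((exp x - 1 - x) * cos y) <= 2 * m ^ 2).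
  { rewrite Rabs_mult. assert (Rabs (cos y) <= 1) by (apply Rabs_le_between, COS_bound).
    assert (H0 := Rabs_pos (exp x - 1 - x)). assert (H1 := Rabs_pos (cos y)). nra. }
  assert (Rabs ((1 + x) * (cos y - 1)) <= 2 * m ^ 2).
  { rewrite Rabs_mult. assert (Rabs (1 + x) <= 2).
    { apply Rabs_le_between. apply Rabs_le_between in Hx. lra. }
    assert (H1 := Rabs_pos (cos y - 1)). assert (H2 := Rabs_pos (1 + x)). nra. }
  assert (Rabs ((exp x - 1 - x + x) * sin y) <= 3 * m ^ 2).
  { rewrite Rabs_mult.
    assert (Rabs (exp x - 1 - x + x) <= 3 * m).
    { eapply Rle_trans; [apply Rabs_triang|]. nra. }
    assert (H3 := Rabs_pos (sin y)). assert (H4 := Rabs_pos (exp x - 1 - x + x)). nra. }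
  assert (T1 := Rabs_triang ((exp x - 1 - x) * cos y) ((1 + x) * (cos y - 1))).
  assert (T2 := Rabs_triang ((exp x - 1 - x + x) * sin y) (sin y - y)).
  nra.
Qed.

Lemma Cplus_sub : forall z w : C, (z + (w - z))%C = w.
Proof. intros; ring. Qed.

(** * Complex and real differentiation of complex-valued functions *)

(** The ring is used as a module over itself, so that the general product and
    chain rules apply. *)
Definition cderiv (f : C -> C) (z l : C) : Prop :=
  is_derive (K := C_AbsRing) (V := AbsRing_NormedModule C_AbsRing) f z l.

(** Derivatives are exchanged with remainder estimates here and below: the sums
    over packets are controlled through their remainders. *)
Lemma cderiv_of_remainder : forall (f : C -> C) z l,
  (forall eps, 0 < eps -> exists d, 0 < d /\ forall h : C, Cmod h < d ->
     Cmod (f (z + h) - f z - h * l)%C <= eps * Cmod h) ->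
  cderiv f z l.
Proof.
  intros f z l H. split.
  - apply is_linear_scal_l.
  - intros x Hx eps.
    apply (is_filter_lim_locally_unique (V := AbsRing_NormedModule C_AbsRing)) in Hx; subst x.
    destruct (H eps (cond_pos eps)) as (d & Hd & Hh).
    exists (mkposreal d Hd). intros y Hy.
    specialize (Hh (y - z)%C Hy).
    rewrite Cplus_sub in Hh. exact Hh.
Qed.

Lemma cderiv_remainder : forall (f : C -> C) z l, cderiv f z l ->
  forall eps, 0 < eps -> exists d, 0 < d /\ forall h : C, Cmod h < d ->
     Cmod (f (z + h) - f z - h * l)%C <= eps * Cmod h.
Proof.
  intros f z l [_ H] eps Heps.
  destruct (H z (fun P HP => HP) (mkposreal eps Heps)) as [d Hd].
  exists d; split; [apply cond_pos|]. intros h Hh.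
  specialize (Hd (z + h)%C).
  assert (E : (z + h - z)%C = h) by ring.
  assert (Hb : Cmod (z + h - z)%C < d) by (rewrite E; exact Hh).
  specialize (Hd Hb).
  change (Cmod (f (z + h) - f z - (z + h - z) * l)%C <= eps * Cmod (z + h - z)%C) in Hd.
  rewrite E in Hd. exact Hd.
Qed.

Lemma cderiv_of_quadratic : forall (f : C -> C) z l d B, 0 < d ->
  (forall h : C, Cmod h < d -> Cmod (f (z + h) - f z - h * l)%C <= B * Cmod h ^ 2) ->
  cderiv f z l.
Proof.
  intros f z l d B Hd H. apply cderiv_of_remainder. intros eps Heps.
  assert (HB : 0 < Rabs B + 1) by (assert (H0 := Rabs_pos B); lra).
  exists (Rmin d (eps / (Rabs B + 1))). split.
  - apply Rmin_glb_lt; [assumption|]. apply Rdiv_lt_0_compat; assumption.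
  - intros h Hh.
    assert (H1 : Cmod h < d) by (eapply Rlt_le_trans; [exact Hh|apply Rmin_l]).
    assert (H2 : Cmod h < eps / (Rabs B + 1)) by (eapply Rlt_le_trans; [exact Hh|apply Rmin_r]).
    eapply Rle_trans; [apply H; assumption|].
    assert (H3 := Cmod_ge_0 h).
    assert (H4 : Cmod h * (Rabs B + 1) <= eps).
    { apply Rlt_le in H2. apply (Rmult_le_compat_r (Rabs B + 1)) in H2; [|lra].
      unfold Rdiv in H2. rewrite Rmult_assoc, Rinv_l in H2; lra. }
    assert (H5 := Rle_abs B). nra.
Qed.

Lemma cderiv_const : forall c z, cderiv (fun _ => c) z 0%C.
Proof. intros; unfold cderiv in *; apply @is_derive_const. Qed.

Lemma cderiv_id : forall z, cderiv (fun w => w) z 1%C.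
Proof. intros; unfold cderiv in *; apply @is_derive_id. Qed.

Lemma cderiv_plus : forall f g z lf lg, cderiv f z lf -> cderiv g z lg ->
  cderiv (fun w => f w + g w)%C z (lf + lg)%C.
Proof. intros; unfold cderiv in *; apply @is_derive_plus; assumption. Qed.

Lemma cderiv_mult : forall f g z lf lg, cderiv f z lf -> cderiv g z lg ->
  cderiv (fun w => f w * g w)%C z (lf * g z + f z * lg)%C.
Proof. intros; unfold cderiv in *; apply @is_derive_mult; try assumption. intros; apply Cmult_comm. Qed.

Lemma cderiv_comp : forall f g z lf lg, cderiv f (g z) lf -> cderiv g z lg ->
  cderiv (fun w => f (g w)) z (lg * lf)%C.
Proof. intros; unfold cderiv in *; apply @is_derive_comp; assumption. Qed.

Lemma cderiv_exp : forall z, cderiv Cexp z (Cexp z).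
Proof.
  intros z. apply cderiv_of_quadratic with (d := 1) (B := Cmod (Cexp z) * 12); [lra|].
  intros h Hh. rewrite Cexp_plus.
  replace (Cexp z * Cexp h - Cexp z - h * Cexp z)%C with (Cexp z * (Cexp h - 1 - h))%C by ring.
  rewrite Cmod_mult, Rmult_assoc. apply Rmult_le_compat_l; [apply Cmod_ge_0|].
  apply Cexp_quad_bound; lra.
Qed.

Lemma Cmod_sub_ge : forall z w, Cmod z - Cmod w <= Cmod (z - w)%C.
Proof.
  intros z w. assert (H := Cmod_triangle (z - w) w).
  replace (z - w + w)%C with z in H by ring. lra.
Qed.

Lemma Cmod_add_ge : forall z w, Cmod z - Cmod w <= Cmod (z + w)%C.
Proof.
  intros z w. assert (H := Cmod_sub_ge z (- w)). rewrite Cmod_opp in H.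
  replace (z - - w)%C with (z + w)%C in H by ring. exact H.
Qed.

Lemma Cinv_second_order : forall z h : C, z <> 0%C -> (z + h)%C <> 0%C ->
  (/ (z + h) - / z - h * (- (/ z * / z)))%C = (h * h * (/ z * / z * / (z + h)))%C.
Proof. intros; field; split; assumption. Qed.

Lemma cderiv_inv : forall z : C, z <> 0%C -> cderiv Cinv z (- (/ z * / z))%C.
Proof.
  intros z Hz. assert (Hm := proj1 (Cmod_gt_0 z) Hz).
  apply cderiv_of_quadratic with (d := Cmod z / 2) (B := / Cmod z * / Cmod z * / (Cmod z / 2)); [lra|].
  intros h Hh.
  assert (Hzh : Cmod z / 2 < Cmod (z + h)%C) by (assert (H := Cmod_add_ge z h); lra).
  assert (Hzh0 : (z + h)%C <> 0%C) by (apply Cmod_gt_0; lra).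
  rewrite Cinv_second_order by assumption.
  rewrite !Cmod_mult, !Cmod_inv by assumption.
  replace (Cmod h * Cmod h) with (Cmod h ^ 2) by ring.
  rewrite Rmult_comm. apply Rmult_le_compat_r; [apply pow2_ge_0|].
  apply Rmult_le_compat_l.
  - apply Rlt_le, Rmult_lt_0_compat; apply Rinv_0_lt_compat; assumption.
  - apply Rinv_le_contravar; lra.
Qed.

Lemma is_derive_of_remainder : forall (f : R -> R) t l,
  (forall eps, 0 < eps -> exists d, 0 < d /\ forall h, Rabs h < d ->
     Rabs (f (t + h) - f t - h * l) <= eps * Rabs h) ->
  is_derive f t l.
Proof.
  intros f t l H. split.
  - apply is_linear_scal_l.
  - intros x Hx eps.
    apply (is_filter_lim_locally_unique (V := R_NormedModule)) in Hx; subst x.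
    destruct (H eps (cond_pos eps)) as (d & Hd & Hh).
    exists (mkposreal d Hd). intros y Hy.
    specialize (Hh (y - t) Hy).
    rewrite Rplus_minus in Hh. exact Hh.
Qed.

Lemma is_derive_remainder : forall (f : R -> R) t l, is_derive f t l ->
  forall eps, 0 < eps -> exists d, 0 < d /\ forall h, Rabs h < d ->
     Rabs (f (t + h) - f t - h * l) <= eps * Rabs h.
Proof.
  intros f t l [_ H] eps Heps.
  destruct (H t (fun P HP => HP) (mkposreal eps Heps)) as [d Hd].
  exists d; split; [apply cond_pos|]. intros h Hh.
  specialize (Hd (t + h)).
  assert (E : t + h - t = h) by ring.
  assert (Hb : Rabs (t + h - t) < d) by (rewrite E; exact Hh).
  specialize (Hd Hb).
  change (Rabs (f (t + h) - f t - (t + h - t) * l) <= eps * Rabs (t + h - t)) in Hd.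
  rewrite E in Hd. exact Hd.
Qed.

(** Componentwise, because integrals are computed componentwise below. *)
Definition rderiv (f : R -> C) (t : R) (l : C) : Prop :=
  is_derive (fun s => Re (f s)) t (Re l) /\ is_derive (fun s => Im (f s)) t (Im l).

Lemma rderiv_of_remainder : forall (f : R -> C) t (l : C),
  (forall eps, 0 < eps -> exists d, 0 < d /\ forall h, Rabs h < d ->
     Cmod (f (t + h)%R - f t - h * l)%C <= eps * Rabs h) ->
  rderiv f t l.
Proof.
  intros f t l H.
  split; apply is_derive_of_remainder; intros eps Heps;
    destruct (H eps Heps) as (d & Hd & Hh); exists d; (split; [exact Hd|]);
    intros h Hb; (eapply Rle_trans; [|apply Hh; exact Hb]).
  - eapply Rle_trans; [|apply re_le_Cmod]. apply Req_le; f_equal; unfold Re, Im; simpl; ring.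
  - eapply Rle_trans; [|apply im_le_Cmod]. apply Req_le; f_equal; unfold Re, Im; simpl; ring.
Qed.

Lemma rderiv_remainder : forall (f : R -> C) t (l : C), rderiv f t l ->
  forall eps, 0 < eps -> exists d, 0 < d /\ forall h, Rabs h < d ->
     Cmod (f (t + h)%R - f t - h * l)%C <= eps * Rabs h.
Proof.
  intros f t l [HR HI] eps Heps.
  destruct (is_derive_remainder _ _ _ HR (eps / 2)) as (d1 & Hd1 & H1); [lra|].
  destruct (is_derive_remainder _ _ _ HI (eps / 2)) as (d2 & Hd2 & H2); [lra|].
  exists (Rmin d1 d2); split; [apply Rmin_glb_lt; assumption|].
  intros h Hh.
  specialize (H1 h (Rlt_le_trans _ _ _ Hh (Rmin_l _ _))).
  specialize (H2 h (Rlt_le_trans _ _ _ Hh (Rmin_r _ _))).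
  eapply Rle_trans; [apply Cmod_le_Re_Im|].
  replace (eps * Rabs h) with (eps / 2 * Rabs h + eps / 2 * Rabs h) by field.
  apply Rplus_le_compat.
  - eapply Rle_trans; [|apply H1]. apply Req_le; f_equal; unfold Re, Im; simpl; ring.
  - eapply Rle_trans; [|apply H2]. apply Req_le; f_equal; unfold Re, Im; simpl; ring.
Qed.

Lemma rderiv_line : forall (f : C -> C) (z w : C) (t : R) (l : C),
  cderiv f (z + t * w)%C l -> rderiv (fun s : R => f (z + s * w)%C) t (w * l)%C.
Proof.
  intros f z w t l H. apply rderiv_of_remainder. intros eps Heps.
  assert (Hw := Cmod_ge_0 w).
  destruct (cderiv_remainder _ _ _ H (eps / (Cmod w + 1))) as (d & Hd & Hh).
  { apply Rdiv_lt_0_compat; lra. }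
  exists (d / (Cmod w + 1)). split; [apply Rdiv_lt_0_compat; lra|].
  intros h Hb.
  assert (E : Cmod (h * w)%C = Rabs h * Cmod w) by (rewrite Cmod_mult, Cmod_R; reflexivity).
  assert (Hha := Rabs_pos h).
  specialize (Hh (h * w)%C). rewrite E in Hh.
  replace (f (z + (t + h)%R * w) - f (z + t * w) - h * (w * l))%C
    with (f (z + t * w + h * w) - f (z + t * w) - h * w * l)%C.
  - eapply Rle_trans; [apply Hh|].
    + apply (Rmult_lt_compat_r (Cmod w + 1)) in Hb; [|lra].
      unfold Rdiv in Hb; rewrite Rmult_assoc, Rinv_l in Hb by lra. nra.
    + unfold Rdiv. rewrite Rmult_assoc. apply Rmult_le_compat_l; [lra|].
      apply (Rmult_le_reg_l (Cmod w + 1)); [lra|].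
      rewrite <- Rmult_assoc, Rinv_r by lra. nra.
  - replace (z + (t + h)%R * w)%C with (z + t * w + h * w)%C
      by (rewrite RtoC_plus; ring).
    ring.
Qed.

Lemma rderiv_ext : forall f g t l, (forall s, f s = g s) -> rderiv f t l -> rderiv g t l.
Proof.
  intros f g t l E [H1 H2]; split.
  - apply is_derive_ext with (2 := H1). intros; rewrite E; reflexivity.
  - apply is_derive_ext with (2 := H2). intros; rewrite E; reflexivity.
Qed.

Lemma rderiv_scal : forall (k : C) f t (l : C), rderiv f t l ->
  rderiv (fun s => k * f s)%C t (k * l)%C.
Proof.
  intros [a b] f t l [H1 H2].
  split.
  - apply (is_derive_minus (fun s => a * Re (f s)) (fun s => b * Im (f s)));
      apply @is_derive_scal; assumption.
  - apply (is_derive_plus (fun s => a * Im (f s)) (fun s => b * Re (f s)));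
      apply @is_derive_scal; assumption.
Qed.

Definition rcont (f : R -> C) (t : R) : Prop :=
  continuous (fun s => Re (f s)) t /\ continuous (fun s => Im (f s)) t.

Lemma rderiv_rcont : forall f t l, rderiv f t l -> rcont f t.
Proof.
  intros f t l [H1 H2]; split; apply (ex_derive_continuous (V := R_NormedModule));
    eexists; eassumption.
Qed.

Lemma rcont_const : forall c t, rcont (fun _ => c) t.
Proof. intros; split; apply continuous_const. Qed.

Lemma rcont_RtoC : forall t, rcont (fun s => RtoC s) t.
Proof. intros; split; [apply continuous_id|apply continuous_const]. Qed.

Lemma rcont_plus : forall f g t, rcont f t -> rcont g t -> rcont (fun s => f s + g s)%C t.
Proof.
  intros f g t [H1 H2] [H3 H4]; split.
  - apply (continuous_plus (fun s => Re (f s)) (fun s => Re (g s))); assumption.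
  - apply (continuous_plus (fun s => Im (f s)) (fun s => Im (g s))); assumption.
Qed.

Lemma rcont_mult : forall f g t, rcont f t -> rcont g t -> rcont (fun s => f s * g s)%C t.
Proof.
  intros f g t [H1 H2] [H3 H4]; split.
  - apply (continuous_minus (fun s => Re (f s) * Re (g s)) (fun s => Im (f s) * Im (g s)));
      apply (continuous_mult (K := R_AbsRing)); assumption.
  - apply (continuous_plus (fun s => Re (f s) * Im (g s)) (fun s => Im (f s) * Re (g s)));
      apply (continuous_mult (K := R_AbsRing)); assumption.
Qed.

Lemma rcont_ext : forall f g t, (forall s, f s = g s) -> rcont f t -> rcont g t.
Proof.
  intros f g t E [H1 H2]; split.
  - eapply continuous_ext; [|exact H1]. intros; simpl; rewrite E; reflexivity.
  - eapply continuous_ext; [|exact H2]. intros; simpl; rewrite E; reflexivity.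
Qed.

Lemma rcont_opp : forall f t, rcont f t -> rcont (fun s => - f s)%C t.
Proof.
  intros f t H. apply rcont_ext with (fun s => - (1) * f s)%C; [intros; ring|].
  apply rcont_mult; [apply rcont_const|assumption].
Qed.

Lemma rcont_minus : forall f g t, rcont f t -> rcont g t -> rcont (fun s => f s - g s)%C t.
Proof. intros; apply rcont_plus; [assumption|apply rcont_opp; assumption]. Qed.

(** Purely syntactic, so that nothing is unfolded when a rule does not apply. *)
Ltac rcont_tac :=
  repeat lazymatch goal with
  | |- rcont (fun _ => ?c) _ => apply rcont_const
  | |- rcont (fun x => Cdiv (@?f x) (@?g x)) _ => unfold Cdiv
  | |- rcont (fun x => Cplus (@?f x) (@?g x)) _ => apply (rcont_plus f g)
  | |- rcont (fun x => Cminus (@?f x) (@?g x)) _ => apply (rcont_minus f g)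
  | |- rcont (fun x => Cmult (@?f x) (@?g x)) _ => apply (rcont_mult f g)
  | |- rcont (fun x => Copp (@?f x)) _ => apply (rcont_opp f)
  end.

(** * Integrals of complex-valued functions *)

Definition CInt (f : R -> C) (a b : R) : C :=
  (RInt (fun x => Re (f x)) a b, RInt (fun x => Im (f x)) a b).

Lemma ex_RInt_rcont : forall f a b, a <= b ->
  (forall x, a <= x <= b -> rcont f x) ->
  ex_RInt (fun x => Re (f x)) a b /\ ex_RInt (fun x => Im (f x)) a b.
Proof.
  intros f a b Hab H.
  split; apply (ex_RInt_continuous (V := R_CompleteNormedModule)); intros z Hz;
    rewrite Rmin_left, Rmax_right in Hz by assumption; apply H; assumption.
Qed.

Lemma CInt_ext : forall f g a b, a <= b -> (forall x, a <= x <= b -> f x = g x) ->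
  CInt f a b = CInt g a b.
Proof.
  intros f g a b Hab H; unfold CInt; f_equal; apply RInt_ext; intros x Hx;
    rewrite Rmin_left, Rmax_right in Hx by assumption; rewrite H by lra; reflexivity.
Qed.

Lemma CInt_plus : forall f g a b, a <= b ->
  (forall x, a <= x <= b -> rcont f x) -> (forall x, a <= x <= b -> rcont g x) ->
  CInt (fun x => f x + g x)%C a b = (CInt f a b + CInt g a b)%C.
Proof.
  intros f g a b Hab Hf Hg.
  destruct (ex_RInt_rcont f a b Hab Hf), (ex_RInt_rcont g a b Hab Hg).
  unfold CInt, Cplus; simpl; f_equal.
  - apply (RInt_plus (V := R_CompleteNormedModule)); assumption.
  - apply (RInt_plus (V := R_CompleteNormedModule)); assumption.
Qed.

Lemma CInt_scal : forall (k : C) f a b, a <= b ->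
  (forall x, a <= x <= b -> rcont f x) ->
  CInt (fun x => k * f x)%C a b = (k * CInt f a b)%C.
Proof.
  intros [p q] f a b Hab Hf.
  destruct (ex_RInt_rcont f a b Hab Hf) as [H1 H2].
  unfold CInt, Cmult, Re, Im in *; simpl.
  assert (S : forall (c : R) g, ex_RInt g a b ->
     ex_RInt (fun x => c * g x) a b /\ RInt (fun x => c * g x) a b = c * RInt g a b).
  { intros c g Hg. split.
    - apply (ex_RInt_scal (V := R_CompleteNormedModule)); assumption.
    - apply (RInt_scal (V := R_CompleteNormedModule)); assumption. }
  destruct (S p _ H1) as [A1 B1], (S p _ H2) as [A2 B2],
           (S q _ H1) as [A3 B3], (S q _ H2) as [A4 B4].
  f_equal.
  - etransitivity; [apply (RInt_minus (V := R_CompleteNormedModule)); eassumption|].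
    rewrite B1, B4; reflexivity.
  - etransitivity; [apply (RInt_plus (V := R_CompleteNormedModule)); eassumption|].
    rewrite B2, B3; reflexivity.
Qed.

Lemma CInt_minus : forall f g a b, a <= b ->
  (forall x, a <= x <= b -> rcont f x) -> (forall x, a <= x <= b -> rcont g x) ->
  CInt (fun x => f x - g x)%C a b = (CInt f a b - CInt g a b)%C.
Proof.
  intros f g a b Hab Hf Hg.
  rewrite (CInt_ext _ (fun x => f x + (-(1)) * g x)%C) by (auto; intros; ring).
  rewrite CInt_plus, CInt_scal; auto.
  - ring.
  - intros x Hx; apply rcont_mult; [apply rcont_const|auto].
Qed.

Lemma Rabs_RInt_le : forall f g a b, a <= b -> ex_RInt f a b -> ex_RInt g a b ->
  (forall x, a <= x <= b -> Rabs (f x) <= g x) -> Rabs (RInt f a b) <= RInt g a b.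
Proof.
  intros f g a b Hab Hf Hg H.
  eapply Rle_trans; [apply abs_RInt_le; assumption|].
  apply RInt_le; auto.
  - apply (ex_RInt_norm f); assumption.
  - intros; apply H; lra.
Qed.

(** The factor 2 is the price of integrating the two components separately. *)
Lemma Cmod_CInt_le : forall f g a b, a <= b ->
  (forall x, a <= x <= b -> rcont f x) -> ex_RInt g a b ->
  (forall x, a <= x <= b -> Cmod (f x) <= g x) -> Cmod (CInt f a b) <= 2 * RInt g a b.
Proof.
  intros f g a b Hab Hf Hg H.
  destruct (ex_RInt_rcont f a b Hab Hf).
  eapply Rle_trans; [apply Cmod_le_Re_Im|]. simpl.
  assert (Rabs (RInt (fun x => Re (f x)) a b) <= RInt g a b).
  { apply Rabs_RInt_le; auto. intros; eapply Rle_trans; [apply re_le_Cmod|auto]. }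
  assert (Rabs (RInt (fun x => Im (f x)) a b) <= RInt g a b).
  { apply Rabs_RInt_le; auto. intros; eapply Rle_trans; [apply im_le_Cmod|auto]. }
  lra.
Qed.

Definition rcont2 (G : R -> R -> C) (u v : R) : Prop :=
  continuity_2d_pt (fun u v => Re (G u v)) u v /\ continuity_2d_pt (fun u v => Im (G u v)) u v.

Lemma rcont2_mult : forall G H u v, rcont2 G u v -> rcont2 H u v ->
  rcont2 (fun u v => G u v * H u v)%C u v.
Proof.
  intros G H u v [H1 H2] [H3 H4]; split.
  - apply continuity_2d_pt_minus; apply continuity_2d_pt_mult; assumption.
  - apply continuity_2d_pt_plus; apply continuity_2d_pt_mult; assumption.
Qed.

Lemma rcont2_exp : forall G u v, rcont2 G u v -> rcont2 (fun u v => Cexp (G u v)) u v.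
Proof.
  intros G u v [H1 H2]; split; simpl; apply continuity_2d_pt_mult.
  - apply (continuity_1d_2d_pt_comp exp); [apply derivable_continuous_pt, derivable_pt_exp|assumption].
  - apply (continuity_1d_2d_pt_comp cos); [apply derivable_continuous_pt, derivable_pt_cos|assumption].
  - apply (continuity_1d_2d_pt_comp exp); [apply derivable_continuous_pt, derivable_pt_exp|assumption].
  - apply (continuity_1d_2d_pt_comp sin); [apply derivable_continuous_pt, derivable_pt_sin|assumption].
Qed.

Lemma rcont2_snd : forall f u v, rcont f v -> rcont2 (fun _ v => f v) u v.
Proof.
  intros f u v [H1 H2]; split;
    apply (continuity_1d_2d_pt_comp (fun x => _ (f x)) (fun _ v => v));
    try apply continuity_2d_pt_id2; apply continuity_pt_filterlim; assumption.
Qed.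

Lemma rcont2_fst : forall u v, rcont2 (fun u _ => RtoC u) u v.
Proof.
  intros u v; split; [apply continuity_2d_pt_id1|apply (continuity_2d_pt_const u v 0)].
Qed.

(** Differentiation under the integral sign. The unit margin around [a, b]
    leaves room for integrands that are singular elsewhere. *)
Lemma rderiv_CInt_param : forall (G G' : R -> R -> C) a b u, a <= b ->
  (forall u v, a - 1 < v < b + 1 -> rderiv (fun u => G u v) u (G' u v)) ->
  (forall u v, a - 1 < v < b + 1 -> rcont2 G' u v) ->
  (forall u v, a - 1 < v < b + 1 -> rcont (G u) v) ->
  rderiv (fun u => CInt (G u) a b) u (CInt (G' u) a b).
Proof.
  intros G G' a b u Hab HD HC H0.
  assert (Aux : forall g g' : R -> R -> R,
    (forall u v, a - 1 < v < b + 1 -> is_derive (fun u => g u v) u (g' u v)) ->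
    (forall u v, a - 1 < v < b + 1 -> continuity_2d_pt g' u v) ->
    (forall u v, a - 1 < v < b + 1 -> continuous (g u) v) ->
    is_derive (fun u => RInt (g u) a b) u (RInt (g' u) a b)).
  { intros g g' Hd Hc Hg.
    replace (RInt (g' u) a b) with (RInt (fun t => Derive (fun u => g u t) u) a b).
    2: { apply RInt_ext. intros x Hx. rewrite Rmin_left, Rmax_right in Hx by assumption.
         apply is_derive_unique, Hd; lra. }
    apply is_derive_RInt_param.
    - apply filter_forall; intros y t Ht. rewrite Rmin_left, Rmax_right in Ht by assumption.
      eexists; apply Hd; lra.
    - intros t Ht. rewrite Rmin_left, Rmax_right in Ht by assumption.
      apply continuity_2d_pt_ext_loc with g'; [|apply Hc; lra].
      exists (mkposreal 1 Rlt_0_1); simpl; intros u' v' _ Hv.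
      symmetry; apply is_derive_unique, Hd.
      apply Rabs_def2 in Hv; lra.
    - apply filter_forall; intros y.
      apply (ex_RInt_continuous (V := R_CompleteNormedModule)); intros z Hz.
      rewrite Rmin_left, Rmax_right in Hz by assumption. apply Hg; lra. }
  split.
  - apply (Aux (fun u v => Re (G u v)) (fun u v => Re (G' u v))); intros; [apply HD|apply HC|apply H0]; assumption.
  - apply (Aux (fun u v => Im (G u v)) (fun u v => Im (G' u v))); intros; [apply HD|apply HC|apply H0]; assumption.
Qed.

Lemma CInt_derive : forall f f' a b, a <= b ->
  (forall x, a <= x <= b -> rderiv f x (f' x)) ->
  (forall x, a <= x <= b -> rcont f' x) ->
  CInt f' a b = (f b - f a)%C.
Proof.
  intros f f' a b Hab HD HC. apply C_eq; simpl; apply is_RInt_unique.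
  - apply (is_RInt_derive (fun x => Re (f x))); intros x Hx;
      rewrite Rmin_left, Rmax_right in Hx by assumption; [apply HD|apply HC]; assumption.
  - apply (is_RInt_derive (fun x => Im (f x))); intros x Hx;
      rewrite Rmin_left, Rmax_right in Hx by assumption; [apply HD|apply HC]; assumption.
Qed.

Lemma rderiv_bound : forall (f f' : R -> C) a b B, a <= b ->
  (forall x, a <= x <= b -> rderiv f x (f' x)) ->
  (forall x, a <= x <= b -> Cmod (f' x) <= B) ->
  Cmod (f b - f a)%C <= 2 * B * (b - a).
Proof.
  intros f f' a b B Hab HD HB.
  assert (Aux : forall g g' : R -> R, (forall x, a <= x <= b -> is_derive g x (g' x)) ->
     (forall x, a <= x <= b -> Rabs (g' x) <= B) -> Rabs (g b - g a) <= B * (b - a)).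
  { intros g g' Hd Hb. destruct (MVT_gen g a b g') as (c & Hc & E).
    - rewrite Rmin_left, Rmax_right by assumption. intros; apply Hd; lra.
    - rewrite Rmin_left, Rmax_right by assumption. intros.
      apply continuity_pt_filterlim, (ex_derive_continuous (V := R_NormedModule)).
      eexists; apply Hd; lra.
    - rewrite Rmin_left, Rmax_right in Hc by assumption.
      rewrite E, Rabs_mult, (Rabs_pos_eq (b - a)) by lra.
      apply Rmult_le_compat_r; [lra|auto]. }
  eapply Rle_trans; [apply Cmod_le_Re_Im|].
  assert (Rabs (Re (f b - f a)%C) <= B * (b - a)).
  { apply (Aux (fun x => Re (f x)) (fun x => Re (f' x))); intros x Hx; [apply HD; assumption|].
    eapply Rle_trans; [apply re_le_Cmod|auto]. }
  assert (Rabs (Im (f b - f a)%C) <= B * (b - a)).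
  { apply (Aux (fun x => Im (f x)) (fun x => Im (f' x))); intros x Hx; [apply HD; assumption|].
    eapply Rle_trans; [apply im_le_Cmod|auto]. }
  lra.
Qed.

(** * Moving horizontal contours *)

(** Two derivatives are recorded because the second one makes the first one
    continuous, which is what differentiation under the integral asks for. *)
Definition hol (D : C -> Prop) (f : C -> C) : Prop :=
  exists f' f'' : C -> C, forall z, D z -> cderiv f z (f' z) /\ cderiv f' z (f'' z).

Lemma hol_const : forall D c, hol D (fun _ => c).
Proof.
  intros D c; exists (fun _ => 0%C), (fun _ => 0%C); intros; split; apply cderiv_const.
Qed.

Lemma hol_id : forall D, hol D (fun z => z).
Proof.
  intros D; exists (fun _ => 1%C), (fun _ => 0%C); intros; split;
    [apply cderiv_id|apply cderiv_const].
Qed.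

Lemma hol_plus : forall D f g, hol D f -> hol D g -> hol D (fun z => f z + g z)%C.
Proof.
  intros D f g (f1 & f2 & Hf) (g1 & g2 & Hg).
  exists (fun z => f1 z + g1 z)%C, (fun z => f2 z + g2 z)%C. intros z Hz.
  destruct (Hf z Hz), (Hg z Hz). split; apply cderiv_plus; assumption.
Qed.

Lemma hol_mult : forall D f g, hol D f -> hol D g -> hol D (fun z => f z * g z)%C.
Proof.
  intros D f g (f1 & f2 & Hf) (g1 & g2 & Hg).
  exists (fun z => f1 z * g z + f z * g1 z)%C,
    (fun z => (f2 z * g z + f1 z * g1 z) + (f1 z * g1 z + f z * g2 z))%C.
  intros z Hz. destruct (Hf z Hz), (Hg z Hz).
  split; [|apply cderiv_plus]; apply cderiv_mult; assumption.
Qed.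

Lemma hol_comp : forall D f g, hol D g -> hol (fun w => exists z, D z /\ w = g z) f ->
  hol D (fun z => f (g z)).
Proof.
  intros D f g (g1 & g2 & Hg) (f1 & f2 & Hf).
  exists (fun z => g1 z * f1 (g z))%C,
    (fun z => g2 z * f1 (g z) + g1 z * (g1 z * f2 (g z)))%C.
  intros z Hz. destruct (Hg z Hz) as [G1 G2].
  destruct (Hf (g z)) as [F1 F2]; [exists z; auto|].
  split; [apply cderiv_comp; assumption|].
  apply (cderiv_mult g1 (fun z => f1 (g z))); [assumption|].
  apply cderiv_comp; assumption.
Qed.

Lemma hol_exp : forall D g, hol D g -> hol D (fun z => Cexp (g z)).
Proof.
  intros D g Hg; apply hol_comp; [exact Hg|].
  exists Cexp, Cexp; intros; split; apply cderiv_exp.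
Qed.

Lemma hol_inv : forall (D : C -> Prop) g, hol D g -> (forall z, D z -> g z <> 0%C) ->
  hol D (fun z => / g z)%C.
Proof.
  intros D g Hg H0; apply hol_comp; [exact Hg|].
  exists (fun z => - (1) * (/ z * / z))%C.
  exists (fun z => 0 * (/ z * / z)
    + - (1) * (- (/ z * / z) * / z + / z * - (/ z * / z)))%C; intros w (z & Hz & ->); specialize (H0 z Hz). split.
  - replace (- (1) * (/ g z * / g z))%C with (- (/ g z * / g z))%C by ring.
    apply cderiv_inv; assumption.
  - apply (cderiv_mult (fun _ => - (1))%C (fun z => / z * / z)%C); [apply cderiv_const|].
    apply (cderiv_mult Cinv Cinv); apply cderiv_inv; assumption.
Qed.

Lemma cderiv_rcont2 : forall f (z : C) l, cderiv f z l ->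
  rcont2 (fun y x => f (x, y)) (Im z) (Re z).
Proof.
  intros f z l H.
  assert (Hc : forall eps, 0 < eps -> exists d, 0 < d /\ forall w : C, Cmod (w - z)%C < d ->
     Cmod (f w - f z)%C < eps).
  { intros eps Heps.
    destruct (cderiv_remainder _ _ _ H 1 Rlt_0_1) as (d & Hd & Hh).
    assert (Hl := Cmod_ge_0 l).
    exists (Rmin d (eps / (2 + Cmod l))). split.
    - apply Rmin_glb_lt; [assumption|]. apply Rdiv_lt_0_compat; lra.
    - intros w Hw.
      specialize (Hh _ (Rlt_le_trans _ _ _ Hw (Rmin_l _ _))).
      assert (Hw2 := Rlt_le_trans _ _ _ Hw (Rmin_r _ _)).
      rewrite Cplus_sub in Hh.
      assert (T := Cmod_triangle (f w - f z - (w - z) * l)%C ((w - z) * l)%C).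
      replace (f w - f z - (w - z) * l + (w - z) * l)%C with (f w - f z)%C in T by ring.
      rewrite Cmod_mult in T.
      assert (Hp := Cmod_ge_0 (w - z)%C).
      apply (Rmult_lt_compat_r (2 + Cmod l)) in Hw2; [|lra].
      unfold Rdiv in Hw2; rewrite Rmult_assoc, Rinv_l in Hw2 by lra. nra. }
  assert (Hd2 : forall eps, 0 < eps -> exists d : posreal, forall y x,
     Rabs (y - Im z) < d -> Rabs (x - Re z) < d -> Cmod (f (x, y) - f z)%C < eps).
  { intros eps Heps. destruct (Hc eps Heps) as (d & Hd & Hw).
    assert (Hd' : 0 < d / 2) by lra. exists (mkposreal _ Hd'); simpl.
    intros y x Hy Hx. apply Hw.
    eapply Rle_lt_trans; [apply Cmod_le_Re_Im|]. simpl.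
    replace (x + - fst z) with (x - Re z) by (unfold Re; ring).
    replace (y + - snd z) with (y - Im z) by (unfold Im; ring). lra. }
  split; intros eps; destruct (Hd2 eps (cond_pos eps)) as [d Hd]; exists d; intros y x Hy Hx;
    specialize (Hd y x Hy Hx); destruct z as [zx zy]; simpl in *.
  - eapply Rle_lt_trans; [|exact Hd]. apply (re_le_Cmod (f (x, y) - f (zx, zy))%C).
  - eapply Rle_lt_trans; [|exact Hd]. apply (im_le_Cmod (f (x, y) - f (zx, zy))%C).
Qed.

Lemma point_as_line : forall x y : R, (x, y) = (RtoC x + RtoC y * Ci)%C.
Proof. intros; apply C_eq; simpl; ring. Qed.

Lemma point_as_line' : forall x y : R, (x, y) = ((0, y) + RtoC x * 1)%C.
Proof. intros; apply C_eq; simpl; ring. Qed.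

Lemma cderiv_vertical : forall f x y l, cderiv f (x, y) l ->
  rderiv (fun y => f (x, y)) y (Ci * l)%C.
Proof.
  intros f x y l H. apply rderiv_ext with (fun y => f (RtoC x + RtoC y * Ci)%C).
  - intros; rewrite <- point_as_line; reflexivity.
  - apply rderiv_line. rewrite <- point_as_line; assumption.
Qed.

Lemma cderiv_horizontal : forall f x y l, cderiv f (x, y) l ->
  rderiv (fun x => f (x, y)) x l.
Proof.
  intros f x y l H. replace l with (1 * l)%C by ring.
  apply rderiv_ext with (fun x => f ((0, y) + RtoC x * 1)%C).
  - intros; rewrite <- point_as_line'; reflexivity.
  - apply rderiv_line. rewrite <- point_as_line'; assumption.
Qed.

(** The horizontal margin matches the one in [rderiv_CInt_param]. *)
Definition strip (a b : R) (z : C) : Prop := a - 1 < Re z < b + 1.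

Lemma hol_rcont : forall a b f, hol (strip a b) f ->
  forall y x, a - 1 < x < b + 1 -> rcont (fun x => f (x, y)) x.
Proof.
  intros a b f (f1 & f2 & H) y x Hx.
  apply rderiv_rcont with (f1 (x, y)), cderiv_horizontal, H. exact Hx.
Qed.

(** Cauchy's theorem on a rectangle: the two horizontal integrals differ by the
    contribution of the vertical sides. The derivative in [y] of the integral
    along height [y] is itself a boundary term by the Cauchy-Riemann equations. *)
Lemma contour_shift : forall f a b y1 y2 B, a <= b -> y1 <= y2 ->
  hol (strip a b) f ->
  (forall y, y1 <= y <= y2 -> Cmod (f (a, y)) <= B /\ Cmod (f (b, y)) <= B) ->
  Cmod (CInt (fun x => f (x, y2)) a b - CInt (fun x => f (x, y1)) a b)%C <= 4 * B * (y2 - y1).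
Proof.
  intros f a b y1 y2 B Hab Hy Hf HB.
  assert (Hcont := hol_rcont a b f Hf).
  destruct Hf as (f1 & f2 & Hf).
  assert (Hf1 : forall y x, a - 1 < x < b + 1 -> rcont (fun x => f1 (x, y)) x).
  { intros y x Hx. apply rderiv_rcont with (f2 (x, y)), cderiv_horizontal, Hf. exact Hx. }
  replace (4 * B) with (2 * (2 * B)) by ring.
  apply (rderiv_bound (fun y => CInt (fun x => f (x, y)) a b)
           (fun y => CInt (fun x => Ci * f1 (x, y))%C a b)); [assumption| |].
  - intros y _. apply (rderiv_CInt_param (fun y x => f (x, y)) (fun y x => Ci * f1 (x, y))%C).
    + assumption.
    + intros u v Hv. apply cderiv_vertical, Hf. exact Hv.
    + intros u v Hv. apply rcont2_mult; [apply rcont2_snd, rcont_const|].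
      apply (cderiv_rcont2 f1 (v, u) (f2 (v, u))), Hf. exact Hv.
    + intros u v Hv. apply Hcont; assumption.
  - intros y Hy'. rewrite CInt_scal; [|assumption|intros; apply Hf1; lra].
    rewrite (CInt_derive (fun x => f (x, y))); [|assumption| |].
    + destruct (HB y Hy') as [Ha Hb].
      rewrite Cmod_mult, Cmod_Ci, Rmult_1_l.
      unfold Cminus. eapply Rle_trans; [apply Cmod_triangle|]. rewrite Cmod_opp. lra.
    + intros x Hx. apply cderiv_horizontal, Hf. unfold strip; simpl; lra.
    + intros; apply Hf1; lra.
Qed.

Lemma rcont_Cmod : forall f t, rcont f t -> continuous (fun s => Cmod (f s)) t.
Proof.
  intros f t [H1 H2]. unfold Cmod.
  apply (continuous_comp (fun s => fst (f s) ^ 2 + snd (f s) ^ 2) sqrt); [|apply continuous_sqrt].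
  assert (Sq : forall g : R -> R, continuous g t -> continuous (fun s => g s ^ 2) t).
  { intros g Hg. apply continuous_ext with (fun s => g s * g s); [intros; simpl; ring|].
    apply (continuous_mult (K := R_AbsRing)); assumption. }
  apply (continuous_plus (fun s => fst (f s) ^ 2) (fun s => snd (f s) ^ 2));
    apply Sq; assumption.
Qed.

Lemma rcont_comp : forall f g t l, rcont f t -> cderiv g (f t) l -> rcont (fun s => g (f s)) t.
Proof.
  intros f g t l [H1 H2] Hg.
  destruct (cderiv_rcont2 _ _ _ Hg) as [G1 G2].
  apply continuity_2d_pt_filterlim in G1. apply continuity_2d_pt_filterlim in G2.
  apply rcont_ext with (fun s => g (Re (f s), Im (f s))); [intros s; destruct (f s); reflexivity|].
  split.
  - apply (continuous_comp_2 (fun s => Im (f s)) (fun s => Re (f s)) (fun y x => Re (g (x, y))));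
      assumption.
  - apply (continuous_comp_2 (fun s => Im (f s)) (fun s => Re (f s)) (fun y x => Im (g (x, y))));
      assumption.
Qed.

Lemma rcont_exp : forall f t, rcont f t -> rcont (fun s => Cexp (f s)) t.
Proof. intros; eapply rcont_comp; [assumption|apply cderiv_exp]. Qed.

Lemma rcont_inv : forall f t, rcont f t -> f t <> 0%C -> rcont (fun s => / f s)%C t.
Proof. intros; eapply rcont_comp; [assumption|apply cderiv_inv; assumption]. Qed.

(** * Exponential integrals and their Laplace transforms *)

Section ExponentialIntegral.

Context (k zeta : R -> C) (a b : R).
Hypothesis Hab : a <= b.
Hypothesis Hk : forall x, rcont k x.
Hypothesis Hz : forall x, rcont zeta x.

Definition expint (s : R) : C := CInt (fun x => k x * Cexp (s * zeta x))%C a b.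

Lemma expint_integrand_rcont : forall (s x : R), rcont (fun x => k x * Cexp (s * zeta x))%C x.
Proof.
  intros; apply rcont_mult; [apply Hk|]. apply rcont_exp, rcont_mult; [apply rcont_const|apply Hz].
Qed.

End ExponentialIntegral.

Lemma expint_derive : forall k zeta a b s, a <= b ->
  (forall x, rcont k x) -> (forall x, rcont zeta x) ->
  rderiv (expint k zeta a b) s (expint (fun x => k x * zeta x)%C zeta a b s).
Proof.
  intros k zeta a b s Hab Hk Hz. unfold expint.
  apply (rderiv_CInt_param (fun (s x : R) => k x * Cexp (s * zeta x))%C
           (fun (s x : R) => k x * zeta x * Cexp (s * zeta x))%C); [assumption| | |].
  - intros u v _.
    replace (k v * zeta v * Cexp (u * zeta v))%C with (k v * (zeta v * Cexp (u * zeta v)))%C by ring.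
    apply rderiv_scal.
    apply rderiv_ext with (fun s : R => Cexp (0 + s * zeta v)%C).
    + intros; f_equal; ring.
    + replace (Cexp (u * zeta v)) with (Cexp (0 + u * zeta v)%C) by (f_equal; ring).
      apply rderiv_line, cderiv_exp.
  - intros u v _. apply rcont2_mult.
    + apply rcont2_snd. apply rcont_mult; auto.
    + apply rcont2_exp. apply rcont2_mult; [apply rcont2_fst|apply rcont2_snd; auto].
  - intros u v _. apply expint_integrand_rcont; assumption.
Qed.

Lemma Cexp_opp_mult : forall z, (Cexp (- z) * Cexp z = 1)%C.
Proof.
  intros z; rewrite <- Cexp_plus. replace (- z + z)%C with (RtoC 0) by ring. apply Cexp_0.
Qed.

Section Laplace.

Context (k zeta : R -> C) (a b eta : R) (lam : C).
Hypothesis Hab : a <= b.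
Hypothesis Hk : forall x, rcont k x.
Hypothesis Hz : forall x, rcont zeta x.
Hypothesis Hre : forall x, Re (zeta x) = - eta.
Hypothesis Hlam : - eta < Re lam.

Lemma resolvent_nonzero : forall x, (lam - zeta x)%C <> 0%C.
Proof.
  intros x E. apply (f_equal Re) in E. specialize (Hre x).
  unfold Re in *; simpl in *. lra.
Qed.

Lemma resolvent_rcont : forall x, rcont (fun x => k x / (lam - zeta x))%C x.
Proof.
  intros x; apply rcont_mult; [apply Hk|]. apply rcont_inv; [|apply resolvent_nonzero].
  apply rcont_plus; [apply rcont_const|].
  apply rcont_ext with (fun s => - (1) * zeta s)%C; [intros; ring|].
  apply rcont_mult; [apply rcont_const|apply Hz].
Qed.

(** Up to time [T] the transform is [int k (1 - exp (- T (lam - zeta))) / (lam - zeta)],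
    by differentiation in [T]; the second term dies out since
    [Re (lam - zeta) = Re lam + eta > 0]. *)
Lemma laplace_expint : exists Q, forall T, 0 <= T ->
  Cmod (CInt (fun s => Cexp (- (lam * s)) * expint k zeta a b s)%C 0 T
        - CInt (fun x => k x / (lam - zeta x))%C a b)%C <= Q * exp (- (Re lam + eta) * T).
Proof.
  set (w := fun x => (- (lam - zeta x))%C).
  assert (Hw : forall x, rcont w x).
  { intros x. apply rcont_ext with (fun s => - lam + zeta s)%C; [intros; unfold w; ring|].
    apply rcont_plus; [apply rcont_const|apply Hz]. }
  set (m := fun x => (k x / (lam - zeta x))%C).
  assert (Hm := resolvent_rcont : forall x, rcont m x).
  exists (2 * RInt (fun x => Cmod (m x)) a b). intros T HT.
  assert (E : CInt (fun s => Cexp (- (lam * s)) * expint k zeta a b s)%C 0 T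
              = (CInt m a b - expint m w a b T)%C).
  { rewrite (CInt_derive (fun s => (- (1)) * expint m w a b s)%C).
    - unfold expint at 2.
      rewrite (CInt_ext (fun x => m x * Cexp (RtoC 0 * w x))%C m); [ring|assumption|].
      intros x _. replace (RtoC 0 * w x)%C with (RtoC 0) by ring. rewrite Cexp_0; ring.
    - assumption.
    - intros s _.
      replace (Cexp (- (lam * s)) * expint k zeta a b s)%C
        with (- (1) * expint (fun x => m x * w x)%C w a b s)%C.
      + apply rderiv_scal, expint_derive; auto.
      + unfold expint. rewrite <- !CInt_scal; try assumption.
        * apply CInt_ext; [assumption|]. intros x _.
          replace (s * w x)%C with (- (lam * s) + s * zeta x)%C by (unfold w; ring).
          rewrite Cexp_plus. unfold m, w. field. apply resolvent_nonzero.
        * intros; apply expint_integrand_rcont; assumption.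
        * intros; apply expint_integrand_rcont; auto.
          intros; apply rcont_mult; auto.
    - intros s _. apply rcont_mult.
      + apply rcont_exp. apply rcont_ext with (fun s => (- lam) * RtoC s)%C; [intros; ring|].
        apply rcont_mult; [apply rcont_const|apply rcont_RtoC].
      + eapply rderiv_rcont, expint_derive; auto. }
  rewrite E. fold m.
  replace (CInt m a b - expint m w a b T - CInt m a b)%C with (- expint m w a b T)%C by ring.
  rewrite Cmod_opp. unfold expint.
  assert (HI : ex_RInt (fun x => Cmod (m x)) a b).
  { apply (ex_RInt_continuous (V := R_CompleteNormedModule)); intros; apply rcont_Cmod, Hm. }
  rewrite Rmult_assoc, (Rmult_comm (RInt _ _ _)).
  rewrite <- (RInt_scal (V := R_CompleteNormedModule) (fun x => Cmod (m x))) by assumption.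
  apply Cmod_CInt_le; [assumption| | |].
  - intros; apply expint_integrand_rcont; auto.
  - apply (ex_RInt_scal (V := R_CompleteNormedModule)); assumption.
  - intros x _. rewrite Cmod_mult, Cmod_Cexp, Rmult_comm. apply Req_le.
    unfold scal; simpl; unfold mult; simpl. f_equal. f_equal.
    specialize (Hre x). unfold w, Re in *; simpl. rewrite Hre; ring.
Qed.

End Laplace.

(** * A double-exponentially small bump with analytic continuation *)

Lemma cos_ge_half : forall v, Rabs v <= 1 -> / 2 <= cos v.
Proof.
  intros v Hv. replace v with (2 * (v / 2)) by field. rewrite cos_2a_sin.
  assert (Hs : (sin (v / 2)) ^ 2 <= Rabs (v / 2) ^ 2).
  { apply pow_maj_Rabs, Rabs_sin_le. }
  rewrite pow2_abs in Hs. apply Rabs_le_between in Hv. nra.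
Qed.

(** This is [exp (- 2 cosh (c z))]. *)
Definition bump (c : R) (z : C) : C := Cexp (- (Cexp (c * z) + Cexp (- (c * z)))).

Lemma hol_bump : forall D c, hol D (bump c).
Proof.
  intros D c. unfold bump.
  assert (H : hol D (fun z => Cexp ((- (1)) * (Cexp (c * z) + Cexp ((- (1)) * (c * z))))%C)).
  { apply hol_exp, hol_mult; [apply hol_const|].
    assert (H : hol D (fun z => c * z)%C) by (apply hol_mult; [apply hol_const|apply hol_id]).
    apply hol_plus; apply hol_exp; [exact H|].
    apply hol_mult; [apply hol_const|exact H]. }
  assert (E : (fun z => Cexp ((- (1)) * (Cexp (c * z) + Cexp ((- (1)) * (c * z))))%C)
              = (fun z => Cexp (- (Cexp (c * z) + Cexp (- (c * z)))))).
  { apply FunctionalExtensionality.functional_extensionality; intros z.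
    f_equal. replace (- (1) * (c * z))%C with (- (c * z))%C by ring. ring. }
  rewrite <- E; exact H.
Qed.

Lemma bump_bound : forall c x y, Rabs (c * y) <= 1 ->
  Cmod (bump c (x, y)) <= exp (- ((exp (c * x) + exp (- (c * x))) / 2)).
Proof.
  intros c x y H. unfold bump. rewrite Cmod_Cexp.
  assert (E : Re (- (Cexp (c * (x, y)) + Cexp (- (c * (x, y)))))%C
     = - ((exp (c * x) + exp (- (c * x))) * cos (c * y))).
  { unfold Cexp, Re, Im; simpl.
    replace (c * x - 0 * y) with (c * x) by ring.
    replace (c * y + 0 * x) with (c * y) by ring. rewrite cos_neg. ring. }
  rewrite E. assert (H2 := cos_ge_half _ H).
  assert (H3 := exp_pos (c * x)). assert (H4 := exp_pos (- (c * x))).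
  apply exp_le_compat. nra.
Qed.

(** A majorant with an explicit antiderivative is enough, since only the order of
    magnitude of the integral of the bump matters. *)
Lemma double_exp_le_lorentzian : forall v,
  exp (- ((exp v + exp (- v)) / 2)) <= / (1 + (v / 3) ^ 2).
Proof.
  assert (Pos : forall v, 0 <= v -> 1 + v ^ 2 / 4 <= exp v).
  { intros v Hv. replace v with (v / 2 + v / 2) at 2 by field. rewrite exp_plus.
    assert (H := exp_ineq1_le (v / 2)). nra. }
  intros v. rewrite exp_Ropp. apply Rinv_le_contravar; [assert (H := pow2_ge_0 (v / 3)); lra|].
  eapply Rle_trans; [|apply exp_ineq1_le].
  assert (H1 := exp_pos v). assert (H2 := exp_pos (- v)).
  destruct (Rle_dec 0 v) as [Hv|Hv].
  - specialize (Pos v Hv). nra.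
  - assert (Hv' : 0 <= - v) by lra. specialize (Pos _ Hv'). nra.
Qed.

Lemma RInt_lorentzian : forall k t a b, 0 < k -> a <= b ->
  ex_RInt (fun x => / (1 + (k * (x - t)) ^ 2)) a b /\
  RInt (fun x => / (1 + (k * (x - t)) ^ 2)) a b <= 4 / k.
Proof.
  intros k t a b Hk Hab.
  assert (H : is_RInt (fun x => / (1 + (k * (x - t)) ^ 2)) a b
    (minus (/ k * atan (k * (b - t))) (/ k * atan (k * (a - t))))).
  { apply (is_RInt_derive (fun x => / k * atan (k * (x - t)))).
    - intros x _. auto_derive; auto. field. split; [|lra].
      assert (H0 := pow2_ge_0 (k * (x - t))). nra.
    - intros x _. apply (ex_derive_continuous (V := R_NormedModule)).
      auto_derive. assert (H0 := pow2_ge_0 (k * (x - t))). nra. }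
  split; [eexists; exact H|].
  rewrite (is_RInt_unique _ _ _ _ H). unfold minus, plus, opp; simpl.
  assert (H1 := atan_bound (k * (b - t))). assert (H2 := atan_bound (k * (a - t))).
  assert (H3 := PI_4). unfold Rdiv. rewrite (Rmult_comm 4).
  assert (0 < / k) by (apply Rinv_0_lt_compat; assumption). nra.
Qed.

(** The factor [exp (v * i (z + Y))] has modulus [exp (- v Im z)]: for [v >= 0]
    the line [Im z = eta] already gives decay, and for [v < 0] the line is moved
    to [Im z = - eta], the vertical sides being negligible as long as [- v <= t].
    The analytic weight [q] covers at once the packet, its derivatives, its
    Laplace transform at low frequencies and the Taylor remainder of the latter.
    In the constant, [24 eta] is the integral along a line and [8 eta] comes from
    the sides. *)
Lemma bump_integral_bound : forall eta X t, 0 < eta -> 0 <= X -> 0 <= t ->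
  exp (- (exp (/ eta * X) / 2)) <= exp (- (2 * eta * t)) ->
  forall Y Q q, 0 <= Q -> hol (strip (- X) X) q ->
  (forall x y, - X <= x <= X -> Rabs y <= eta -> Cmod (q (x, y)) <= Q) ->
  forall v, - t <= v ->
  Cmod (CInt (fun x => Cexp (v * (Ci * ((x, eta) + RtoC Y))) * bump (/ eta) (x, eta) * q (x, eta))%C
          (- X) X) <= 32 * eta * Q * exp (- eta * Rabs v).
Proof.
  intros eta X t Heta HX Ht Hsmall Y Q q HQ Hq HqQ v Hv.
  set (c := / eta). assert (Hc : 0 < c) by (apply Rinv_0_lt_compat; assumption).
  assert (Hce : c * eta = 1) by (unfold c; field; lra).
  set (P := fun z => (Cexp (v * (Ci * (z + RtoC Y))) * bump c z * q z)%C).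
  assert (HP : hol (strip (- X) X) P).
  { apply hol_mult; [apply hol_mult|exact Hq]; [|apply hol_bump].
    apply hol_exp. apply hol_mult; [apply hol_const|]. apply hol_mult; [apply hol_const|].
    apply hol_plus; [apply hol_id|apply hol_const]. }
  assert (Hcy : forall y, Rabs y <= eta -> Rabs (c * y) <= 1).
  { intros y Hy. rewrite Rabs_mult, (Rabs_pos_eq c) by lra.
    apply Rmult_le_compat_l with (r := c) in Hy; lra. }
  assert (HE : forall x y, Cmod (Cexp (v * (Ci * ((x, y) + RtoC Y)))%C) = exp (- (v * y))).
  { intros x y. rewrite Cmod_Cexp. f_equal. unfold Re; simpl. ring. }
  assert (Hm : forall x y, - X <= x <= X -> Rabs y <= eta ->
     Cmod (P (x, y)) <= exp (- (v * y)) * Q * exp (- ((exp (c * x) + exp (- (c * x))) / 2))).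
  { intros x y Hx Hy. unfold P. rewrite !Cmod_mult, HE.
    assert (B1 := bump_bound c x y (Hcy y Hy)). assert (B2 := HqQ x y Hx Hy).
    assert (B3 := exp_pos (- (v * y))).
    assert (B4 := Cmod_ge_0 (bump c (x, y))). assert (B5 := Cmod_ge_0 (q (x, y))).
    rewrite !Rmult_assoc. apply Rmult_le_compat_l; [lra|]. rewrite (Rmult_comm Q).
    apply Rmult_le_compat; assumption. }
  assert (Hline : forall y, Rabs y <= eta ->
     Cmod (CInt (fun x => P (x, y)) (- X) X) <= 24 * eta * Q * exp (- (v * y))).
  { intros y Hy.
    destruct (RInt_lorentzian (c / 3) 0 (- X) X) as [I1 I2]; [lra|lra|].
    eapply Rle_trans.
    - apply (Cmod_CInt_le _ (fun x => (exp (- (v * y)) * Q) * / (1 + (c / 3 * (x - 0)) ^ 2))); [lra| | |].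
      + intros x Hx. apply (hol_rcont _ _ P HP). lra.
      + apply (ex_RInt_scal (V := R_CompleteNormedModule)); assumption.
      + intros x Hx. eapply Rle_trans; [apply Hm; assumption|].
        apply Rmult_le_compat_l; [apply Rmult_le_pos; [apply Rlt_le, exp_pos|assumption]|].
        replace (c / 3 * (x - 0)) with (c * x / 3) by field. apply double_exp_le_lorentzian.
    - rewrite (RInt_scal (V := R_CompleteNormedModule)) by assumption.
      unfold scal; simpl; unfold mult; simpl.
      replace (4 / (c / 3)) with (12 * eta) in I2 by (unfold c; field; lra).
      assert (0 <= exp (- (v * y)) * Q) by (apply Rmult_le_pos; [apply Rlt_le, exp_pos|assumption]).
      assert (H0 := Rmult_le_compat_l _ _ _ H I2). simpl in H0. lra. }
  change (Cmod (CInt (fun x => P (x, eta)) (- X) X) <= 32 * eta * Q * exp (- eta * Rabs v)).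
  assert (HeQ : 0 <= eta * Q) by (apply Rmult_le_pos; lra).
  destruct (Rle_dec 0 v) as [Hv0|Hv0].
  - rewrite (Rabs_pos_eq v) by assumption.
    eapply Rle_trans; [apply Hline; rewrite Rabs_pos_eq; lra|].
    replace (- eta * v) with (- (v * eta)) by ring. assert (H0 := exp_pos (- (v * eta))). nra.
  - rewrite (Rabs_left v) by lra.
    assert (HS := contour_shift P (- X) X (- eta) eta (Q * exp (eta * v))).
    assert (Hsum := Cmod_sub_ge (CInt (fun x => P (x, eta)) (- X) X) (CInt (fun x => P (x, (- eta)%R)) (- X) X)).
    assert (H1 := Hline (- eta)). rewrite Rabs_Ropp, Rabs_pos_eq in H1 by lra.
    replace (- (v * - eta)) with (eta * v) in H1 by ring.
    replace (- eta * - v) with (eta * v) by ring.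
    assert (H2 : Cmod (CInt (fun x => P (x, eta)) (- X) X - CInt (fun x => P (x, (- eta)%R)) (- X) X)%C
      <= 4 * (Q * exp (eta * v)) * (eta - - eta)).
    { apply HS; [lra|lra|exact HP|].
      assert (Side : forall x y, - eta <= y <= eta -> (x = X \/ x = - X) ->
        Cmod (P (x, y)) <= Q * exp (eta * v)).
      { intros x y Hy Hx.
        eapply Rle_trans; [apply Hm|]; [destruct Hx; lra|apply Rabs_le; lra|].
        assert (G : exp (- ((exp (c * x) + exp (- (c * x))) / 2)) <= exp (- (2 * eta * t))).
        { eapply Rle_trans; [|exact Hsmall]. fold c. apply exp_le_compat.
          assert (Hp1 := exp_pos (c * x)). assert (Hp2 := exp_pos (- (c * x))).
          destruct Hx; subst x.
          - lra.
          - replace (- (c * - X)) with (c * X) in * by ring. lra. }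
        rewrite (Rmult_comm _ Q), Rmult_assoc. apply Rmult_le_compat_l; [assumption|].
        eapply Rle_trans; [apply Rmult_le_compat_l; [apply Rlt_le, exp_pos|exact G]|].
        rewrite <- exp_plus. apply exp_le_compat. nra. }
      intros y Hy; split; apply Side; auto. }
    specialize (H1 (Rle_refl _)). lra.
Qed.

(** On the real axis the bump is positive, and moving the contour there from
    height [eta] costs only the vertical sides. *)
Lemma bump_integral_lower : forall eta X, 1 <= eta -> 1 <= X ->
  8 * eta * exp (- (exp (/ eta * X) / 2)) <= exp (-6) ->
  exp (-6) <= Cmod (CInt (fun x => bump (/ eta) (x, eta)) (- X) X).
Proof.
  intros eta X Heta HX Hsmall.
  set (c := / eta) in *. assert (Hc : 0 < c) by (apply Rinv_0_lt_compat; lra).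
  assert (Hce : c * eta = 1) by (unfold c; field; lra).
  assert (Hc1 : c <= 1) by nra.
  assert (HS := contour_shift (bump c) (- X) X 0 eta (exp (- (exp (c * X) / 2)))).
  assert (H2 : Cmod (CInt (fun x => bump c (x, eta)) (- X) X - CInt (fun x => bump c (x, 0)) (- X) X)%C
     <= exp (-6)).
  { eapply Rle_trans; [apply HS|]; [lra|lra|apply hol_bump| |].
    - assert (Side : forall x y, 0 <= y <= eta -> (x = X \/ x = - X) ->
        Cmod (bump c (x, y)) <= exp (- (exp (c * X) / 2))).
      { intros x y Hy Hx. eapply Rle_trans; [apply bump_bound|].
        - rewrite Rabs_mult, !Rabs_pos_eq by lra. nra.
        - apply exp_le_compat.
          assert (Hp1 := exp_pos (c * x)). assert (Hp2 := exp_pos (- (c * x))).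
          destruct Hx; subst x.
          + lra.
          + replace (- (c * - X)) with (c * X) in * by ring. lra. }
      intros y Hy; split; apply Side; auto.
    - assert (H0 := exp_pos (- (exp (c * X) / 2))). nra. }
  set (g := fun x => exp (- (exp (c * x) + exp (- (c * x))))).
  assert (Hre : forall x, Re (bump c (x, 0)) = g x).
  { intros x. unfold bump, Cexp, g, Re, Im; simpl.
    replace (c * x - 0 * 0) with (c * x) by ring.
    replace (c * 0 + 0 * x) with 0 by ring.
    rewrite Ropp_0, !sin_0, !cos_0, !Rmult_1_r, !Rmult_0_r.
    replace (- (0 + 0)) with 0 by ring. rewrite cos_0, Rmult_1_r. reflexivity. }
  assert (Hgc : forall a b, ex_RInt g a b).
  { intros a b. apply (ex_RInt_continuous (V := R_CompleteNormedModule)). intros z _.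
    apply (ex_derive_continuous (V := R_NormedModule)). unfold g. auto_derive. auto. }
  assert (Hg0 : forall x, 0 <= g x) by (intros; apply Rlt_le, exp_pos).
  assert (Hl : 2 * exp (-6) <= Re (CInt (fun x => bump c (x, 0)) (- X) X)).
  { unfold CInt; cbn [Re fst]. rewrite (RInt_ext _ g) by (intros; apply Hre).
    rewrite <- (RInt_Chasles g (- X) (-1) X), <- (RInt_Chasles g (-1) 1 X) by apply Hgc.
    unfold plus; simpl.
    assert (0 <= RInt g (- X) (-1)) by (apply RInt_ge_0; auto; lra).
    assert (0 <= RInt g 1 X) by (apply RInt_ge_0; auto; lra).
    assert (RInt (fun _ => exp (-6)) (-1) 1 <= RInt g (-1) 1).
    { apply RInt_le; auto; [lra|apply ex_RInt_const|]. intros x Hx. unfold g.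
      apply exp_le_compat.
      assert (A1 : exp (c * x) <= exp 1) by (apply exp_le_compat; nra).
      assert (A2 : exp (- (c * x)) <= exp 1) by (apply exp_le_compat; nra).
      assert (A3 := exp_le_3). lra. }
    rewrite RInt_const in H1. unfold scal in H1; simpl in H1; unfold mult in H1; simpl in H1. lra. }
  assert (T := Cmod_sub_ge (CInt (fun x => bump c (x, 0)) (- X) X) (CInt (fun x => bump c (x, eta)) (- X) X)).
  rewrite <- Cmod_opp in H2.
  replace (- (CInt (fun x => bump c (x, eta)) (- X) X - CInt (fun x => bump c (x, 0)) (- X) X))%C
    with (CInt (fun x => bump c (x, 0)) (- X) X - CInt (fun x => bump c (x, eta)) (- X) X)%C in H2 by ring.
  assert (T2 := re_le_Cmod (CInt (fun x => bump c (x, 0)) (- X) X)).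
  assert (T3 := Rle_abs (Re (CInt (fun x => bump c (x, 0)) (- X) X))).
  lra.
Qed.

(** * Wave packets *)

Definition converges_at_infinity (g : R -> C) (l : C) : Prop :=
  forall eps, 0 < eps -> exists T0, 0 <= T0 /\ forall T, T0 <= T -> Cmod (g T - l)%C <= eps.

Definition has_laplace (f : R -> C) (lam l : C) : Prop :=
  converges_at_infinity (fun T => CInt (fun s => Cexp (- (lam * s)) * f s)%C 0 T) l.

(** What the superposition needs to know about a packet [f] of frequency [rho] at
    time [t] with transform [F]; [f1] and [F1] are the derivatives. The constants
    [C0] and [c0] do not depend on [rho] and [t], whereas the Lipschitz constant
    of [f1] does. The fields about the range [|Im lam| <= rho] are the ones that
    make a series of transforms converge. *)
Record wave (C0 c0 eta rho t : R) (f f1 : R -> C) (F F1 : C -> C) : Prop := {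
  wave_size : forall s, 0 <= s -> Cmod (f s) <= C0 / rho * exp (- eta * Rabs (s - t));
  wave_size1 : forall s, 0 <= s -> Cmod (f1 s) <= C0 * exp (- eta * Rabs (s - t));
  wave_derive : forall s, rderiv f s (f1 s);
  wave_rcont1 : forall s, rcont f1 s;
  wave_lip1 : exists L, forall s u, 0 <= s -> s <= u -> Cmod (f1 u - f1 s)%C <= L * (u - s);
  wave_peak : c0 / rho <= Cmod (f t);
  wave_cderiv : forall lam, - eta < Re lam -> cderiv F lam (F1 lam);
  wave_low : forall lam, - eta < Re lam -> Rabs (Im lam) <= rho ->
    Cmod (F lam) <= C0 /\ Cmod (lam * F lam)%C <= C0 /\ Cmod (F1 lam) <= C0;
  wave_low2 : forall lam h, - eta < Re lam -> - eta < Re (lam + h)%C ->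
    Rabs (Im lam) <= rho -> Rabs (Im (lam + h)%C) <= rho ->
    Cmod (F (lam + h) - F lam - h * F1 lam)%C <= C0 * Cmod h ^ 2;
  wave_laplace : forall lam, - eta < Re lam -> has_laplace f lam (F lam);
  wave_laplace1 : forall lam, - eta < Re lam -> has_laplace f1 lam (lam * F lam - f 0)%C
}.

Arguments wave_size {C0 c0 eta rho t f f1 F F1}.
Arguments wave_size1 {C0 c0 eta rho t f f1 F F1}.
Arguments wave_derive {C0 c0 eta rho t f f1 F F1}.
Arguments wave_rcont1 {C0 c0 eta rho t f f1 F F1}.
Arguments wave_lip1 {C0 c0 eta rho t f f1 F F1}.
Arguments wave_peak {C0 c0 eta rho t f f1 F F1}.
Arguments wave_cderiv {C0 c0 eta rho t f f1 F F1}.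
Arguments wave_low {C0 c0 eta rho t f f1 F F1}.
Arguments wave_low2 {C0 c0 eta rho t f f1 F F1}.
Arguments wave_laplace {C0 c0 eta rho t f f1 F F1}.
Arguments wave_laplace1 {C0 c0 eta rho t f f1 F F1}.

Lemma exp_decay_le_1 : forall k v, 0 <= k -> exp (- k * Rabs v) <= 1.
Proof.
  intros k v Hk. rewrite <- exp_0. apply exp_le_compat. assert (H := Rabs_pos v). nra.
Qed.

Lemma exp_decay_limit : forall Q k, 0 < k ->
  forall eps, 0 < eps -> exists T0, 0 <= T0 /\ forall T, T0 <= T -> Q * exp (- k * T) <= eps.
Proof.
  intros Q k Hk eps Heps.
  exists (Rabs Q / (k * eps)). assert (HQ := Rabs_pos Q).
  assert (Hke : 0 < k * eps) by (apply Rmult_lt_0_compat; assumption).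
  split; [apply Rdiv_le_0_compat; assumption|]. intros T HT.
  assert (H1 : Rabs Q <= T * (k * eps)).
  { apply (Rmult_le_compat_r (k * eps)) in HT; [|lra].
    unfold Rdiv in HT. rewrite Rmult_assoc, Rinv_l in HT; lra. }
  replace (- k * T) with (- (k * T)) by ring. rewrite exp_Ropp.
  assert (H2 := exp_ineq1_le (k * T)).
  assert (H3 := exp_pos (k * T)).
  apply (Rmult_le_reg_r (exp (k * T))); [assumption|].
  rewrite Rmult_assoc, Rinv_l by lra. assert (H4 := Rle_abs Q). nra.
Qed.

Section Packet.

Context (eta N rho t : R).
Hypothesis Heta : 1 <= eta.
Hypothesis HN : 1 <= N.
Hypothesis Hrho : 1 <= rho.
Hypothesis Ht : 0 <= t.
Let X := N * rho.
Let Y := X + 2 * rho.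
Hypothesis Hsmall : exp (- (exp (/ eta * X) / 2)) <= exp (- (2 * eta * t)).
Hypothesis Hsmall' : 8 * eta * exp (- (exp (/ eta * X) / 2)) <= exp (-6).

(** The exponent is [i (z + Y)] at the point [z = x + i eta] of the contour. *)
Definition packet_exponent (x : R) : C := Ci * ((x, eta) + RtoC Y).
Definition packet_amplitude (x : R) : C :=
  / rho * (Cexp (- (t * packet_exponent x)) * bump (/ eta) (x, eta)).

Notation zeta := packet_exponent.
Notation k := packet_amplitude.

Definition packet : R -> C := expint k zeta (- X) X.
Definition packet_transform (lam : C) : C := CInt (fun x => k x / (lam - zeta x))%C (- X) X.
Definition packet_transform' (lam : C) : C :=
  CInt (fun x => k x * - (/ (lam - zeta x) * / (lam - zeta x)))%C (- X) X.

Lemma packet_half_width_ge_1 : 1 <= X.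
Proof. unfold X. nra. Qed.

Lemma packet_exponent_Re : forall x, Re (zeta x) = - eta.
Proof. intros x; unfold packet_exponent, Re; simpl; ring. Qed.

Lemma rcont_horizontal : forall (f : C -> C) x y l, cderiv f (x, y) l -> rcont (fun x => f (x, y)) x.
Proof. intros; eapply rderiv_rcont, cderiv_horizontal; eassumption. Qed.

Lemma rcont_of_entire : forall f y, hol (fun _ => True) f -> forall x, rcont (fun x => f (x, y)) x.
Proof.
  intros f y (f1 & f2 & H) x. apply rcont_horizontal with (f1 (x, y)), H. exact I.
Qed.

Lemma hol_exponent : forall D, hol D (fun z => Ci * (z + RtoC Y))%C.
Proof.
  intros D; apply hol_mult; [apply hol_const|]; apply hol_plus; [apply hol_id|apply hol_const].
Qed.

Lemma packet_exponent_rcont : forall x, rcont zeta x.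
Proof. apply (rcont_of_entire (fun z => Ci * (z + RtoC Y))%C), hol_exponent. Qed.

Lemma packet_amplitude_rcont : forall x, rcont k x.
Proof.
  intros x. apply rcont_mult; [apply rcont_const|]. apply rcont_mult.
  - apply rcont_exp. apply rcont_ext with (fun x => - t * zeta x)%C; [intros; ring|].
    apply rcont_mult; [apply rcont_const|apply packet_exponent_rcont].
  - apply (rcont_of_entire (bump (/ eta))), hol_bump.
Qed.

Lemma packet_weighted_bound : forall q Q s, 0 <= s -> 0 <= Q ->
  hol (strip (- X) X) q ->
  (forall x y, - X <= x <= X -> Rabs y <= eta -> Cmod (q (x, y)) <= Q) ->
  Cmod (CInt (fun x => k x * q (x, eta) * Cexp (s * zeta x))%C (- X) X)
    <= 32 * eta * Q / rho * exp (- eta * Rabs (s - t)).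
Proof.
  intros q Q s Hs HQ Hq HqQ. assert (HX := packet_half_width_ge_1).
  rewrite (CInt_ext _ (fun x => / rho *
    (Cexp ((s - t)%R * (Ci * ((x, eta) + RtoC Y))) * bump (/ eta) (x, eta) * q (x, eta)))%C).
  - rewrite CInt_scal.
    + rewrite Cmod_mult, Cmod_inv, Cmod_R, Rabs_pos_eq
        by (try lra; intros E; apply RtoC_inj in E; lra).
      assert (H := bump_integral_bound eta X t ltac:(lra) ltac:(lra) Ht Hsmall Y Q q HQ Hq HqQ (s - t) ltac:(lra)).
      apply (Rmult_le_compat_l (/ rho)) in H; [|apply Rlt_le, Rinv_0_lt_compat; lra].
      eapply Rle_trans; [exact H|]. apply Req_le. field. lra.
    + lra.
    + intros x Hx. apply rcont_mult; [apply rcont_mult|].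
      * apply rcont_exp, rcont_mult; [apply rcont_const|apply packet_exponent_rcont].
      * apply (rcont_of_entire (bump (/ eta))), hol_bump.
      * apply (hol_rcont _ _ q Hq). lra.
  - lra.
  - intros x _. unfold packet_amplitude. fold (zeta x).
    replace ((s - t)%R * zeta x)%C with (- (t * zeta x) + s * zeta x)%C
      by (rewrite RtoC_minus; ring).
    rewrite Cexp_plus. ring.
Qed.

(** At [s = 0] the decay factor can be dropped: this is the form used for Laplace
    transforms, whose integrand contains [exp (- t zeta)]. *)
Lemma packet_weighted_bound0 : forall q Q, 0 <= Q ->
  hol (strip (- X) X) q ->
  (forall x y, - X <= x <= X -> Rabs y <= eta -> Cmod (q (x, y)) <= Q) ->
  Cmod (CInt (fun x => k x * q (x, eta))%C (- X) X) <= 32 * eta * Q.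
Proof.
  intros q Q HQ Hq HqQ. assert (HX := packet_half_width_ge_1).
  rewrite (CInt_ext _ (fun x => k x * q (x, eta) * Cexp (RtoC 0 * zeta x))%C).
  - eapply Rle_trans; [apply (packet_weighted_bound q Q 0); auto; lra|].
    assert (H1 : 0 <= 32 * eta * Q) by nra.
    assert (H2 : exp (- eta * Rabs (0 - t)) <= 1)
      by (apply exp_decay_le_1; lra).
    assert (H3 : / rho <= 1) by (rewrite <- Rinv_1; apply Rinv_le_contravar; lra).
    assert (H4 : 0 < / rho) by (apply Rinv_0_lt_compat; lra).
    assert (H5 := exp_pos (- eta * Rabs (0 - t))).
    assert (H6 : / rho * exp (- eta * Rabs (0 - t)) <= 1) by nra.
    unfold Rdiv. rewrite Rmult_assoc. nra.
  - lra.
  - intros x _. replace (RtoC 0 * zeta x)%C with (RtoC 0) by ring. rewrite Cexp_0; ring.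
Qed.

Lemma packet_exponent_bound : forall x y, - X <= x <= X -> Rabs y <= eta ->
  Cmod (Ci * ((x, y) + RtoC Y))%C <= (2 * N + 2 + eta) * rho.
Proof.
  intros x y Hx Hy. rewrite Cmod_mult, Cmod_Ci, Rmult_1_l.
  eapply Rle_trans; [apply Cmod_le_Re_Im|]. simpl.
  assert (H : Rabs (x + Y) <= 2 * X + 2 * rho).
  { apply Rabs_le. unfold Y. lra. }
  rewrite Rplus_0_r. unfold X in *. nra.
Qed.

Section LowFrequency.

Context (lam : C).
Hypothesis Hlam : Rabs (Im lam) <= rho.

(** The frequencies of the packet are at least [Y - X = 2 rho], at distance at
    least [rho] from [Im lam]. *)
Lemma low_frequency_gap : forall x y, - X - 1 < x -> 0 < Cmod (lam - Ci * ((x, y) + RtoC Y))%C /\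
  (- X <= x -> rho <= Cmod (lam - Ci * ((x, y) + RtoC Y))%C).
Proof.
  intros x y Hx. assert (H := im_le_Cmod (lam - Ci * ((x, y) + RtoC Y))%C).
  assert (E : Im (lam - Ci * ((x, y) + RtoC Y))%C = Im lam - (x + Y)) by (unfold Im; simpl; ring).
  rewrite E in H. apply Rabs_le_between in Hlam.
  assert (H0 : x + Y - Im lam <= Rabs (Im lam - (x + Y))) by (rewrite Rabs_minus_sym; apply Rle_abs).
  unfold Y in *. split; [|intros Hx']; lra.
Qed.

Lemma hol_low_resolvent : hol (strip (- X) X) (fun z => / (lam - Ci * (z + RtoC Y)))%C.
Proof.
  apply hol_inv.
  - assert (E : (fun z => lam + (- Ci) * (z + RtoC Y))%C = (fun z => lam - Ci * (z + RtoC Y))%C)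
      by (apply FunctionalExtensionality.functional_extensionality; intros; ring).
    rewrite <- E. apply hol_plus; [apply hol_const|]. apply hol_mult; [apply hol_const|].
    apply hol_plus; [apply hol_id|apply hol_const].
  - intros [x y] [Hz _]. apply Cmod_gt_0. apply low_frequency_gap. exact Hz.
Qed.

Lemma low_resolvent_bound : forall x y, - X <= x -> Cmod (/ (lam - Ci * ((x, y) + RtoC Y)))%C <= / rho.
Proof.
  intros x y Hx. destruct (low_frequency_gap x y) as [H1 H2]; [lra|].
  rewrite Cmod_inv by (apply Cmod_gt_0; assumption).
  apply Rinv_le_contravar; [lra|auto].
Qed.

Lemma low_resolvent_bound1 : forall x y, - X <= x -> Cmod (/ (lam - Ci * ((x, y) + RtoC Y)))%C <= 1.
Proof.
  intros x y Hx. eapply Rle_trans; [apply low_resolvent_bound; assumption|].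
  rewrite <- Rinv_1. apply Rinv_le_contravar; lra.
Qed.

End LowFrequency.

(** The largest of the bounds [32 eta Q] over the weights [q] that occur; with
    [A = 2 N + 2 + eta] the largest [Q] is [1 + A], for [lam / (lam - zeta)]. *)
Definition packet_const : R := 32 * eta * (2 * N + 3 + eta).

(** The remainder is again an integral of the packet against an analytic weight.
    It is estimated crudely to differentiate the transform at an arbitrary point,
    and by moving the contour to get a bound uniform in the packet. *)
Lemma resolvent_split : forall lam h, - eta < Re lam -> - eta < Re (lam + h)%C ->
  (packet_transform (lam + h) - packet_transform lam - h * packet_transform' lam)%C
  = (h * h * CInt (fun x => k x * (/ (lam - zeta x) * / (lam - zeta x) * / (lam + h - zeta x))) (- X) X)%C.
Proof.
  intros lam h H1 H2. assert (HX := packet_half_width_ge_1).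
  assert (Hk := packet_amplitude_rcont). assert (Hz := packet_exponent_rcont).
  assert (Hre := packet_exponent_Re).
  assert (R1 := resolvent_nonzero zeta eta lam Hre H1).
  assert (R2 := resolvent_nonzero zeta eta (lam + h)%C Hre H2).
  assert (Hinv : forall mu, - eta < Re mu -> forall x, rcont (fun x => / (mu - zeta x))%C x).
  { intros mu Hmu x.
    apply rcont_ext with (fun x => 1 / (mu - zeta x))%C.
    - intros; unfold Cdiv; ring.
    - apply (resolvent_rcont (fun _ => 1%C) zeta eta mu); auto. intros; apply rcont_const. }
  unfold packet_transform, packet_transform'.
  assert (Hneg : forall x, rcont (fun x => - (/ (lam - zeta x) * / (lam - zeta x)))%C x).
  { intros x. apply rcont_ext with (fun x => - (1) * (/ (lam - zeta x) * / (lam - zeta x)))%C; [intros; ring|].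
    apply rcont_mult; [apply rcont_const|]. apply rcont_mult; apply Hinv; assumption. }
  rewrite <- !CInt_scal; try lra.
  rewrite <- !CInt_minus; try lra.
  - apply CInt_ext; [lra|]. intros x _. field; split; auto.
  all: intros x _; rcont_tac;
    first [exact (Hk x) | exact (Hinv _ H1 x) | exact (Hinv _ H2 x)].
Qed.

Lemma packet_wave : wave packet_const (exp (-6)) eta rho t packet
    (expint (fun x => k x * zeta x)%C zeta (- X) X)
    packet_transform packet_transform'.
Proof.
  assert (HX := packet_half_width_ge_1).
  assert (Hk := packet_amplitude_rcont). assert (Hz := packet_exponent_rcont).
  assert (Hre := packet_exponent_Re).
  assert (Hkz : forall x, rcont (fun x => k x * zeta x)%C x) by (intros; apply rcont_mult; auto).
  assert (Hir : 0 < / rho) by (apply Rinv_0_lt_compat; lra).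
  assert (Hc : 32 * eta <= packet_const) by (unfold packet_const; nra).
  set (A := 2 * N + 2 + eta).
  assert (HA : 32 * eta * A <= packet_const /\ 32 * eta * (1 + A) <= packet_const)
    by (unfold packet_const, A; nra).
  assert (HA0 : 1 <= A) by (unfold A; lra).
  constructor.
  - intros s Hs.
    unfold packet, expint.
    rewrite (CInt_ext _ (fun x => k x * 1 * Cexp (s * zeta x))%C) by (try lra; intros; ring).
    eapply Rle_trans.
    + apply (packet_weighted_bound (fun _ => 1%C) 1 s Hs); [lra|apply hol_const|].
      intros; rewrite Cmod_1; lra.
    + apply Rmult_le_compat_r; [apply Rlt_le, exp_pos|].
      unfold Rdiv; apply Rmult_le_compat_r; lra.
  - intros s Hs.
    unfold expint. eapply Rle_trans.
    + apply (packet_weighted_bound (fun z => Ci * (z + RtoC Y))%C (A * rho) s Hs); [nra|apply hol_exponent|].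
      intros; apply packet_exponent_bound; assumption.
    + apply Rmult_le_compat_r; [apply Rlt_le, exp_pos|].
      replace (32 * eta * (A * rho) / rho) with (32 * eta * A) by (field; lra). apply HA.
  - intros s. apply expint_derive; auto; lra.
  - intros s. eapply rderiv_rcont, expint_derive; auto; lra.
  - exists (2 * (32 * eta * (A * rho * (A * rho)) / rho)). intros s u Hs Hu.
    apply (rderiv_bound _ (expint (fun x => k x * zeta x * zeta x)%C zeta (- X) X)).
    + assumption.
    + intros x _. apply expint_derive; auto; lra.
    + intros v Hv. unfold expint.
      rewrite (CInt_ext _ (fun x => k x * (zeta x * zeta x) * Cexp (v * zeta x))%C) by (try lra; intros; ring).
      eapply Rle_trans.
      * apply (packet_weighted_bound (fun z => Ci * (z + RtoC Y) * (Ci * (z + RtoC Y)))%C (A * rho * (A * rho)) v);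
          [lra|nra|apply hol_mult; apply hol_exponent|].
        intros. rewrite Cmod_mult.
        apply Rmult_le_compat; try apply Cmod_ge_0; apply packet_exponent_bound; assumption.
      * rewrite <- (Rmult_1_r (32 * eta * (A * rho * (A * rho)) / rho)) at 2.
        apply Rmult_le_compat_l.
        -- apply Rmult_le_pos; [|lra]. apply Rmult_le_pos; nra.
        -- apply exp_decay_le_1; lra.
  - assert (H := bump_integral_lower eta X Heta HX Hsmall').
    unfold packet, expint.
    rewrite (CInt_ext _ (fun x => / rho * bump (/ eta) (x, eta))%C).
    + rewrite CInt_scal; [|lra|intros; apply (rcont_of_entire (bump (/ eta))), hol_bump].
      rewrite Cmod_mult, Cmod_inv, Cmod_R, Rabs_pos_eq
        by (try lra; intros E; apply RtoC_inj in E; lra).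
      unfold Rdiv. rewrite Rmult_comm. apply Rmult_le_compat_l; lra.
    + lra.
    + intros x _. unfold packet_amplitude.
      rewrite <- (Cmult_1_r (bump (/ eta) (x, eta))) at 2.
      rewrite <- (Cexp_opp_mult (t * zeta x)). ring.
  (* [d] bounds the distance from [lam] and [lam + h] to the singular line below. *)
  - intros lam Hlam.
    set (d := (Re lam + eta) / 2). assert (Hd : 0 < d) by (unfold d; lra).
    assert (HI : ex_RInt (fun x => / d ^ 3 * Cmod (k x)) (- X) X).
    { apply (ex_RInt_scal (V := R_CompleteNormedModule)).
      apply (ex_RInt_continuous (V := R_CompleteNormedModule)); intros; apply rcont_Cmod; auto. }
    apply cderiv_of_quadratic with (d := d) (B := 2 * RInt (fun x => / d ^ 3 * Cmod (k x)) (- X) X); [assumption|].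
    intros h Hh.
    assert (Hh' := re_le_Cmod h). apply Rabs_le_between in Hh'.
    assert (Hlh : - eta < Re (lam + h)%C) by (unfold d, Re in *; simpl; lra).
    rewrite resolvent_split by assumption.
    rewrite !Cmod_mult. rewrite Rmult_comm. replace (Cmod h * Cmod h) with (Cmod h ^ 2) by ring.
    apply Rmult_le_compat_r; [apply pow2_ge_0|].
    assert (Hinv : forall mu, - eta + d <= Re mu -> forall x, (mu - zeta x)%C <> 0%C /\
        Cmod (/ (mu - zeta x))%C <= / d /\ rcont (fun x => / (mu - zeta x))%C x).
    { intros mu Hmu x.
      assert (H0 := resolvent_nonzero zeta eta mu Hre ltac:(lra)).
      split; [apply H0|split].
      - rewrite Cmod_inv by apply H0. apply Rinv_le_contravar; [assumption|].
        eapply Rle_trans; [|apply re_le_Cmod]. eapply Rle_trans; [|apply Rle_abs].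
        specialize (Hre x). unfold Re in *; simpl. lra.
      - apply rcont_ext with (fun x => 1 / (mu - zeta x))%C.
        + intros; unfold Cdiv; ring.
        + apply (resolvent_rcont (fun _ => 1%C) zeta eta mu); auto; [|lra]. intros; apply rcont_const. }
    assert (G1 : - eta + d <= Re lam) by (unfold d; lra).
    assert (G2 : - eta + d <= Re (lam + h)%C) by (unfold d, Re in *; simpl; lra).
    apply Cmod_CInt_le; [lra| |assumption|].
    + intros x _. rcont_tac; first [exact (Hk x) | apply (Hinv _ G1 x) | apply (Hinv _ G2 x)].
    + intros x _.
      destruct (Hinv _ G1 x) as (_ & I1 & _), (Hinv _ G2 x) as (_ & I2 & _).
      rewrite !Cmod_mult, Rmult_comm. apply Rmult_le_compat_r; [apply Cmod_ge_0|].
      replace (/ d ^ 3) with (/ d * / d * / d) by (field; lra).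
      repeat apply Rmult_le_compat; try apply Rmult_le_pos; try apply Cmod_ge_0; assumption.
  - intros lam Hlam Him.
    assert (HR := low_resolvent_bound lam Him). assert (HR1 := low_resolvent_bound1 lam Him).
    assert (HH := hol_low_resolvent lam Him).
    repeat split.
    + eapply Rle_trans; [apply (packet_weighted_bound0 (fun z => / (lam - Ci * (z + RtoC Y)))%C 1);
        [lra|exact HH|]|lra].
      intros x y Hx Hy. apply HR1; lra.
    + unfold packet_transform. rewrite <- CInt_scal; [|lra|intros; apply (resolvent_rcont k zeta eta); auto].
      rewrite (CInt_ext _ (fun x => k x * (lam * / (lam - zeta x)))%C) by (try lra; intros; unfold Cdiv; ring).
      eapply Rle_trans; [apply (packet_weighted_bound0 (fun z => lam * / (lam - Ci * (z + RtoC Y)))%C (1 + A))|lra].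
      * lra.
      * apply hol_mult; [apply hol_const|exact HH].
      * intros x y Hx Hy.
        destruct (low_frequency_gap lam Him x y) as [G1 G2]; [lra|].
        (* Here [lam] may be large: the quotient [lam / (lam - w)] is [1 + w / (lam - w)]. *)
        replace (lam * / (lam - Ci * ((x, y) + RtoC Y)))%C
          with (1 + Ci * ((x, y) + RtoC Y) * / (lam - Ci * ((x, y) + RtoC Y)))%C
          by (field; apply Cmod_gt_0; exact G1).
        eapply Rle_trans; [apply Cmod_triangle|]. rewrite Cmod_1, Cmod_mult.
        apply Rplus_le_compat_l.
        replace A with (A * rho * / rho) by (field; lra).
        apply Rmult_le_compat; try apply Cmod_ge_0.
        -- apply packet_exponent_bound; assumption.
        -- apply HR; lra.
    + unfold packet_transform'.
      rewrite (CInt_ext _ (fun x => k x * (- (1) * (/ (lam - zeta x) * / (lam - zeta x))))%C) by (try lra; intros; ring).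
      eapply Rle_trans; [apply (packet_weighted_bound0
        (fun z => - (1) * (/ (lam - Ci * (z + RtoC Y)) * / (lam - Ci * (z + RtoC Y))))%C 1)|lra].
      * lra.
      * apply hol_mult; [apply hol_const|]. apply hol_mult; exact HH.
      * intros x y Hx Hy. rewrite !Cmod_mult, Cmod_opp, Cmod_1.
        assert (H := HR1 x y ltac:(lra)).
        assert (H0 := Cmod_ge_0 (/ (lam - Ci * ((x, y) + RtoC Y)))%C). nra.
  - intros lam h Hlam Hlamh Him Himh.
    rewrite resolvent_split by assumption.
    rewrite !Cmod_mult, Rmult_comm. replace (Cmod h * Cmod h) with (Cmod h ^ 2) by ring.
    apply Rmult_le_compat_r; [apply pow2_ge_0|].
    eapply Rle_trans; [apply (packet_weighted_bound0
        (fun z => / (lam - Ci * (z + RtoC Y)) * / (lam - Ci * (z + RtoC Y)) * / (lam + h - Ci * (z + RtoC Y)))%C 1)|lra].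
    + lra.
    + apply hol_mult; [apply hol_mult|]; apply hol_low_resolvent; assumption.
    + intros x y Hx Hy. rewrite !Cmod_mult.
      assert (H := low_resolvent_bound1 lam Him x y ltac:(lra)).
      assert (H' := low_resolvent_bound1 (lam + h)%C Himh x y ltac:(lra)).
      assert (H0 := Cmod_ge_0 (/ (lam - Ci * ((x, y) + RtoC Y)))%C).
      assert (H0' := Cmod_ge_0 (/ (lam + h - Ci * ((x, y) + RtoC Y)))%C).
      assert (Cmod (/ (lam - Ci * ((x, y) + RtoC Y))) * Cmod (/ (lam - Ci * ((x, y) + RtoC Y))) <= 1) by nra.
      nra.
  - intros lam Hlam eps Heps.
    destruct (laplace_expint k zeta (- X) X eta lam) as [Q HQ]; auto; [lra|].
    destruct (exp_decay_limit Q (Re lam + eta) ltac:(lra) eps Heps) as (T0 & HT0 & HT).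
    exists T0; split; [assumption|]. intros T HTT. eapply Rle_trans; [apply HQ; lra|auto].
  - intros lam Hlam eps Heps.
    destruct (laplace_expint (fun x => k x * zeta x)%C zeta (- X) X eta lam) as [Q HQ]; auto; [lra|].
    destruct (exp_decay_limit Q (Re lam + eta) ltac:(lra) eps Heps) as (T0 & HT0 & HT).
    exists T0; split; [assumption|]. intros T HTT.
    (* [f1] has amplitude [k zeta], and [zeta / (lam - zeta) = lam / (lam - zeta) - 1]. *)
    assert (E : (lam * packet_transform lam - packet 0)%C
                = CInt (fun x => k x * zeta x / (lam - zeta x))%C (- X) X).
    { unfold packet_transform, packet, expint.
      rewrite <- CInt_scal; [|lra|intros; apply (resolvent_rcont k zeta eta); auto].
      rewrite <- CInt_minus; [|lra| |].
      - apply CInt_ext; [lra|]. intros x _.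
        replace (RtoC 0 * zeta x)%C with (RtoC 0) by ring. rewrite Cexp_0.
        field. apply (resolvent_nonzero zeta eta); auto.
      - intros; apply rcont_mult; [apply rcont_const|apply (resolvent_rcont k zeta eta); auto].
      - intros; apply expint_integrand_rcont; auto. }
    rewrite E. eapply Rle_trans; [apply HQ; lra|auto].
Qed.

End Packet.

Lemma exp_ge_half_square : forall u, 0 <= u -> (1 + u ^ 2) / 2 <= exp u.
Proof.
  intros u Hu. assert (H := exp_ineq1_le (u / 3)).
  replace u with (u / 3 + (u / 3 + u / 3)) at 2 by field. rewrite !exp_plus.
  set (e := exp (u / 3)) in *.
  assert (H1 : (1 + u / 3) * (1 + u / 3) <= e * e) by (apply Rmult_le_compat; lra).
  assert (H2 : (1 + u / 3) * ((1 + u / 3) * (1 + u / 3)) <= e * (e * e)) by (apply Rmult_le_compat; nra).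
  assert (0 <= u * (27 - 9 / 2 * u + u ^ 2)) by (apply Rmult_le_pos; nra).
  nra.
Qed.

(** The factor [exp (m t)] is the price of evaluating the transform to the left
    of the imaginary axis at a packet located near time [t]. Majorizing
    [exp (- |u|)] by [2 / (1 + u ^ 2)] gives the constant 16; the value 17 leaves
    room for the passage to the limit. *)
Lemma laplace_localized_bound : forall f lam l eta B t m, 0 <= t -> 0 <= B -> 0 <= m -> m <= eta - 1 ->
  - m <= Re lam -> (forall s, 0 <= s -> Cmod (f s) <= B * exp (- eta * Rabs (s - t))) ->
  (forall s, 0 <= s -> rcont f s) ->
  has_laplace f lam l -> Cmod l <= 17 * B * exp (m * t).
Proof.
  intros f lam l eta B t m Ht HB Hm Hme Hlam Hf Hc Hl.
  assert (HBe : 0 <= B * exp (m * t)) by (apply Rmult_le_pos; [assumption|apply Rlt_le, exp_pos]).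
  apply Rnot_lt_le. intros Hlt.
  destruct (Hl ((Cmod l - 17 * B * exp (m * t)) / 2)) as (T & HT & H); [lra|].
  specialize (H T (Rle_refl _)).
  set (I := CInt (fun s => Cexp (- (lam * s)) * f s)%C 0 T) in *.
  assert (HI : Cmod I <= 16 * B * exp (m * t)).
  { destruct (RInt_lorentzian 1 t 0 T) as [I1 I2]; [lra|assumption|].
    unfold I. eapply Rle_trans.
    - apply (Cmod_CInt_le _ (fun s => (2 * (B * exp (m * t))) * / (1 + (1 * (s - t)) ^ 2))); [assumption| | |].
      + intros s Hs. apply rcont_mult; [|apply Hc; lra].
        apply rcont_exp. apply rcont_ext with (fun s => - lam * RtoC s)%C; [intros; ring|].
        apply rcont_mult; [apply rcont_const|apply rcont_RtoC].
      + apply (ex_RInt_scal (V := R_CompleteNormedModule)); assumption.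
      + intros s Hs. rewrite Cmod_mult, Cmod_Cexp.
        assert (E1 : exp (Re (- (lam * s))%C) <= exp (m * s)).
        { apply exp_le_compat. unfold Re in *; simpl. nra. }
        assert (E2 := Hf s ltac:(lra)).
        assert (E3 := exp_pos (Re (- (lam * s))%C)).
        assert (E4 := Cmod_ge_0 (f s)).
        eapply Rle_trans; [apply Rmult_le_compat; [lra|assumption|exact E1|exact E2]|].
        rewrite <- Rmult_assoc, (Rmult_comm _ B), Rmult_assoc, <- exp_plus.
        replace (2 * (B * exp (m * t)) * / (1 + (1 * (s - t)) ^ 2))
          with (B * (exp (m * t) * (2 * / (1 + (1 * (s - t)) ^ 2)))) by ring.
        apply Rmult_le_compat_l; [assumption|].
        eapply Rle_trans with (exp (m * t + - Rabs (s - t))).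
        { apply exp_le_compat. assert (A1 := Rle_abs (s - t)). assert (A2 := Rabs_pos (s - t)). nra. }
        rewrite exp_plus. apply Rmult_le_compat_l; [apply Rlt_le, exp_pos|].
        rewrite exp_Ropp.
        assert (A2 := Rabs_pos (s - t)).
        assert (A5 : (1 * (s - t)) ^ 2 = Rabs (s - t) ^ 2) by (rewrite pow2_abs; ring).
        rewrite A5. set (u := Rabs (s - t)) in *.
        assert (A6 := exp_ge_half_square u A2).
        assert (A7 : 2 * / (1 + u ^ 2) = / ((1 + u ^ 2) / 2)) by (field; nra).
        rewrite A7. apply Rinv_le_contravar; [nra|exact A6].
    - rewrite (RInt_scal (V := R_CompleteNormedModule)) by assumption.
      unfold scal; simpl; unfold mult; simpl.
      replace (4 / 1) with 4 in I2 by field.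
      assert (H0 := Rmult_le_compat_l _ _ _ HBe I2). simpl in H0. lra. }
  assert (T1 := Cmod_sub_ge l I).
  rewrite <- Cmod_opp in H. replace (- (I - l))%C with (l - I)%C in H by ring. lra.
Qed.

(** * Series of complex numbers *)

Definition CSeries (u : nat -> C) : C :=
  (Series (fun n => Re (u n)), Series (fun n => Im (u n))).

Fixpoint csum (u : nat -> C) (n : nat) : C :=
  match n with O => 0%C | S m => (csum u m + u m)%C end.

Definition csummable (u : nat -> C) : Prop :=
  ex_series (fun n => Re (u n)) /\ ex_series (fun n => Im (u n)).

Lemma csummable_of_le : forall u a, ex_series a -> (forall n, Cmod (u n) <= a n) -> csummable u.
Proof.
  intros u a Ha H; split; apply (ex_series_le (K := R_AbsRing) (V := R_CompleteNormedModule)) with a;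
    auto; intros n; eapply Rle_trans; try apply H; [apply re_le_Cmod|apply im_le_Cmod].
Qed.

Lemma CSeries_bound : forall u a, ex_series a -> (forall n, Cmod (u n) <= a n) ->
  Cmod (CSeries u) <= 2 * Series a.
Proof.
  intros u a Ha H.
  assert (Aux : forall g : nat -> R, (forall n, Rabs (g n) <= a n) -> Rabs (Series g) <= Series a).
  { intros g Hg.
    eapply Rle_trans; [apply Series_Rabs|apply Series_le; [|assumption]].
    - apply (ex_series_le (K := R_AbsRing) (V := R_CompleteNormedModule)) with a; auto.
      intros n. unfold norm; simpl; unfold abs; simpl. rewrite Rabs_Rabsolu. apply Hg.
    - intros n; split; [apply Rabs_pos|apply Hg]. }
  eapply Rle_trans; [apply Cmod_le_Re_Im|]. simpl.
  assert (Rabs (Series (fun n => Re (u n))) <= Series a).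
  { apply Aux. intros n; eapply Rle_trans; [apply re_le_Cmod|apply H]. }
  assert (Rabs (Series (fun n => Im (u n))) <= Series a).
  { apply Aux. intros n; eapply Rle_trans; [apply im_le_Cmod|apply H]. }
  lra.
Qed.

Lemma CSeries_split : forall u N, csummable u ->
  CSeries u = (csum u N + CSeries (fun k => u (N + k)%nat))%C.
Proof.
  intros u N [H1 H2]. induction N as [|N IH].
  - simpl. rewrite Cplus_0_l. reflexivity.
  - rewrite IH. simpl. rewrite <- Cplus_assoc. f_equal.
    assert (E : forall g : nat -> R, ex_series g ->
      Series (fun k => g (N + k)%nat) = g N + Series (fun k => g (S (N + k)))).
    { intros g Hg. rewrite Series_incr_1.
      - rewrite Nat.add_0_r. f_equal. apply Series_ext. intros; f_equal; lia.
      - apply ex_series_incr_n; assumption. }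
    apply C_eq; simpl; apply (E (fun n => _ (u n))); assumption.
Qed.

Lemma CSeries_minus : forall u v, csummable u -> csummable v ->
  CSeries (fun n => u n - v n)%C = (CSeries u - CSeries v)%C.
Proof.
  intros u v [H1 H2] [H3 H4]. apply C_eq; simpl.
  - apply (Series_minus (fun n => Re (u n)) (fun n => Re (v n))); assumption.
  - apply (Series_minus (fun n => Im (u n)) (fun n => Im (v n))); assumption.
Qed.

Lemma ex_series_scal_R : forall (k : R) g, ex_series g -> ex_series (fun n => k * g n).
Proof. intros k g H. apply (ex_series_scal_l k g H). Qed.

Lemma CSeries_scal : forall (k : C) u, csummable u ->
  CSeries (fun n => k * u n)%C = (k * CSeries u)%C.
Proof.
  intros [p q] u [H1 H2]. apply C_eq; simpl.
  - unfold Re, Im in *; simpl in *. rewrite <- !Series_scal_l.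
    apply (Series_minus (fun n => p * fst (u n)) (fun n => q * snd (u n)));
      apply ex_series_scal_R; assumption.
  - unfold Re, Im in *; simpl in *. rewrite <- !Series_scal_l.
    apply (Series_plus (fun n => p * snd (u n)) (fun n => q * fst (u n)));
      apply ex_series_scal_R; assumption.
Qed.

Lemma series_tail_small : forall a, ex_series a -> forall eps, 0 < eps ->
  exists N, forall m, (N <= m)%nat -> Rabs (Series (fun k => a (m + k)%nat)) <= eps.
Proof.
  intros a Ha eps Heps.
  assert (Hl := Series_correct _ Ha).
  destruct (proj1 (filterlim_locally _ _) Hl (mkposreal eps Heps)) as [N HN].
  exists (S N). intros m Hm. destruct m as [|m]; [lia|].
  specialize (HN m ltac:(lia)).
  rewrite (Series_incr_n a (S m)) in HN by (auto; lia).
  set (s := Series (fun k => a (S m + k)%nat)) in *.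
  change (Rabs (sum_n a m - (sum_f_R0 a m + s)) < eps) in HN.
  rewrite sum_n_Reals in HN. rewrite <- (Rabs_Ropp s).
  replace (- s) with (sum_f_R0 a m - (sum_f_R0 a m + s)) by ring. lra.
Qed.

Lemma converges_is_RInt_gen : forall (g : R -> C) (l : C), (forall s, rcont g s) ->
  converges_at_infinity (fun T => CInt g 0 T) l ->
  is_RInt_gen (V := C_R_CompleteNormedModule) g (at_point 0) (Rbar_locally p_infty) l.
Proof.
  intros g l Hg Hl P [eps HP].
  destruct (Hl (eps / 2)) as (T0 & HT0 & HT); [assert (H := cond_pos eps); lra|].
  unfold filtermapi.
  apply Filter_prod with (Q := fun a => a = 0) (R := fun b => T0 < b).
  - reflexivity.
  - exists T0; auto.
  - intros a b -> Hb. exists (CInt g 0 b). split.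
    + simpl. destruct (ex_RInt_rcont g 0 b) as [E1 E2]; [lra|auto|].
      apply (is_RInt_fct_extend_pair (U := R_NormedModule) (V := R_NormedModule));
        apply (RInt_correct (V := R_CompleteNormedModule)); assumption.
    + apply HP. specialize (HT b ltac:(lra)).
      assert (He := cond_pos eps).
      split; [change (Rabs (Re (CInt g 0 b) - Re l) < eps)|change (Rabs (Im (CInt g 0 b) - Im l) < eps)].
      * eapply Rle_lt_trans; [apply (re_le_Cmod (CInt g 0 b - l)%C)|]; lra.
      * eapply Rle_lt_trans; [apply (im_le_Cmod (CInt g 0 b - l)%C)|]; lra.
Qed.

Lemma rcont_of_lipschitz : forall (g : R -> C) L, (forall s u, Cmod (g u - g s)%C <= L * Rabs (u - s)) ->
  forall s, rcont g s.
Proof.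
  intros g L H s.
  assert (Aux : forall p : R -> R, (forall u, Rabs (p u - p s) <= L * Rabs (u - s)) -> continuous p s).
  { intros p Hp. apply filterlim_locally. intros eps.
    assert (HL : 0 < Rabs L + 1) by (assert (H0 := Rabs_pos L); lra).
    assert (Hd : 0 < eps / (Rabs L + 1)) by (apply Rdiv_lt_0_compat; [apply cond_pos|assumption]).
    exists (mkposreal _ Hd). intros u Hu. change (Rabs (u - s) < eps / (Rabs L + 1)) in Hu.
    change (Rabs (p u - p s) < eps).
    eapply Rle_lt_trans; [apply Hp|].
    apply (Rmult_lt_compat_r (Rabs L + 1)) in Hu; [|assumption].
    unfold Rdiv in Hu; rewrite Rmult_assoc, Rinv_l in Hu by lra.
    assert (H0 := Rle_abs L). assert (H1 := Rabs_pos (u - s)). nra. }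
  split; apply Aux; intros u; (eapply Rle_trans; [|apply H]).
  - apply (re_le_Cmod (g u - g s)%C).
  - apply (im_le_Cmod (g u - g s)%C).
Qed.

Lemma is_derive_on_Rplus_of_remainder : forall f t l, 0 <= t ->
  (forall eps, 0 < eps -> exists d, 0 < d /\ forall h, Rabs h < d -> 0 <= t + h ->
     Cmod (f (t + h)%R - f t - h * l)%C <= eps * Rabs h) ->
  is_derive_on_Rplus f t l.
Proof.
  intros f t l Ht H. split.
  - apply (is_linear_scal_l (K := R_AbsRing) (V := C_R_NormedModule) l).
  - intros x Hx eps.
    assert (E : x = t).
    { destruct (Req_dec x t) as [|Hne]; [assumption|exfalso].
      assert (Hd : 0 < Rabs (x - t) / 2).
      { assert (H0 : 0 < Rabs (x - t)) by (apply Rabs_pos_lt; lra). lra. }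
      destruct (Hx (fun y => Rabs (y - x) < Rabs (x - t) / 2)) as [d Hd'].
      - exists (mkposreal _ Hd). intros y Hy; exact Hy.
      - specialize (Hd' t (ball_center _ _) Ht). rewrite Rabs_minus_sym in Hd'. lra. }
    subst x. destruct (H eps (cond_pos eps)) as (d & Hd & Hh).
    exists (mkposreal d Hd). intros y Hy Hy0. change (Rabs (y - t) < d) in Hy. unfold Rplus_set in Hy0.
    assert (E : t + (y - t) = y) by ring.
    specialize (Hh (y - t) Hy). rewrite E in Hh. specialize (Hh Hy0).
    change (@norm R_AbsRing C_R_NormedModule (minus (minus (f y) (f t)) (scal (minus y t) l))
      <= eps * Rabs (y - t)).
    eapply Rle_trans; [|exact Hh]. apply Req_le. rewrite Cmod_norm. f_equal.
    apply C_eq; unfold Re, Im; simpl;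
      unfold minus, plus, opp, scal; simpl; unfold mult; simpl; ring.
Qed.

(** * Superposition of wave packets *)

Section Superposition.

Context (C0 c0 eta : R) (rho t : nat -> R) (f f1 : nat -> R -> C) (F F1 : nat -> C -> C).
Hypothesis Heta : 0 < eta.
Hypothesis HC0 : 0 <= C0.
Hypothesis Hwave : forall n, wave C0 c0 eta (rho n) (t n) (f n) (f1 n) (F n) (F1 n).
Hypothesis Hrho1 : forall n, 1 <= rho n.
Hypothesis Hrhon : forall n, INR n <= rho n.
Context (c a : nat -> R).
Hypothesis Hc : forall n, Rabs (c n) <= a n.
Hypothesis Ha : ex_series a.

Definition weighted (u : nat -> C) : C := CSeries (fun n => c n * u n)%C.
Definition tail (N : nat) : R := Series (fun k => a (N + k)%nat).
Definition eventually_bounded (u : nat -> C) : Prop :=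
  exists N B, forall n, (N <= n)%nat -> Cmod (u n) <= B.

Lemma eventually_bounded_scal : forall (k : C) u,
  eventually_bounded u -> eventually_bounded (fun n => k * u n)%C.
Proof.
  intros k u (N & B & H). exists N, (Cmod k * B). intros n Hn. rewrite Cmod_mult.
  apply Rmult_le_compat_l; [apply Cmod_ge_0|auto].
Qed.

Lemma eventually_bounded_minus : forall u v,
  eventually_bounded u -> eventually_bounded v -> eventually_bounded (fun n => u n - v n)%C.
Proof.
  intros u v (N1 & B1 & H1) (N2 & B2 & H2). exists (Nat.max N1 N2), (B1 + B2). intros n Hn.
  unfold Cminus. eapply Rle_trans; [apply Cmod_triangle|]. rewrite Cmod_opp.
  specialize (H1 n ltac:(lia)). specialize (H2 n ltac:(lia)). lra.
Qed.

Lemma weights_nonneg : forall n, 0 <= a n.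
Proof. intros n; eapply Rle_trans; [apply Rabs_pos|apply Hc]. Qed.

Lemma tail_ex : forall N, ex_series (fun k => a (N + k)%nat).
Proof. intros N; apply ex_series_incr_n; assumption. Qed.

Lemma tail_nonneg : forall N, 0 <= tail N.
Proof.
  intros N. unfold tail. replace 0 with (Series (fun _ : nat => 0)).
  - apply Series_le; [|apply tail_ex]. intros; split; [lra|apply weights_nonneg].
  - assert (E := Series_scal_l 0 (fun _ : nat => 0)). rewrite Rmult_0_l in E. 
    etransitivity; [|exact E]. apply Series_ext; intros; ring.
Qed.

Lemma tail_small : forall eps, 0 < eps -> exists N0, forall N, (N0 <= N)%nat -> tail N <= eps.
Proof.
  intros eps Heps. destruct (series_tail_small a Ha eps Heps) as [N0 H].
  exists N0; intros N HN. eapply Rle_trans; [apply Rle_abs|apply H; assumption].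
Qed.

Lemma weighted_term : forall n (z : C) B, Cmod z <= B -> Cmod (c n * z)%C <= B * a n.
Proof.
  intros n z B H. rewrite Cmod_mult, Cmod_R, Rmult_comm.
  apply Rmult_le_compat; auto using Cmod_ge_0, Rabs_pos.
Qed.

Lemma weighted_summable : forall u, eventually_bounded u -> csummable (fun n => c n * u n)%C.
Proof.
  intros u (N & B & H).
  destruct (csummable_of_le (fun k => c (N + k)%nat * u (N + k)%nat)%C (fun k => B * a (N + k)%nat)) as [H1 H2].
  - apply ex_series_scal_R, tail_ex.
  - intros k. apply weighted_term, H. lia.
  - split; apply (ex_series_incr_n _ N); assumption.
Qed.

(** The basic estimate: every property of the sum is proved for a finite partial
    sum and transferred by choosing the tail of the weights small. *)
Lemma weighted_tail : forall u N B, (forall n, (N <= n)%nat -> Cmod (u n) <= B) ->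
  Cmod (weighted u - csum (fun n => c n * u n)%C N)%C <= 2 * B * tail N.
Proof.
  intros u N B H. unfold weighted.
  rewrite (CSeries_split _ N) by (apply weighted_summable; exists N, B; assumption).
  replace (csum (fun n => c n * u n) N + CSeries (fun k => c (N + k)%nat * u (N + k)%nat)
    - csum (fun n => c n * u n) N)%C with (CSeries (fun k => c (N + k)%nat * u (N + k)%nat)%C) by ring.
  unfold tail. rewrite Rmult_assoc, <- Series_scal_l.
  apply CSeries_bound.
  - apply ex_series_scal_R, tail_ex.
  - intros k. apply weighted_term, H. lia.
Qed.

Lemma weighted_bound : forall u B, (forall n, Cmod (u n) <= B) -> Cmod (weighted u) <= 2 * B * tail 0.
Proof.
  intros u B H. assert (E := weighted_tail u 0 B (fun n _ => H n)). simpl in E.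
  replace (weighted u - 0)%C with (weighted u) in E by ring. exact E.
Qed.

Lemma weighted_minus : forall u v, eventually_bounded u -> eventually_bounded v ->
  weighted (fun n => u n - v n)%C = (weighted u - weighted v)%C.
Proof.
  intros u v Hu Hv. unfold weighted. rewrite <- CSeries_minus by (apply weighted_summable; assumption).
  f_equal. apply FunctionalExtensionality.functional_extensionality; intros; ring.
Qed.

Lemma weighted_scal : forall k u, eventually_bounded u ->
  weighted (fun n => k * u n)%C = (k * weighted u)%C.
Proof.
  intros k u Hu. unfold weighted. rewrite <- CSeries_scal by (apply weighted_summable; assumption).
  f_equal. apply FunctionalExtensionality.functional_extensionality; intros; ring.
Qed.

Lemma csum_minus : forall u v N, csum (fun n => u n - v n)%C N = (csum u N - csum v N)%C.
Proof. intros u v N; induction N as [|N IH]; simpl; [ring|rewrite IH; ring]. Qed.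

Lemma csum_scal : forall k u N, csum (fun n => k * u n)%C N = (k * csum u N)%C.
Proof. intros k u N; induction N as [|N IH]; simpl; [ring|rewrite IH; ring]. Qed.

Lemma csum_ext : forall u v N, (forall n, u n = v n) -> csum u N = csum v N.
Proof. intros u v N H; induction N as [|N IH]; simpl; [reflexivity|rewrite IH, H; reflexivity]. Qed.

Lemma packet_le : forall n s, 0 <= s -> Cmod (f n s) <= C0.
Proof.
  intros n s Hs. eapply Rle_trans; [apply (wave_size (Hwave n)); assumption|].
  assert (E : exp (- eta * Rabs (s - t n)) <= 1)
      by (apply exp_decay_le_1; lra).
  assert (H0 := exp_pos (- eta * Rabs (s - t n))).
  assert (H1 : C0 / rho n <= C0).
  { unfold Rdiv. rewrite <- (Rmult_1_r C0) at 2. apply Rmult_le_compat_l; [assumption|].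
    rewrite <- Rinv_1. apply Rinv_le_contravar; [lra|apply Hrho1]. }
  assert (H2 : 0 <= C0 / rho n) by (apply Rdiv_le_0_compat; [assumption|specialize (Hrho1 n); lra]).
  nra.
Qed.

Lemma packet1_le : forall n s, 0 <= s -> Cmod (f1 n s) <= C0.
Proof.
  intros n s Hs. eapply Rle_trans; [apply (wave_size1 (Hwave n)); assumption|].
  assert (E : exp (- eta * Rabs (s - t n)) <= 1)
      by (apply exp_decay_le_1; lra).
  assert (H0 := exp_pos (- eta * Rabs (s - t n))). nra.
Qed.

Lemma packet_lipschitz : forall n s u, 0 <= s -> 0 <= u -> Cmod (f n u - f n s)%C <= 2 * C0 * Rabs (u - s).
Proof.
  assert (Aux : forall n s u, 0 <= s -> s <= u -> Cmod (f n u - f n s)%C <= 2 * C0 * (u - s)).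
  { intros n s u Hs Hu. apply (rderiv_bound (f n) (f1 n)); auto.
    - intros; apply (wave_derive (Hwave n)).
    - intros; apply packet1_le; lra. }
  intros n s u Hs Hu. destruct (Rle_dec s u) as [H|H].
  - rewrite Rabs_pos_eq by lra. apply Aux; assumption.
  - rewrite Rabs_left by lra. rewrite <- Cmod_opp.
    replace (- (f n u - f n s))%C with (f n s - f n u)%C by ring.
    replace (- (u - s)) with (s - u) by ring. apply Aux; lra.
Qed.

(** Reflecting the argument makes the sum a continuous function on the whole
    line without changing it on the half-line. *)
Definition total (s : R) : C := weighted (fun n => f n (Rabs s)).
Definition total1 (s : R) : C := weighted (fun n => f1 n (Rabs s)).
Definition total_transform (lam : C) : C := weighted (fun n => F n lam).

Lemma packet_eventually_bounded : forall s, 0 <= s -> eventually_bounded (fun n => f n s).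
Proof. intros s Hs; exists 0%nat, C0; intros; apply packet_le; assumption. Qed.

Lemma packet1_eventually_bounded : forall s, 0 <= s -> eventually_bounded (fun n => f1 n s).
Proof. intros s Hs; exists 0%nat, C0; intros; apply packet1_le; assumption. Qed.

Lemma large_index : forall y, exists N, forall n, (N <= n)%nat -> y <= rho n.
Proof.
  intros y. destruct (INR_unbounded y) as [N HN]. exists N. intros n Hn.
  apply le_INR in Hn. specialize (Hrhon n). lra.
Qed.

Lemma transform_eventually_bounded : forall lam, - eta < Re lam -> eventually_bounded (fun n => F n lam).
Proof.
  intros lam Hlam. destruct (large_index (Rabs (Im lam))) as [N HN].
  exists N, C0. intros n Hn. apply (wave_low (Hwave n)); auto.
Qed.

Lemma transform1_eventually_bounded : forall lam, - eta < Re lam -> eventually_bounded (fun n => F1 n lam).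
Proof.
  intros lam Hlam. destruct (large_index (Rabs (Im lam))) as [N HN].
  exists N, C0. intros n Hn. apply (wave_low (Hwave n)); auto.
Qed.

Lemma total_bounded : bounded_on_Rplus total.
Proof.
  exists (2 * C0 * tail 0). intros s _. apply weighted_bound. intros; apply packet_le, Rabs_pos.
Qed.

Lemma total_lipschitz : forall s u, Cmod (total u - total s)%C <= 2 * (2 * C0) * tail 0 * Rabs (u - s).
Proof.
  intros s u. unfold total. rewrite <- weighted_minus by (apply packet_eventually_bounded, Rabs_pos).
  replace (2 * (2 * C0) * tail 0 * Rabs (u - s)) with (2 * (2 * C0 * Rabs (u - s)) * tail 0) by ring.
  apply weighted_bound. intros n. eapply Rle_trans; [apply packet_lipschitz; apply Rabs_pos|].
  apply Rmult_le_compat_l; [lra|]. apply Rabs_triang_inv2.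
Qed.

Lemma rderiv_csum : forall s N,
  rderiv (fun s => csum (fun n => c n * f n s)%C N) s (csum (fun n => c n * f1 n s)%C N).
Proof.
  intros s N; induction N as [|N IH]; simpl.
  - split; apply (is_derive_const (V := R_NormedModule) 0).
  - destruct IH as [I1 I2]. destruct (rderiv_scal (c N) _ _ _ (wave_derive (Hwave N) s)) as [W1 W2].
    split; apply (is_derive_plus (V := R_NormedModule)
      (fun x => _ (csum (fun n => c n * f n x)%C N)) (fun x => _ (c N * f N x)%C)); assumption.
Qed.

Lemma cderiv_csum : forall lam N, - eta < Re lam ->
  cderiv (fun lam => csum (fun n => c n * F n lam)%C N) lam (csum (fun n => c n * F1 n lam)%C N).
Proof.
  intros lam N Hlam; induction N as [|N IH]; simpl; [apply cderiv_const|].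
  apply (cderiv_plus (fun lam => csum (fun n => c n * F n lam)%C N) (fun lam => c N * F N lam)%C); [exact IH|].
  replace (c N * F1 N lam)%C with (0 * F N lam + c N * F1 N lam)%C by ring.
  apply (cderiv_mult (fun _ => RtoC (c N)) (F N)); [apply cderiv_const|].
  apply (wave_cderiv (Hwave N)); assumption.
Qed.

Lemma small_tail_for : forall B eps, 0 <= B -> 0 < eps ->
  exists N0, forall N, (N0 <= N)%nat -> B * tail N <= eps.
Proof.
  intros B eps HB Heps. destruct (tail_small (eps / (B + 1))) as [N0 H].
  { apply Rdiv_lt_0_compat; lra. }
  exists N0; intros N HN. specialize (H N HN).
  assert (H0 := tail_nonneg N).
  apply (Rmult_le_compat_r (B + 1)) in H; [|lra].
  unfold Rdiv in H; rewrite Rmult_assoc, Rinv_l in H by lra. nra.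
Qed.

(** The second derivatives of the packets are not uniformly bounded, so the
    remainder is split: the head is a finite sum of differentiable functions, and
    in the tail the uniform Lipschitz bounds are multiplied by small weights. *)
Lemma total_derive : forall s, 0 <= s -> is_derive_on_Rplus total s (total1 s).
Proof.
  intros s Hs. apply is_derive_on_Rplus_of_remainder; [assumption|]. intros eps Heps.
  destruct (small_tail_for (2 * (3 * C0)) (eps / 2)) as [N HN]; [lra|lra|].
  specialize (HN N (le_n _)).
  destruct (rderiv_remainder _ _ _ (rderiv_csum s N) (eps / 2)) as (d & Hd & Hh); [lra|].
  exists d; split; [assumption|]. intros h Hhd Hsh. specialize (Hh h Hhd).
  unfold total, total1. rewrite (Rabs_pos_eq s), (Rabs_pos_eq (s + h)) by assumption.
  set (D := fun n => (f n (s + h)%R - f n s - h * f1 n s)%C).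
  assert (HD : forall n, Cmod (D n) <= 3 * C0 * Rabs h).
  { intros n. unfold D, Cminus at 1. eapply Rle_trans; [apply Cmod_triangle|].
    rewrite Cmod_opp, Cmod_mult, Cmod_R.
    assert (P1 := packet_lipschitz n s (s + h) Hs Hsh). replace (s + h - s) with h in P1 by ring.
    assert (P2 := packet1_le n s Hs). assert (P3 := Rabs_pos h). nra. }
  rewrite <- weighted_scal, <- !weighted_minus
    by auto using packet_eventually_bounded, packet1_eventually_bounded,
         eventually_bounded_scal, eventually_bounded_minus.
  change (Cmod (weighted D) <= eps * Rabs h).
  assert (HT := weighted_tail D N (3 * C0 * Rabs h) (fun n _ => HD n)).
  assert (E : csum (fun n => c n * D n)%C N =
    (csum (fun n => c n * f n (s + h)%R) N - csum (fun n => c n * f n s) N - h * csum (fun n => c n * f1 n s) N)%C).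
  { rewrite <- csum_scal, <- !csum_minus. apply csum_ext. intros n; unfold D; ring. }
  rewrite <- E in Hh.
  assert (T := Cmod_triangle (weighted D - csum (fun n => c n * D n)%C N)%C (csum (fun n => c n * D n)%C N)).
  replace (weighted D - csum (fun n => c n * D n)%C N + csum (fun n => c n * D n)%C N)%C
    with (weighted D) in T by ring.
  assert (P3 := Rabs_pos h). nra.
Qed.

Lemma total1_uniformly_continuous : uniformly_continuous_on_Rplus total1.
Proof.
  intros eps. assert (He := cond_pos eps).
  destruct (small_tail_for (2 * (2 * C0)) (eps / 2)) as [N HN]; [lra|lra|].
  specialize (HN N (le_n _)).
  assert (HL : exists L, 0 <= L /\ forall s u, 0 <= s -> s <= u ->
     Cmod (csum (fun n => c n * f1 n u)%C N - csum (fun n => c n * f1 n s)%C N)%C <= L * (u - s)).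
  { clear HN. induction N as [|N (L & HL0 & HL)].
    - exists 0; split; [lra|]. intros s u _ Hu. simpl.
      replace (0 - 0)%C with (RtoC 0) by ring. rewrite Cmod_0; lra.
    - destruct (wave_lip1 (Hwave N)) as [L' HL'].
      exists (L + Rabs (c N) * Rabs L'). split.
      + assert (H1 := Rabs_pos (c N)). assert (H2 := Rabs_pos L'). nra.
      + intros s u Hs Hu. simpl.
        replace (csum (fun n => c n * f1 n u) N + c N * f1 N u - (csum (fun n => c n * f1 n s) N + c N * f1 N s))%C
          with ((csum (fun n => c n * f1 n u) N - csum (fun n => c n * f1 n s) N) + c N * (f1 N u - f1 N s))%C by ring.
        eapply Rle_trans; [apply Cmod_triangle|]. rewrite Cmod_mult, Cmod_R.
        specialize (HL s u Hs Hu). specialize (HL' s u Hs Hu).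
        assert (H1 := Rabs_pos (c N)). assert (H2 := Rle_abs L').
        assert (Cmod (f1 N u - f1 N s) <= Rabs L' * (u - s)) by nra. nra. }
  destruct HL as (L & HL0 & HL).
  assert (Hd : 0 < eps / 2 / (L + 1)) by (apply Rdiv_lt_0_compat; lra).
  exists (mkposreal _ Hd). simpl.
  assert (Main : forall s u, 0 <= s -> s <= u -> u - s < eps / 2 / (L + 1) -> Cmod (total1 u - total1 s)%C < eps).
  { intros s u Hs Hu Hsu. specialize (HL s u Hs Hu).
    unfold total1. rewrite (Rabs_pos_eq s), (Rabs_pos_eq u) by lra.
    rewrite <- weighted_minus by (apply packet1_eventually_bounded; lra).
    set (D := fun n => (f1 n u - f1 n s)%C).
    assert (HD : forall n, Cmod (D n) <= 2 * C0).
    { intros n. unfold D, Cminus. eapply Rle_trans; [apply Cmod_triangle|]. rewrite Cmod_opp.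
      assert (P1 := packet1_le n s Hs). assert (P2 := packet1_le n u ltac:(lra)). lra. }
    assert (HT := weighted_tail D N (2 * C0) (fun n _ => HD n)).
    assert (E : csum (fun n => c n * D n)%C N =
      (csum (fun n => c n * f1 n u) N - csum (fun n => c n * f1 n s) N)%C).
    { rewrite <- csum_minus. apply csum_ext. intros n; unfold D; ring. }
    rewrite <- E in HL.
    assert (T := Cmod_triangle (weighted D - csum (fun n => c n * D n)%C N)%C (csum (fun n => c n * D n)%C N)).
    replace (weighted D - csum (fun n => c n * D n)%C N + csum (fun n => c n * D n)%C N)%C
    with (weighted D) in T by ring.
    apply (Rmult_lt_compat_r (L + 1)) in Hsu; [|lra].
    unfold Rdiv in Hsu at 1; rewrite Rmult_assoc, Rinv_l in Hsu by lra.
    change (Cmod (weighted D) < eps). nra. }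
  intros s u Hs Hu Hsu. destruct (Rle_dec s u) as [H|H].
  - rewrite Rabs_pos_eq in Hsu by lra. apply Main; assumption.
  - rewrite Rabs_left in Hsu by lra. rewrite <- Cmod_opp.
    replace (- (total1 u - total1 s))%C with (total1 s - total1 u)%C by ring. apply Main; lra.
Qed.

(** For fixed [lam] all but finitely many packets have [lam] in their
    low-frequency range, where their transforms are uniformly tame. *)
Lemma total_transform_cderiv : forall lam, - eta < Re lam ->
  cderiv total_transform lam (weighted (fun n => F1 n lam)).
Proof.
  intros lam Hlam.
  destruct (large_index (Rabs (Im lam) + 1)) as [N HN].
  apply cderiv_of_remainder. intros eps Heps.
  destruct (cderiv_remainder _ _ _ (cderiv_csum lam N Hlam) (eps / 2)) as (d & Hd & Hh); [lra|].
  set (B := 2 * C0 * tail N). assert (HB : 0 <= B) by (assert (H := tail_nonneg N); unfold B; nra).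
  exists (Rmin d (Rmin (Rmin 1 (Re lam + eta)) (eps / 2 / (B + 1)))). split.
  { repeat apply Rmin_glb_lt; try lra. repeat apply Rdiv_lt_0_compat; lra. }
  intros h Hhd.
  assert (G1 := Rlt_le_trans _ _ _ Hhd (Rmin_l _ _)).
  assert (G2 := Rlt_le_trans _ _ _ Hhd (Rmin_r _ _)).
  assert (G3 := Rlt_le_trans _ _ _ G2 (Rmin_l _ _)).
  assert (G4 := Rlt_le_trans _ _ _ G2 (Rmin_r _ _)).
  assert (G5 := Rlt_le_trans _ _ _ G3 (Rmin_l _ _)).
  assert (G6 := Rlt_le_trans _ _ _ G3 (Rmin_r _ _)).
  clear Hhd G2 G3. specialize (Hh h G1).
  assert (Hre := re_le_Cmod h). assert (Him := im_le_Cmod h).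
  assert (Hlh : - eta < Re (lam + h)%C).
  { apply Rabs_le_between in Hre. unfold Re in *; simpl. lra. }
  assert (Himh : Rabs (Im (lam + h)%C) <= Rabs (Im lam) + 1).
  { unfold Im in *; simpl. eapply Rle_trans; [apply Rabs_triang|]. lra. }
  set (D := fun n => (F n (lam + h) - F n lam - h * F1 n lam)%C).
  assert (HD : forall n, (N <= n)%nat -> Cmod (D n) <= C0 * Cmod h ^ 2).
  { intros n Hn. specialize (HN n Hn). apply (wave_low2 (Hwave n)); auto; lra. }
  unfold total_transform.
  rewrite <- weighted_scal, <- !weighted_minus
    by auto using transform_eventually_bounded, transform1_eventually_bounded,
         eventually_bounded_scal, eventually_bounded_minus.
  change (Cmod (weighted D) <= eps * Cmod h).
  assert (HT := weighted_tail D N (C0 * Cmod h ^ 2) HD).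
  assert (E : csum (fun n => c n * D n)%C N =
    (csum (fun n => c n * F n (lam + h)) N - csum (fun n => c n * F n lam) N - h * csum (fun n => c n * F1 n lam) N)%C).
  { rewrite <- csum_scal, <- !csum_minus. apply csum_ext. intros n; unfold D; ring. }
  rewrite <- E in Hh.
  assert (T := Cmod_triangle (weighted D - csum (fun n => c n * D n)%C N)%C (csum (fun n => c n * D n)%C N)).
  replace (weighted D - csum (fun n => c n * D n)%C N + csum (fun n => c n * D n)%C N)%C
    with (weighted D) in T by ring.
  assert (P3 := Cmod_ge_0 h).
  assert (HBh : B * Cmod h <= eps / 2).
  { apply (Rmult_lt_compat_r (B + 1)) in G4; [|lra].
    unfold Rdiv in G4 at 1; rewrite Rmult_assoc, Rinv_l in G4 by lra. nra. }
  replace (2 * (C0 * Cmod h ^ 2) * tail N) with (B * Cmod h * Cmod h) in HT by (unfold B; ring).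
  nra.
Qed.

Lemma laplace_kernel_rcont : forall lam s, rcont (fun s : R => Cexp (- (lam * s))) s.
Proof.
  intros lam s. apply rcont_exp. apply rcont_ext with (fun s => - lam * RtoC s)%C; [intros; ring|].
  apply rcont_mult; [apply rcont_const|apply rcont_RtoC].
Qed.

Lemma csum_packet_rcont : forall N s, rcont (fun s => csum (fun n => c n * f n s)%C N) s.
Proof. intros; eapply rderiv_rcont, rderiv_csum. Qed.

Lemma total_rcont : forall s, rcont total s.
Proof. apply rcont_of_lipschitz with (2 * (2 * C0) * tail 0), total_lipschitz. Qed.

Lemma laplace_csum : forall lam N, - eta < Re lam ->
  has_laplace (fun s => csum (fun n => c n * f n s)%C N) lam (csum (fun n => c n * F n lam)%C N).
Proof.
  intros lam N Hlam; induction N as [|N IH]; intros eps Heps.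
  - exists 0; split; [lra|]. intros T HT. simpl.
    rewrite (CInt_ext _ (fun s => 0 * Cexp (- (lam * s)))%C) by (auto; intros; ring).
    rewrite CInt_scal by (auto; intros; apply laplace_kernel_rcont).
    replace (0 * CInt (fun s : R => Cexp (- (lam * s))) 0 T - 0)%C with (RtoC 0) by ring.
    rewrite Cmod_0; lra.
  - destruct (IH (eps / 2)) as (T1 & HT1 & H1); [lra|].
    destruct (wave_laplace (Hwave N) lam Hlam (eps / 2 / (Rabs (c N) + 1))) as (T2 & HT2 & H2).
    { assert (H := Rabs_pos (c N)). repeat apply Rdiv_lt_0_compat; lra. }
    exists (Rmax T1 T2). split; [eapply Rle_trans; [exact HT1|apply Rmax_l]|]. intros T HT.
    specialize (H1 T (Rle_trans _ _ _ (Rmax_l _ _) HT)). specialize (H2 T (Rle_trans _ _ _ (Rmax_r _ _) HT)).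
    assert (HT0 : 0 <= T) by (eapply Rle_trans; [exact HT1|]; eapply Rle_trans; [apply Rmax_l|exact HT]).
    assert (Hf : forall s, rcont (f N) s) by (intros; eapply rderiv_rcont, (wave_derive (Hwave N))).
    simpl.
    rewrite (CInt_ext _ (fun s => Cexp (- (lam * s)) * csum (fun n => c n * f n s) N
       + c N * (Cexp (- (lam * s)) * f N s))%C) by (auto; intros; ring).
    rewrite CInt_plus, CInt_scal; auto.
    + set (I1 := CInt (fun s : R => Cexp (- (lam * s)) * csum (fun n => c n * f n s) N)%C 0 T) in *.
      set (I2 := CInt (fun s : R => Cexp (- (lam * s)) * f N s)%C 0 T) in *.
      replace (I1 + c N * I2 - (csum (fun n => c n * F n lam) N + c N * F N lam))%C
        with ((I1 - csum (fun n => c n * F n lam) N) + c N * (I2 - F N lam))%C by ring.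
      eapply Rle_trans; [apply Cmod_triangle|]. rewrite Cmod_mult, Cmod_R.
      assert (H := Rabs_pos (c N)). assert (H3 := Cmod_ge_0 (I2 - F N lam)%C).
      apply (Rmult_le_compat_r (Rabs (c N) + 1)) in H2; [|lra].
      unfold Rdiv in H2 at 1; rewrite Rmult_assoc, Rinv_l in H2 by lra. nra.
    + intros; apply rcont_mult; [apply laplace_kernel_rcont|apply Hf].
    + intros; apply rcont_mult; [apply laplace_kernel_rcont|apply csum_packet_rcont].
    + intros; apply rcont_mult; [apply rcont_const|]. apply rcont_mult; [apply laplace_kernel_rcont|apply Hf].
Qed.

Lemma RInt_exp_decay : forall k T, 0 < k -> 0 <= T ->
  ex_RInt (fun s => exp (- (k * s))) 0 T /\ RInt (fun s => exp (- (k * s))) 0 T <= / k.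
Proof.
  intros k T Hk HT.
  assert (H : is_RInt (fun s => exp (- (k * s))) 0 T
     (minus (- / k * exp (- (k * T))) (- / k * exp (- (k * 0))))).
  { apply (is_RInt_derive (fun s => - / k * exp (- (k * s)))).
    - intros s _. auto_derive; auto. field. lra.
    - intros s _. apply (ex_derive_continuous (V := R_NormedModule)). auto_derive; auto. }
  split; [eexists; exact H|]. rewrite (is_RInt_unique _ _ _ _ H).
  unfold minus, plus, opp; simpl. rewrite Rmult_0_r, Ropp_0, exp_0.
  assert (H0 : 0 < / k) by (apply Rinv_0_lt_compat; assumption).
  assert (H1 := exp_pos (- (k * T))). nra.
Qed.

(** Replacing the sum by a partial sum changes the integral up to time [T] by a
    multiple of the tail over [Re lam], uniformly in [T]. *)
Lemma total_laplace : forall lam, 0 < Re lam -> total_transform lam = laplace total lam.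
Proof.
  intros lam Hlam. symmetry. unfold laplace.
  apply (is_RInt_gen_unique (V := C_R_CompleteNormedModule)).
  apply converges_is_RInt_gen.
  { intros s; apply rcont_mult; [apply laplace_kernel_rcont|apply total_rcont]. }
  intros eps Heps.
  destruct (large_index (Rabs (Im lam))) as [N1 HN1].
  assert (Hk : 0 < / Re lam) by (apply Rinv_0_lt_compat; assumption).
  destruct (small_tail_for (2 * (2 * C0) * / Re lam) (eps / 3)) as [N2 HN2]; [|lra|].
  { apply Rmult_le_pos; lra. }
  destruct (small_tail_for (2 * C0) (eps / 3)) as [N3 HN3]; [lra|lra|].
  set (N := Nat.max N1 (Nat.max N2 N3)).
  specialize (HN2 N ltac:(lia)). specialize (HN3 N ltac:(lia)).
  destruct (laplace_csum lam N ltac:(lra) (eps / 3)) as (T0 & HT0 & HT); [lra|].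
  exists T0; split; [assumption|]. intros T HTT. specialize (HT T HTT).
  assert (HT1 : 0 <= T) by lra.
  assert (H1 : Cmod (total_transform lam - csum (fun n => c n * F n lam)%C N)%C <= eps / 3).
  { eapply Rle_trans; [apply weighted_tail with (B := C0)|exact HN3].
    intros n Hn. apply (wave_low (Hwave n)); [lra|]. apply HN1; lia. }
  set (E := fun s => (total s - csum (fun n => c n * f n s) N)%C).
  assert (HE : forall s, 0 <= s -> Cmod (E s) <= 2 * C0 * tail N).
  { intros s Hs. unfold E, total. rewrite Rabs_pos_eq by assumption.
    apply weighted_tail. intros; apply packet_le; assumption. }
  assert (HEc : forall s, rcont E s) by (intros; apply rcont_minus; [apply total_rcont|apply csum_packet_rcont]).
  rewrite (CInt_ext _ (fun s => Cexp (- (lam * s)) * csum (fun n => c n * f n s) N + Cexp (- (lam * s)) * E s)%C)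
    by (auto; intros; unfold E; ring).
  rewrite CInt_plus by (auto; intros; apply rcont_mult; auto using laplace_kernel_rcont, csum_packet_rcont).
  assert (H2 : Cmod (CInt (fun s => Cexp (- (lam * s)) * E s)%C 0 T) <= eps / 3).
  { destruct (RInt_exp_decay (Re lam) T Hlam HT1) as [I1 I2].
    eapply Rle_trans.
    - apply (Cmod_CInt_le _ (fun s => (2 * C0 * tail N) * exp (- (Re lam * s)))); auto.
      + intros; apply rcont_mult; auto using laplace_kernel_rcont.
      + apply (ex_RInt_scal (V := R_CompleteNormedModule)); assumption.
      + intros s Hs. rewrite Cmod_mult, Cmod_Cexp, Rmult_comm.
        apply Rmult_le_compat; [apply Cmod_ge_0|apply Rlt_le, exp_pos|apply HE; lra|].
        apply exp_le_compat. unfold Re; simpl; lra.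
    - rewrite (RInt_scal (V := R_CompleteNormedModule)) by assumption.
      unfold scal; simpl; unfold mult; simpl.
      assert (H0 := tail_nonneg N).
      assert (H3 : 0 <= 2 * C0 * tail N) by nra.
      assert (H4 := Rmult_le_compat_l _ _ _ H3 I2). simpl in H4. lra. }
  set (I1 := CInt (fun s : R => Cexp (- (lam * s)) * csum (fun n => c n * f n s) N)%C 0 T) in *.
  set (I2 := CInt (fun s : R => Cexp (- (lam * s)) * E s)%C 0 T) in *.
  replace (I1 + I2 - total_transform lam)%C with
    ((I1 - csum (fun n => c n * F n lam) N) + (I2 + - (total_transform lam - csum (fun n => c n * F n lam) N)))%C by ring.
  eapply Rle_trans; [apply Cmod_triangle|].
  assert (T2 := Cmod_triangle I2 (- (total_transform lam - csum (fun n => c n * F n lam) N))%C).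
  rewrite Cmod_opp in T2. lra.
Qed.

Lemma total_transform_bound : forall (w lam : C) B, - eta < Re lam ->
  (forall n, Cmod (w * F n lam)%C <= B) -> Cmod (w * total_transform lam)%C <= 2 * B * tail 0.
Proof.
  intros w lam B Hlam H. unfold total_transform. rewrite <- weighted_scal by (apply transform_eventually_bounded; assumption).
  apply weighted_bound; assumption.
Qed.

End Superposition.

(** * The function MK and its inverse *)

Section InverseFunction.

Context (M K : R -> R).
Hypothesis HM0 : positive_on_Rplus M.
Hypothesis HK0 : positive_on_Rplus K.
Hypothesis HMm : nondecreasing_on_Rplus M.
Hypothesis HKm : nondecreasing_on_Rplus K.
Hypothesis HMc : continuous_on Rplus_set M.
Hypothesis HKc : continuous_on Rplus_set K.

(** One-sided continuity at 0 becomes continuity on the line, as the intermediate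
    value theorem requires. *)
Lemma continuous_on_reflect : forall g : R -> R, continuous_on Rplus_set g ->
  forall s : R, continuous (fun s => g (Rabs s)) s.
Proof.
  intros g Hg s. unfold continuous.
  apply (filterlim_comp _ _ _ Rabs g (locally s) (within Rplus_set (locally (Rabs s)))).
  - intros P HP. unfold filtermap. unfold within in HP.
    assert (H := continuous_Rabs s _ HP). unfold filtermap in H.
    apply filter_imp with (2 := H). intros x Hx. apply Hx, Rabs_pos.
  - apply Hg, Rabs_pos.
Qed.

Lemma MK_continuous : forall s : R, continuous (fun s => MK M K (Rabs s)) s.
Proof.
  assert (Hln : forall (g : R -> R) (s : R), (forall s, continuous g s) -> 0 < 1 + g s -> continuous (fun s => ln (1 + g s)) s).
  { intros g s Hg Hp. apply (continuous_comp (fun s => 1 + g s) ln).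
    - apply (continuous_plus (fun _ => 1) g); [apply continuous_const|apply Hg].
    - apply (ex_derive_continuous (V := R_NormedModule)). auto_derive. exact Hp. }
  intros s. unfold MK.
  apply (continuous_mult (K := R_AbsRing) (fun s => M (Rabs s))); [apply continuous_on_reflect, HMc|].
  apply (continuous_plus (fun s => ln (1 + Rabs s)) (fun s => ln (1 + K (Rabs s)))).
  - apply Hln; [apply continuous_Rabs|]. assert (H := Rabs_pos s). lra.
  - apply (Hln (fun s => K (Rabs s))); [apply continuous_on_reflect, HKc|].
    assert (H := HK0 (Rabs s) (Rabs_pos s)). lra.
Qed.

Lemma MK_increasing : forall s u, 0 <= s -> s < u -> MK M K s < MK M K u.
Proof.
  intros s u Hs Hu. unfold MK.
  assert (M1 := HM0 s Hs). assert (M2 := HMm s u Hs ltac:(lra)).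
  assert (K1 := HK0 s Hs). assert (K2 := HKm s u Hs ltac:(lra)).
  assert (L1 : ln (1 + s) < ln (1 + u)) by (apply ln_increasing; lra).
  assert (L2 : ln (1 + K s) <= ln (1 + K u)).
  { destruct K2 as [K2| ->]; [|lra]. apply Rlt_le, ln_increasing; lra. }
  assert (L3 : 0 <= ln (1 + s)).
  { destruct Hs as [Hs|<-]; [|rewrite Rplus_0_r, ln_1; lra]. rewrite <- ln_1. apply Rlt_le, ln_increasing; lra. }
  assert (L4 : 0 < ln (1 + K s)) by (rewrite <- ln_1; apply ln_increasing; lra).
  apply Rlt_le_trans with (M s * (ln (1 + u) + ln (1 + K u))).
  - apply Rmult_lt_compat_l; lra.
  - apply Rmult_le_compat_r; lra.
Qed.

Lemma MK_nondecreasing : forall s u, 0 <= s -> s <= u -> MK M K s <= MK M K u.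
Proof. intros s u Hs [H| ->]; [apply Rlt_le, MK_increasing; assumption|lra]. Qed.

Lemma MK_nonneg : forall s, 0 <= s -> 0 <= MK M K s.
Proof.
  intros s Hs. eapply Rle_trans; [|apply (MK_nondecreasing 0 s); lra].
  unfold MK. rewrite Rplus_0_r, ln_1, Rplus_0_l. apply Rmult_le_pos; [apply Rlt_le, HM0; lra|].
  assert (H := HK0 0 (Rle_refl _)). rewrite <- ln_1 at 1. apply Rlt_le, ln_increasing; lra.
Qed.

Lemma MK_surjective : forall T, MK M K 0 <= T -> exists s, 0 <= s /\ MK M K s = T.
Proof.
  intros T HT.
  assert (HM := HM0 0 (Rle_refl _)).
  set (b := exp (T / M 0)).
  assert (Hb : 0 < b) by apply exp_pos.
  assert (HTb : T <= MK M K b).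
  { unfold MK. assert (M2 := HMm 0 b ltac:(lra) ltac:(lra)).
    assert (K1 := HK0 b ltac:(lra)).
    assert (L2 : 0 < ln (1 + K b)) by (rewrite <- ln_1; apply ln_increasing; lra).
    assert (L1 : T / M 0 < ln (1 + b)).
    { rewrite <- (ln_exp (T / M 0)). apply ln_increasing; fold b; lra. }
    assert (HTM : T = M 0 * (T / M 0)) by (field; lra).
    destruct (Rle_dec 0 (T / M 0)) as [Hp|Hn].
    - rewrite HTM at 1. apply Rmult_le_compat; lra.
    - assert (T <= 0) by nra. assert (HP := MK_nonneg b ltac:(lra)). unfold MK in HP. lra. }
  destruct (IVT_gen (fun s => MK M K (Rabs s)) 0 b T) as (s & Hs & E).
  - intros s. apply continuity_pt_filterlim, MK_continuous.
  - rewrite Rabs_R0, (Rabs_pos_eq b) by lra. rewrite Rmin_left, Rmax_right by lra. lra.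
  - rewrite Rmin_left, Rmax_right in Hs by lra. rewrite Rabs_pos_eq in E by lra.
    exists s; split; [lra|exact E].
Qed.

Lemma MK_inv_spec : forall T, MK M K 0 <= T -> 0 <= MK_inv M K T /\ MK M K (MK_inv M K T) = T.
Proof.
  intros T HT. unfold MK_inv.
  apply (iota_correct (V := R_CompleteNormedModule) (fun s : R => 0 <= s /\ MK M K s = T)).
  destruct (MK_surjective T HT) as (s & Hs & E). exists s; split; [auto|].
  intros u [Hu E']. destruct (Rtotal_order s u) as [H|[H|H]]; [|exact H|].
  - assert (H1 := MK_increasing s u Hs H). lra.
  - assert (H1 := MK_increasing u s Hu H). lra.
Qed.

Lemma MK_inv_ge : forall T s, 0 <= s -> MK M K s <= T -> s <= MK_inv M K T.
Proof.
  intros T s Hs HT. assert (H0 := MK_nondecreasing 0 s (Rle_refl _) Hs).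
  destruct (MK_inv_spec T ltac:(lra)) as [H1 H2].
  apply Rnot_lt_le. intros H. assert (H3 := MK_increasing _ _ H1 H). lra.
Qed.

(** [M] contributes [exp (alpha s)], and [ln K] another [exp (alpha s)]. *)
Lemma MK_growth : forall alpha, 0 < alpha ->
  bigO_infty M (fun s => exp (alpha * s)) -> bigO_infty K (fun s => exp (exp (alpha * s))) ->
  exists A S, 0 <= A /\ forall s, S <= s -> 0 <= s -> MK M K s <= A * exp (2 * alpha * s).
Proof.
  intros alpha Ha (A1 & S1 & H1) (A2 & S2 & H2).
  exists (Rabs A1 * (/ alpha + ln (1 + Rabs A2) + 1)), (Rmax S1 S2 + 1).
  assert (P1 := Rabs_pos A1). assert (P2 := Rabs_pos A2).
  assert (Hia : 0 < / alpha) by (apply Rinv_0_lt_compat; assumption).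
  assert (L0 : 0 <= ln (1 + Rabs A2)).
  { destruct P2 as [P2|<-]; [|rewrite Rplus_0_r, ln_1; lra]. rewrite <- ln_1. apply Rlt_le, ln_increasing; lra. }
  split; [apply Rmult_le_pos; lra|].
  intros s Hs Hs0.
  assert (B1 := Rmax_l S1 S2). assert (B2 := Rmax_r S1 S2).
  specialize (H1 s ltac:(lra)). specialize (H2 s ltac:(lra)).
  assert (HM := HM0 s Hs0). assert (HK := HK0 s Hs0).
  rewrite (Rabs_pos_eq (M s)), (Rabs_pos_eq (exp _)) in H1 by (try apply Rlt_le, exp_pos; lra).
  rewrite (Rabs_pos_eq (K s)), (Rabs_pos_eq (exp _)) in H2 by (try apply Rlt_le, exp_pos; lra).
  set (e := exp (alpha * s)) in *.
  assert (He : 1 + alpha * s <= e) by apply exp_ineq1_le.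
  assert (Has : 0 <= alpha * s) by (apply Rmult_le_pos; lra).
  assert (G1 : M s <= Rabs A1 * e) by (assert (H := Rle_abs A1); nra).
  assert (G2 : ln (1 + s) <= / alpha * e).
  { assert (H : ln (1 + s) <= s).
    { destruct Hs0 as [Hs0|<-]; [|rewrite Rplus_0_r, ln_1; lra].
      rewrite <- (ln_exp s) at 2. apply Rlt_le, ln_increasing; [lra|]. apply exp_ineq1; lra. }
    assert (H' : s = / alpha * (alpha * s)) by (field; lra). nra. }
  assert (G3 : ln (1 + K s) <= ln (1 + Rabs A2) + e).
  { assert (Hee := exp_pos e). assert (Hee1 : 1 <= exp e) by (assert (H := exp_ineq1_le e); lra).
    rewrite <- (ln_exp e). rewrite <- ln_mult by lra.
    assert (H : 1 + K s <= (1 + Rabs A2) * exp e) by (assert (H := Rle_abs A2); nra).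
    destruct H as [H|H]; [apply Rlt_le, ln_increasing; lra|rewrite H; lra]. }
  assert (G4 : 0 <= ln (1 + s) + ln (1 + K s)).
  { assert (H := MK_nonneg s Hs0). unfold MK in H.
    apply Rnot_lt_le; intros H'. nra. }
  unfold MK. replace (exp (2 * alpha * s)) with (e * e)
    by (unfold e; rewrite <- exp_plus; f_equal; ring).
  assert (G5 : ln (1 + s) + ln (1 + K s) <= (/ alpha + ln (1 + Rabs A2) + 1) * e) by nra.
  replace (Rabs A1 * (/ alpha + ln (1 + Rabs A2) + 1) * (e * e))
    with (Rabs A1 * e * ((/ alpha + ln (1 + Rabs A2) + 1) * e)) by ring.
  apply Rmult_le_compat; lra.
Qed.

End InverseFunction.

(** * Gliding hump *)

Section GlidingHump.

Context (v : nat -> nat -> C) (p : R) (threshold : nat -> R).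

(** The next term is added only when the partial sum is too small at the current
    index; two numbers whose difference is at least the threshold cannot both be
    smaller than half of it. *)
Definition hump_choice (m : nat) (x : C) : R :=
  if Rle_dec (threshold m / 2) (Cmod x) then 0 else p ^ m.

Fixpoint hump (n : nat) : nat -> C :=
  match n with
  | O => fun _ => 0%C
  | S m => fun j => (hump m j + hump_choice m (hump m m) * v m j)%C
  end.

Definition hump_coeff (m : nat) : R := hump_choice m (hump m m).

Lemma hump_csum : forall n j, hump n j = csum (fun k => hump_coeff k * v k j)%C n.
Proof.
  intros n j; induction n as [|n IH]; [reflexivity|].
  simpl csum. rewrite <- IH. reflexivity.
Qed.

Lemma hump_diagonal : forall n, threshold n <= p ^ n * Cmod (v n n) -> 0 <= p ->
  threshold n / 2 <= Cmod (hump (S n) n).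
Proof.
  intros n H Hp. simpl.
  assert (E : hump_choice n (hump n n) = 0 /\ threshold n / 2 <= Cmod (hump n n) \/
              hump_choice n (hump n n) = p ^ n /\ Cmod (hump n n) < threshold n / 2).
  { unfold hump_choice. destruct Rle_dec; [left|right]; split; auto; lra. }
  destruct E as [[-> E]|[-> E]].
  - rewrite Cmult_0_l, Cplus_0_r. exact E.
  - assert (T := Cmod_add_ge (RtoC (p ^ n) * v n n)%C (hump n n)).
    rewrite Cmod_mult, Cmod_R, Rabs_pos_eq in T by (apply pow_le; assumption).
    rewrite Cplus_comm. lra.
Qed.

End GlidingHump.

(** Each coefficient is chosen to make the partial sum large at its own index.
    The later terms cannot spoil it: monotonicity of [rho] bounds them by
    [C0 / rho n], and [p] is small compared with [c0 / C0], so that their total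
    weight is at most half of what the choice guarantees. *)
Lemma gliding_hump : forall (v : nat -> nat -> C) p c0 C0 (rho : nat -> R),
  0 < p < 1 -> 0 < c0 -> 0 <= C0 -> 8 * C0 * p <= c0 * (1 - p) ->
  (forall n, 0 < rho n) -> (forall n m, (n <= m)%nat -> rho n <= rho m) ->
  (forall n, c0 / rho n <= Cmod (v n n)) -> (forall k n, Cmod (v k n) <= C0 / rho k) ->
  exists e : nat -> R, (forall k, Rabs (e k) <= p ^ k) /\
    forall n, c0 / 4 * (p ^ n / rho n) <= Cmod (weighted e (fun k => v k n)).
Proof.
  intros v p c0 C0 rho Hp Hc0 HC0 Hpc Hrho Hmono Hdiag Hv.
  set (th := fun n => p ^ n * (c0 / rho n)).
  exists (hump_coeff v p th).
  assert (Hpn : forall n, 0 < p ^ n) by (intros; apply pow_lt; lra).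
  assert (He : forall k, Rabs (hump_coeff v p th k) <= p ^ k).
  { intros k. specialize (Hpn k). unfold hump_coeff, hump_choice. destruct Rle_dec; [rewrite Rabs_R0|rewrite Rabs_pos_eq]; lra. }
  split; [exact He|]. intros n.
  assert (Ha : ex_series (fun k => p ^ k)) by (apply ex_series_geom; rewrite Rabs_pos_eq; lra).
  assert (Hir : 0 < / rho n) by (apply Rinv_0_lt_compat, Hrho).
  assert (HD := hump_diagonal v p th n). rewrite hump_csum in HD.
  specialize (HD (Rmult_le_compat_l _ _ _ (Rlt_le _ _ (Hpn n)) (Hdiag n)) ltac:(lra)).
  assert (HT := weighted_tail (hump_coeff v p th) (fun k => p ^ k) He Ha (fun k => v k n) (S n) (C0 / rho n)).
  assert (HB : forall k, (S n <= k)%nat -> Cmod (v k n) <= C0 / rho n).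
  { intros k Hk. eapply Rle_trans; [apply Hv|]. apply Rmult_le_compat_l; [assumption|].
    apply Rinv_le_contravar; [apply Hrho|apply Hmono; lia]. }
  specialize (HT HB).
  assert (Ht : tail (fun k => p ^ k) (S n) = p ^ n * p / (1 - p)).
  { unfold tail. rewrite (Series_ext _ (fun k => p ^ S n * p ^ k)) by (intros; apply pow_add).
    rewrite Series_scal_l, Series_geom by (rewrite Rabs_pos_eq; lra). simpl. field. lra. }
  rewrite Ht in HT.
  set (W := weighted (hump_coeff v p th) (fun k => v k n)) in *.
  set (Sn := csum (fun k => hump_coeff v p th k * v k n)%C (S n)) in *.
  assert (T := Cmod_sub_ge Sn W).
  rewrite <- Cmod_opp in HT. replace (- (W - Sn))%C with (Sn - W)%C in HT by ring.
  assert (HQ : 2 * (C0 / rho n) * (p ^ n * p / (1 - p)) <= c0 / 4 * (p ^ n / rho n)).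
  { apply (Rmult_le_reg_r (4 * (1 - p))); [lra|].
    replace (2 * (C0 / rho n) * (p ^ n * p / (1 - p)) * (4 * (1 - p)))
      with (8 * C0 * p * (p ^ n * / rho n)) by (field; specialize (Hrho n); lra).
    replace (c0 / 4 * (p ^ n / rho n) * (4 * (1 - p)))
      with (c0 * (1 - p) * (p ^ n * / rho n)) by (field; specialize (Hrho n); lra).
    apply Rmult_le_compat_r; [|assumption]. specialize (Hpn n). nra. }
  unfold th in HD. replace (p ^ n * (c0 / rho n) / 2) with (2 * (c0 / 4 * (p ^ n / rho n))) in HD
    by (field; specialize (Hrho n); lra).
  lra.
Qed.

(** * Optimality *)

Section Optimality.

Context (M K r : R -> R) (alpha : R).
Hypothesis HM0 : positive_on_Rplus M.
Hypothesis HK0 : positive_on_Rplus K.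
Hypothesis HMm : nondecreasing_on_Rplus M.
Hypothesis HKm : nondecreasing_on_Rplus K.
Hypothesis HMc : continuous_on Rplus_set M.
Hypothesis HKc : continuous_on Rplus_set K.
Hypothesis Halpha : 0 < alpha.
Hypothesis HMg : bigO_infty M (fun s => exp (alpha * s)).
Hypothesis HKg : bigO_infty K (fun s => exp (exp (alpha * s))).

Let eta := / M 0 + 1.
Let N := (2 * alpha + 1) * eta.

Lemma eta_ge : 1 <= eta.
Proof.
  unfold eta. assert (H := Rinv_0_lt_compat _ (HM0 0 (Rle_refl _))). lra.
Qed.

(** The margin 1 between [Omega M] and the line [Re lam = - eta] makes
    [exp (- Re lam * s)] times the packet integrable with a uniform constant. *)
Lemma Omega_left : forall lam, Omega M lam -> - (eta - 1) < Re lam.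
Proof.
  intros lam H. unfold Omega in H. unfold eta.
  assert (H0 := HM0 0 (Rle_refl _)).
  assert (H1 := HMm 0 (Rabs (Im lam)) (Rle_refl _) (Rabs_pos _)).
  assert (H2 := Rinv_le_contravar _ _ H0 H1). unfold Rdiv in H. lra.
Qed.

(** With [X / eta = (2 alpha + 1) rho], the number [exp (X / eta)] exceeds
    [exp (2 alpha rho)], the order of the upper bound for [MK rho], by a factor
    [exp rho], which absorbs all constants for large [rho]. *)
Lemma wave_exists : exists rho0, 1 <= rho0 /\ forall rho t, rho0 <= rho -> 0 <= t -> t <= MK M K rho ->
  exists f f1 F F1, wave (packet_const eta N) (exp (-6)) eta rho t f f1 F F1.
Proof.
  destruct (MK_growth M K HM0 HK0 HMm HKm alpha Halpha HMg HKg) as (A & S & HA & HG).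
  assert (He := eta_ge).
  assert (H6 := exp_pos 6).
  exists (1 + Rabs S + 4 * eta * A + 16 * eta * exp 6).
  assert (P1 := Rabs_pos S). assert (P2 : 0 <= 4 * eta * A) by (apply Rmult_le_pos; lra).
  assert (P3 : 0 < 16 * eta * exp 6) by (repeat apply Rmult_lt_0_compat; lra).
  split; [lra|]. intros rho t Hrho Ht HtM.
  assert (HtA : t <= A * exp (2 * alpha * rho)).
  { eapply Rle_trans; [exact HtM|]. apply HG; [|lra]. assert (H := Rle_abs S). lra. }
  set (E := exp (/ eta * (N * rho))).
  assert (HE : E = exp (2 * alpha * rho) * exp rho).
  { unfold E, N. rewrite <- exp_plus. f_equal. field. lra. }
  assert (Her := exp_ineq1_le rho).
  assert (Hea : 1 <= exp (2 * alpha * rho)).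
  { assert (H := exp_ineq1_le (2 * alpha * rho)). nra. }
  do 4 eexists. apply (packet_wave eta N rho t).
  - exact He.
  - unfold N. nra.
  - lra.
  - exact Ht.
  - fold E. apply exp_le_compat.
    assert (4 * eta * t <= E).
    { rewrite HE. apply Rle_trans with (exp (2 * alpha * rho) * (4 * eta * A)).
      - replace (exp (2 * alpha * rho) * (4 * eta * A)) with (4 * eta * (A * exp (2 * alpha * rho))) by ring.
        apply Rmult_le_compat_l; lra.
      - apply Rmult_le_compat_l; lra. }
    lra.
  - fold E.
    assert (HEr : rho <= E) by (rewrite HE; nra).
    assert (H1 : exp (- (E / 2)) <= / (1 + rho / 2)).
    { rewrite exp_Ropp. apply Rinv_le_contravar; [lra|]. assert (H := exp_ineq1_le (E / 2)). lra. }
    replace (exp (-6)) with (/ exp 6) by (rewrite <- exp_Ropp; f_equal; ring).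
    apply Rle_trans with (8 * eta * / (1 + rho / 2)); [apply Rmult_le_compat_l; lra|].
    apply (Rmult_le_reg_r (1 + rho / 2)); [lra|]. rewrite Rmult_assoc, Rinv_l, Rmult_1_r by lra.
    apply (Rmult_le_reg_l (exp 6)); [lra|].
    replace (exp 6 * (/ exp 6 * (1 + rho / 2))) with (1 + rho / 2) by (field; lra). lra.
Qed.

Lemma packet_const_pos : 0 < packet_const eta N.
Proof. unfold packet_const, N. assert (H := eta_ge). nra. Qed.

(** Above the frequency [rho] only the size of the packet in time is used. For
    the second bound, [lam * F lam - f 0] is the transform of [f1]; one more [C0]
    accounts for [f 0]. *)
Lemma wave_high : forall C0 c0 rho t f f1 F F1 lam, 0 <= C0 -> 1 <= rho -> 0 <= t ->
  wave C0 c0 eta rho t f f1 F F1 -> Omega M lam -> rho <= Rabs (Im lam) ->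
  Cmod (F lam) <= 18 * C0 / rho * exp (t / M rho) /\ Cmod (lam * F lam)%C <= 18 * C0 * exp (t / M rho).
Proof.
  intros C0 c0 rho t f f1 F F1 lam HC0 Hrho Ht W HO Him.
  assert (HMr := HM0 rho ltac:(lra)).
  assert (HL := Omega_left lam HO).
  assert (Hm1 : 0 < / M rho) by (apply Rinv_0_lt_compat; assumption).
  assert (Hm2 : / M rho <= eta - 1).
  { unfold eta. assert (H0 := HM0 0 (Rle_refl _)). assert (H1 := HMm 0 rho (Rle_refl _) ltac:(lra)).
    assert (H2 := Rinv_le_contravar _ _ H0 H1). lra. }
  assert (Hm3 : - / M rho <= Re lam).
  { unfold Omega in HO. assert (H1 := HMm rho (Rabs (Im lam)) ltac:(lra) Him).
    assert (H2 := Rinv_le_contravar _ _ HMr H1). unfold Rdiv in HO. lra. }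
  assert (Hir : 0 < / rho <= 1).
  { split; [apply Rinv_0_lt_compat; lra|]. rewrite <- Rinv_1. apply Rinv_le_contravar; lra. }
  assert (Hexp : 1 <= exp (/ M rho * t)).
  { assert (H := exp_ineq1_le (/ M rho * t)). assert (H1 : 0 <= / M rho * t) by (apply Rmult_le_pos; lra). lra. }
  assert (HB : 0 <= C0 / rho) by (apply Rmult_le_pos; lra).
  replace (t / M rho) with (/ M rho * t) by (unfold Rdiv; ring).
  split.
  - assert (H := laplace_localized_bound f lam (F lam) eta (C0 / rho) t (/ M rho) Ht HB ltac:(lra) Hm2 Hm3
      (wave_size W)).
    replace (18 * C0 / rho) with (18 * (C0 / rho)) by (unfold Rdiv; ring).
    assert (H1 : Cmod (F lam) <= 17 * (C0 / rho) * exp (/ M rho * t)).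
    { apply H.
      - intros s _. eapply rderiv_rcont, (wave_derive W).
      - apply (wave_laplace W). lra. }
    nra.
  - assert (H := laplace_localized_bound f1 lam (lam * F lam - f 0)%C eta C0 t (/ M rho) Ht HC0 ltac:(lra) Hm2 Hm3
      (wave_size1 W)).
    assert (H1 : Cmod (lam * F lam - f 0)%C <= 17 * C0 * exp (/ M rho * t)).
    { apply H.
      - intros s _. apply (wave_rcont1 W).
      - apply (wave_laplace1 W). lra. }
    assert (H2 := wave_size W 0 (Rle_refl _)).
    assert (H3 : exp (- eta * Rabs (0 - t)) <= 1)
      by (apply exp_decay_le_1; assert (H4 := eta_ge); lra).
    assert (H4 : Cmod (f 0) <= C0).
    { eapply Rle_trans; [exact H2|]. assert (C0 / rho <= C0) by (unfold Rdiv; nra).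
      assert (H5 := exp_pos (- eta * Rabs (0 - t))). nra. }
    assert (T := Cmod_triangle (lam * F lam - f 0) (f 0)).
    replace (lam * F lam - f 0 + f 0)%C with (lam * F lam)%C in T by ring. nra.
Qed.


Lemma not_bigO_MK_inv : forall kappa, ~ bigO_infty r (fun t => MK_inv M K (kappa * t)) ->
  forall A T, exists t, T <= t /\ A * Rabs (MK_inv M K (kappa * t)) < Rabs (r t).
Proof.
  intros kappa H A T. apply NNPP. intros H'. apply H. exists A, T. intros t Ht.
  apply Rnot_lt_le. intros Hlt. apply H'. exists t. split; [lra|exact Hlt].
Qed.

(** The test functions of both statements are superpositions of wave packets;
    [mult] is the factor by which the transform is multiplied in the growth
    condition, and a packet of frequency [rho] is placed at time [MK rho / kappa].
    The hypothesis on [C1] says that the bounds satisfied by packets imply the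
    growth condition with a constant independent of [rho]. *)
Lemma optimality : forall (kappa : R) (mult : C -> C), 1 <= kappa -> positive_on_Rplus r ->
  (forall C1, 0 <= C1 ->
  exists D rho1, forall rho lam w, rho1 <= rho -> 1 <= rho -> Omega M lam ->
     (Rabs (Im lam) <= rho -> Cmod w <= C1 /\ Cmod (lam * w)%C <= C1) ->
     (rho <= Rabs (Im lam) -> Cmod w <= C1 / rho * exp (MK M K rho / kappa / M rho) /\
        Cmod (lam * w)%C <= C1 * exp (MK M K rho / kappa / M rho)) ->
     Cmod (mult lam * w)%C <= D * K (Rabs (Im lam))) ->
  (forall f : R -> C, bounded_on_Rplus f -> Lipschitz_on_Rplus f -> has_uniformly_continuous_derivative f ->
     (exists F : C -> C, laplace_extension (Omega M) f F /\
        exists B : R, forall lam : C, Omega M lam -> Cmod (mult lam * F lam)%C / K (Rabs (Im lam)) <= B) ->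
     bigO_infty (fun t => Cmod (f t)) (fun t => / r t)) ->
  bigO_infty r (fun t => MK_inv M K (kappa * t)).
Proof.
  intros kappa mult Hkappa Hr0 Hest Hclass. apply NNPP. intros Hnot.
  assert (Hlarge := not_bigO_MK_inv kappa Hnot). clear Hnot.
  assert (He := eta_ge).
  set (C0 := packet_const eta N). assert (HC0 : 0 < C0) by apply packet_const_pos.
  set (c0 := exp (-6)). assert (Hc0 : 0 < c0) by apply exp_pos.
  destruct (Hest (18 * C0)) as (D & rho1 & HD); [lra|].
  destruct wave_exists as (rho0 & Hrho0 & Hwave).
  (* The solution of [8 * C0 * p = c0 * (1 - p)]. *)
  set (p := c0 / (8 * C0 + c0)).
  assert (Hden : 0 < 8 * C0 + c0) by lra.
  assert (Hp : 0 < p < 1).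
  { unfold p. split; [apply Rdiv_lt_0_compat; lra|].
    apply (Rmult_lt_reg_r (8 * C0 + c0)); [lra|]. unfold Rdiv. rewrite Rmult_assoc, Rinv_l; lra. }
  assert (Hpc : 8 * C0 * p <= c0 * (1 - p)) by (apply Req_le; unfold p; field; lra).
  (* [base n] forces both the position and the frequency of the [n]-th packet to
     be at least [n], and the frequency to be in the range where packets exist. *)
  set (base := fun n : nat => Rmax (INR n) (MK M K (Rmax (Rmax rho0 rho1) (INR n)))).
  (* Of the factor [(2 / p) ^ n], the gliding hump consumes [p ^ n]; [2 ^ n] is left. *)
  set (good := fun (n : nat) (T t : R) => T <= t /\ (2 / p) ^ n * Rabs (MK_inv M K (kappa * t)) < Rabs (r t)).
  assert (Hpick : forall n T, exists t, good n T t) by (intros; apply Hlarge).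
  set (pick := fun n T => proj1_sig (constructive_indefinite_description _ (Hpick n T))).
  assert (Hpk : forall n T, good n T (pick n T)).
  { intros n T. exact (proj2_sig (constructive_indefinite_description _ (Hpick n T))). }
  clearbody pick.
  set (tau := fix tau n := match n with O => pick O (base O) | S m => pick (S m) (Rmax (tau m) (base (S m))) end).
  assert (Hbase : forall n, base n <= tau n).
  { intros [|n]; simpl; [apply (Hpk O)|]. eapply Rle_trans; [apply Rmax_r|]. apply (Hpk (S n)). }
  assert (Hsize : forall n, (2 / p) ^ n * Rabs (MK_inv M K (kappa * tau n)) < Rabs (r (tau n))).
  { intros [|n]; [apply (Hpk O)|apply (Hpk (S n))]. }
  assert (Hstep : forall n, tau n <= tau (S n)).
  { intros n. simpl. eapply Rle_trans; [apply Rmax_l|]. apply (Hpk (S n)). }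
  clearbody tau.
  assert (Htn : forall n, INR n <= tau n) by (intros n; eapply Rle_trans; [apply Rmax_l|apply Hbase]).
  assert (Ht0 : forall n, 0 <= tau n) by (intros n; eapply Rle_trans; [apply pos_INR|apply Htn]).
  set (rho := fun n => MK_inv M K (kappa * tau n)).
  assert (Htkappa : forall n, tau n <= kappa * tau n) by (intros n; specialize (Ht0 n); nra).
  assert (Hrhobase : forall n, Rmax (Rmax rho0 rho1) (INR n) <= rho n).
  { intros n. apply MK_inv_ge; auto.
    - eapply Rle_trans; [apply pos_INR|apply Rmax_r].
    - eapply Rle_trans; [|apply Htkappa]. eapply Rle_trans; [apply Rmax_r|apply (Hbase n)]. }
  assert (Hrho_0 : forall n, rho0 <= rho n).
  { intros n. eapply Rle_trans; [|apply Hrhobase]. eapply Rle_trans; [|apply Rmax_l]. apply Rmax_l. }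
  assert (Hrho_1 : forall n, rho1 <= rho n).
  { intros n. eapply Rle_trans; [|apply Hrhobase]. eapply Rle_trans; [|apply Rmax_l]. apply Rmax_r. }
  assert (Hrho_n : forall n, INR n <= rho n).
  { intros n. eapply Rle_trans; [|apply Hrhobase]. apply Rmax_r. }
  assert (HMKt : forall n, MK M K 0 <= kappa * tau n).
  { intros n. eapply Rle_trans; [|apply Htkappa]. eapply Rle_trans; [|apply (Hbase n)].
    eapply Rle_trans; [|apply Rmax_r]. apply MK_nondecreasing; auto; [lra|].
    eapply Rle_trans; [apply pos_INR|apply Rmax_r]. }
  assert (Hrho_eq : forall n, MK M K (rho n) = kappa * tau n) by (intros n; apply MK_inv_spec; auto).
  assert (Hrho_ge1 : forall n, 1 <= rho n) by (intros n; specialize (Hrho_0 n); lra).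
  assert (Hmono : forall n m, (n <= m)%nat -> rho n <= rho m).
  { intros n m Hnm. induction Hnm as [|m Hnm IH]; [lra|]. eapply Rle_trans; [exact IH|].
    unfold rho at 2. apply MK_inv_ge; auto; [specialize (Hrho_ge1 m); lra|].
    rewrite Hrho_eq. specialize (Hstep m). nra. }
  assert (Hex : forall n, exists x : (R -> C) * (R -> C) * (C -> C) * (C -> C),
    wave C0 c0 eta (rho n) (tau n) (fst (fst (fst x))) (snd (fst (fst x))) (snd (fst x)) (snd x)).
  { intros n. destruct (Hwave (rho n) (tau n)) as (f & f1 & F & F1 & W); auto.
    - rewrite Hrho_eq. apply Htkappa.
    - exists (f, f1, F, F1). exact W. }
  set (x := fun n => proj1_sig (constructive_indefinite_description _ (Hex n))).
  set (f := fun n => fst (fst (fst (x n)))). set (f1 := fun n => snd (fst (fst (x n)))).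
  set (F := fun n => snd (fst (x n))). set (F1 := fun n => snd (x n)).
  assert (HW : forall n, wave C0 c0 eta (rho n) (tau n) (f n) (f1 n) (F n) (F1 n)).
  { intros n. exact (proj2_sig (constructive_indefinite_description _ (Hex n))). }
  clearbody f f1 F F1. clear x.
  destruct (gliding_hump (fun k n => f k (tau n)) p c0 C0 rho) as (e & Hep & Hpeak); auto; try lra.
  { intros n; specialize (Hrho_ge1 n); lra. }
  { intros n. apply (wave_peak (HW n)). }
  { intros k n. eapply Rle_trans; [apply (wave_size (HW k)); apply Ht0|].
    assert (E : exp (- eta * Rabs (tau n - tau k)) <= 1)
      by (apply exp_decay_le_1; lra).
    assert (H2 : 0 <= C0 / rho k) by (apply Rdiv_le_0_compat; [lra|specialize (Hrho_ge1 k); lra]). nra. }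
  assert (Ha : ex_series (fun k => p ^ k)) by (apply ex_series_geom; rewrite Rabs_pos_eq; lra).
  assert (Heta0 : 0 < eta) by lra.
  assert (HC0' : 0 <= C0) by lra.
  destruct (Hclass (total f e)) as (A & T0 & HA).
  - apply (total_bounded C0 c0 eta rho tau f f1 F F1) with (a := fun k => p ^ k); auto.
  - exists (2 * (2 * C0) * tail (fun k => p ^ k) 0). intros s u _ _.
    apply (total_lipschitz C0 c0 eta rho tau f f1 F F1); auto.
  - exists (total1 f1 e). split.
    + apply (total_derive C0 c0 eta rho tau f f1 F F1) with (a := fun k => p ^ k); auto.
    + apply (total1_uniformly_continuous C0 c0 eta rho tau f f1 F F1) with (a := fun k => p ^ k); auto.
  - exists (total_transform F e). split; [split|].
    + intros lam Hlam. assert (HL := Omega_left lam Hlam).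
      destruct (total_transform_cderiv C0 c0 eta rho tau f f1 F F1 HC0' HW Hrho_n e (fun k => p ^ k) Hep Ha lam ltac:(lra)) as [_ HDer].
      eexists. split; [apply (is_linear_scal_l (K := C_AbsRing) (V := C_NormedModule))|exact HDer].
    + intros lam Hlam. apply (total_laplace C0 c0 eta rho tau f f1 F F1) with (a := fun k => p ^ k); auto.
    + exists (2 * D * tail (fun k => p ^ k) 0). intros lam Hlam.
      assert (HL := Omega_left lam Hlam).
      assert (HKp := HK0 _ (Rabs_pos (Im lam))).
      assert (HB : forall n, Cmod (mult lam * F n lam)%C <= D * K (Rabs (Im lam))).
      { intros n. apply (HD (rho n)); auto.
        - intros Him. destruct (wave_low (HW n) lam ltac:(lra) Him) as (W1 & W2 & _). lra.
        - intros Him. rewrite Hrho_eq.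
          assert (HMn : 0 < M (rho n)) by (apply HM0; specialize (Hrho_ge1 n); lra).
          replace (kappa * tau n / kappa / M (rho n)) with (tau n / M (rho n)) by (field; repeat split; lra).
          apply (wave_high C0 c0 (rho n) (tau n) (f n) (f1 n) (F n) (F1 n) lam); auto. }
      assert (HT := total_transform_bound C0 c0 eta rho tau f f1 F F1 HW Hrho_n e (fun k => p ^ k) Hep Ha
        (mult lam) lam (D * K (Rabs (Im lam))) ltac:(lra) HB).
      apply (Rmult_le_reg_r (K (Rabs (Im lam)))); [assumption|].
      unfold Rdiv at 1. rewrite Rmult_assoc, Rinv_l, Rmult_1_r by lra. lra.
  - destruct (INR_unbounded (Rmax T0 (4 * Rabs A / c0))) as [n Hn].
    assert (N1 := Rmax_l T0 (4 * Rabs A / c0)). assert (N2 := Rmax_r T0 (4 * Rabs A / c0)).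
    specialize (HA (tau n) ltac:(specialize (Htn n); lra)). specialize (Hpeak n). specialize (Hsize n).
    fold (rho n) in Hsize.
    assert (Hrp := Hr0 (tau n) (Ht0 n)).
    assert (Hrho_p : 0 < rho n) by (specialize (Hrho_ge1 n); lra).
    rewrite (Rabs_pos_eq (r (tau n))), (Rabs_pos_eq (rho n)) in Hsize by lra.
    rewrite (Rabs_pos_eq (Cmod _)), (Rabs_pos_eq (/ r (tau n))) in HA
      by (first [apply Cmod_ge_0 | apply Rlt_le, Rinv_0_lt_compat; assumption]).
    unfold total in HA. rewrite (Rabs_pos_eq (tau n)) in HA by apply Ht0.
    assert (Hpn : 0 < p ^ n) by (apply pow_lt; lra).
    assert (H2n : INR n <= 2 ^ n).
    { clear. induction n as [|n IH]; [simpl; lra|]. rewrite S_INR. simpl.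
      assert (1 <= 2 ^ n) by (apply pow_R1_Rle; lra). lra. }
    assert (HAr : A * / r (tau n) <= Rabs A * (p ^ n / (2 ^ n * rho n))).
    { assert (HA' := Rle_abs A). assert (HA0 := Rabs_pos A).
      assert (Hri : / r (tau n) <= p ^ n / (2 ^ n * rho n)).
      { replace (p ^ n / (2 ^ n * rho n)) with (/ ((2 / p) ^ n * rho n)).
        - apply Rinv_le_contravar; [|lra]. apply Rmult_lt_0_compat; [|assumption].
          apply pow_lt, Rdiv_lt_0_compat; lra.
        - unfold Rdiv. rewrite Rpow_mult_distr, pow_inv. field.
          repeat split; try lra. apply pow_nonzero; lra. }
      assert (0 < / r (tau n)) by (apply Rinv_0_lt_compat; assumption). nra. }
    assert (Hfin : c0 / 4 * (p ^ n / rho n) <= Rabs A * (p ^ n / (2 ^ n * rho n))) by lra.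
    assert (H2p : 0 < 2 ^ n) by (apply pow_lt; lra).
    apply (Rmult_le_compat_r (2 ^ n * rho n / p ^ n)) in Hfin;
      [|apply Rlt_le, Rdiv_lt_0_compat; [apply Rmult_lt_0_compat|]; assumption].
    replace (c0 / 4 * (p ^ n / rho n) * (2 ^ n * rho n / p ^ n)) with (c0 / 4 * 2 ^ n) in Hfin by (field; lra).
    replace (Rabs A * (p ^ n / (2 ^ n * rho n)) * (2 ^ n * rho n / p ^ n)) with (Rabs A) in Hfin by (field; lra).
    assert (HAc : 4 * Rabs A / c0 < 2 ^ n) by lra.
    apply (Rmult_lt_compat_l c0) in HAc; [|assumption].
    replace (c0 * (4 * Rabs A / c0)) with (4 * Rabs A) in HAc by (field; lra). lra.
Qed.

Lemma K_lower : forall s, 0 <= s -> 0 < K 0 /\ K 0 <= K s.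
Proof. intros s Hs; split; [apply HK0; lra|apply HKm; lra]. Qed.

Lemma one_plus_K_le : forall s, 0 <= s -> 1 + K s <= (/ K 0 + 1) * K s.
Proof.
  intros s Hs. destruct (K_lower s Hs) as [H1 H2].
  assert (/ K 0 * K 0 = 1) by (apply Rinv_l; lra).
  assert (0 < / K 0) by (apply Rinv_0_lt_compat; assumption). nra.
Qed.

Lemma bounded_le_K : forall C1 s, 0 <= C1 -> 0 <= s -> C1 <= C1 * / K 0 * K s.
Proof.
  intros C1 s HC Hs. destruct (K_lower s Hs) as [H1 H2].
  assert (/ K 0 * K 0 = 1) by (apply Rinv_l; lra).
  assert (0 < / K 0) by (apply Rinv_0_lt_compat; assumption). rewrite Rmult_assoc.
  assert (1 <= / K 0 * K s) by nra. nra.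
Qed.

Lemma MK_div_M : forall kappa s, 0 < kappa -> 0 <= s ->
  MK M K s / kappa / M s = (ln (1 + s) + ln (1 + K s)) / kappa.
Proof. intros kappa s Hc Hs. unfold MK. assert (H := HM0 s Hs). field. split; lra. Qed.

(** At [t = MK rho] the exponential is [(1 + rho) (1 + K rho)], and the amplitude
    [1 / rho] of the packet cancels the first factor. *)
Lemma transform_estimate : forall C1, 0 <= C1 ->
  exists D rho1, forall rho lam w, rho1 <= rho -> 1 <= rho -> Omega M lam ->
     (Rabs (Im lam) <= rho -> Cmod w <= C1 /\ Cmod (lam * w)%C <= C1) ->
     (rho <= Rabs (Im lam) -> Cmod w <= C1 / rho * exp (MK M K rho / 1 / M rho) /\
        Cmod (lam * w)%C <= C1 * exp (MK M K rho / 1 / M rho)) ->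
     Cmod (1 * w)%C <= D * K (Rabs (Im lam)).
Proof.
  intros C1 HC1. exists (2 * C1 * (/ K 0 + 1)), 1. intros rho lam w _ Hrho _ Hlow Hhigh.
  rewrite Cmult_1_l.
  assert (HKi : 0 < / K 0) by (apply Rinv_0_lt_compat, HK0; lra).
  assert (Hs := Rabs_pos (Im lam)). destruct (K_lower _ Hs) as [K1 K2].
  destruct (Rle_dec (Rabs (Im lam)) rho) as [H|H].
  - destruct (Hlow H) as [W _]. assert (B := bounded_le_K C1 _ HC1 Hs).
    assert (0 <= C1 * / K 0 * K (Rabs (Im lam))) by (apply Rmult_le_pos; [apply Rmult_le_pos|]; lra).
    assert (0 <= C1 * K (Rabs (Im lam))) by (apply Rmult_le_pos; lra). nra.
  - destruct (Hhigh ltac:(lra)) as [W _]. eapply Rle_trans; [exact W|].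
    rewrite MK_div_M by lra. destruct (K_lower rho ltac:(lra)) as [K3 K4].
    rewrite Rdiv_1_r, exp_plus, !exp_ln by lra.
    assert (G := one_plus_K_le rho ltac:(lra)).
    assert (G2 := HKm rho (Rabs (Im lam)) ltac:(lra) ltac:(lra)).
    replace (C1 / rho * ((1 + rho) * (1 + K rho))) with (C1 * ((1 + rho) * / rho) * (1 + K rho)) by (unfold Rdiv; ring).
    rewrite Rmult_assoc. replace (2 * C1) with (C1 * 2) by ring. rewrite !Rmult_assoc.
    apply Rmult_le_compat_l; [assumption|].
    rewrite <- Rmult_assoc. apply Rmult_le_compat; [| lra | |].
    + apply Rmult_le_pos; [lra|apply Rlt_le, Rinv_0_lt_compat; lra].
    + apply (Rmult_le_reg_r rho); [lra|]. rewrite Rmult_assoc, Rinv_l; lra.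
    + eapply Rle_trans; [exact G|]. apply Rmult_le_compat_l; lra.
Qed.

(** Since [rho <= (K rho / b) ^ (1 / beta)], the product [(1 + rho) (1 + K rho)]
    is at most a constant times [K rho ^ (1 + 1 / beta)]. Raised to the power
    [1 / (1 + 1 / beta)] it is [O(K rho)], and the amplitude [1 / rho] can be spent
    on the factor [lam]. *)
Lemma multiplied_transform_estimate : forall b beta, 0 < b -> 0 < beta ->
  Rbar_locally p_infty (fun s => K s >= b * Rpower s beta) ->
  forall C1, 0 <= C1 ->
  exists D rho1, forall rho lam w, rho1 <= rho -> 1 <= rho -> Omega M lam ->
     (Rabs (Im lam) <= rho -> Cmod w <= C1 /\ Cmod (lam * w)%C <= C1) ->
     (rho <= Rabs (Im lam) -> Cmod w <= C1 / rho * exp (MK M K rho / (1 + / beta) / M rho) /\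
        Cmod (lam * w)%C <= C1 * exp (MK M K rho / (1 + / beta) / M rho)) ->
     Cmod (lam * w)%C <= D * K (Rabs (Im lam)).
Proof.
  intros b beta Hb Hbeta [S HS] C1 HC1.
  assert (Hib : 0 < / beta) by (apply Rinv_0_lt_compat; assumption).
  set (kappa := 1 + / beta). assert (Hkappa : 1 <= kappa) by (unfold kappa; lra).
  set (c' := ln 2 + Rabs (ln b) * / beta + Rabs (ln (/ K 0 + 1))).
  assert (HKi : 0 < / K 0) by (apply Rinv_0_lt_compat, HK0; lra).
  exists (C1 * / K 0 + C1 * exp (c' / kappa)), (S + 1). intros rho lam w HrhoS Hrho _ Hlow Hhigh.
  assert (Hs := Rabs_pos (Im lam)). destruct (K_lower _ Hs) as [K1 K2].
  assert (He := exp_pos (c' / kappa)).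
  assert (0 <= C1 * exp (c' / kappa) * K (Rabs (Im lam))) by (repeat apply Rmult_le_pos; lra).
  assert (0 <= C1 * / K 0 * K (Rabs (Im lam))) by (repeat apply Rmult_le_pos; lra).
  rewrite Rmult_plus_distr_r.
  destruct (Rle_dec (Rabs (Im lam)) rho) as [Hr|Hr].
  - destruct (Hlow Hr) as [_ W]. assert (B := bounded_le_K C1 _ HC1 Hs). lra.
  - destruct (Hhigh ltac:(lra)) as [_ W]. eapply Rle_trans; [exact W|].
    rewrite MK_div_M by (fold kappa; lra). fold kappa. destruct (K_lower rho ltac:(lra)) as [K3 K4].
    assert (G := one_plus_K_le rho ltac:(lra)).
    assert (G2 := HKm rho (Rabs (Im lam)) ltac:(lra) ltac:(lra)).
    assert (HKr := HS rho ltac:(lra)).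
    assert (L1 : ln (1 + rho) <= ln 2 + ln rho).
    { rewrite <- ln_mult by lra. destruct (Req_dec rho 1) as [->|Hne].
      - apply Req_le; f_equal; ring.
      - apply Rlt_le, ln_increasing; lra. }
    assert (L2 : ln rho <= ln (K rho) * / beta + Rabs (ln b) * / beta).
    { assert (L : ln b + beta * ln rho <= ln (K rho)).
      { replace (ln b + beta * ln rho) with (ln (b * Rpower rho beta)).
        - assert (Hpw : 0 < Rpower rho beta) by apply exp_pos.
          assert (Hbp : 0 < b * Rpower rho beta) by (apply Rmult_lt_0_compat; assumption).
          destruct HKr as [HKr|HKr]; [apply Rlt_le, ln_increasing; lra|rewrite HKr; lra].
        - unfold Rpower. rewrite ln_mult, ln_exp by (assumption || apply exp_pos). reflexivity. }
      assert (Ab := Rle_abs (- ln b)). rewrite Rabs_Ropp in Ab.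
      rewrite <- Rmult_plus_distr_r. apply (Rmult_le_reg_r beta); [assumption|].
      rewrite Rmult_assoc, Rinv_l by lra. lra. }
    assert (L3 : ln (1 + K rho) <= Rabs (ln (/ K 0 + 1)) + ln (K rho)).
    { assert (Ab := Rle_abs (ln (/ K 0 + 1))).
      apply Rle_trans with (ln ((/ K 0 + 1) * K rho)); [|rewrite ln_mult by lra; lra].
      destruct G as [G|G]; [apply Rlt_le, ln_increasing; lra|rewrite G; lra]. }
    assert (L4 : (ln (1 + rho) + ln (1 + K rho)) / kappa <= ln (K rho) + c' / kappa).
    { apply (Rmult_le_reg_r kappa); [lra|].
      replace ((ln (1 + rho) + ln (1 + K rho)) / kappa * kappa) with (ln (1 + rho) + ln (1 + K rho)) by (field; lra).
      replace ((ln (K rho) + c' / kappa) * kappa) with (ln (K rho) * kappa + c') by (field; lra).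
      unfold c', kappa. lra. }
    assert (L5 : exp ((ln (1 + rho) + ln (1 + K rho)) / kappa) <= K rho * exp (c' / kappa)).
    { eapply Rle_trans; [apply exp_le_compat, L4|]. rewrite exp_plus, exp_ln by lra. lra. }
    assert (L6 : K rho * exp (c' / kappa) <= K (Rabs (Im lam)) * exp (c' / kappa)) by (apply Rmult_le_compat_r; lra).
    assert (L7 : C1 * exp ((ln (1 + rho) + ln (1 + K rho)) / kappa) <= C1 * (K (Rabs (Im lam)) * exp (c' / kappa)))
      by (apply Rmult_le_compat_l; lra).
    lra.
Qed.

End Optimality.

Theorem theorem2p4 :
  forall (M K r : R -> R) (alpha : R),
    positive_on_Rplus M -> positive_on_Rplus K -> positive_on_Rplus r ->
    nondecreasing_on_Rplus M -> nondecreasing_on_Rplus K ->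
    nondecreasing_on_Rplus r ->
    continuous_on Rplus_set M -> continuous_on Rplus_set K ->
    0 < alpha ->
    bigO_infty M (fun s => exp (alpha * s)) ->
    bigO_infty K (fun s => exp (exp (alpha * s))) ->
    ((forall f : R -> C,
        bounded_on_Rplus f ->
        Lipschitz_on_Rplus f ->
        (exists F : C -> C,
           laplace_extension (Omega M) f F /\
           exists B : R, forall lambda : C, Omega M lambda ->
             Cmod (F lambda) / K (Rabs (Im lambda)) <= B) ->
        bigO_infty (fun t => Cmod (f t)) (fun t => / r t)) ->
     bigO_infty r (MK_inv M K))
    /\
    (forall b beta : R,
       0 < b -> 0 < beta ->
       Rbar_locally p_infty (fun s => K s >= b * Rpower s beta) ->
       (forall f : R -> C,
          bounded_on_Rplus f ->
          Lipschitz_on_Rplus f ->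
          has_uniformly_continuous_derivative f ->
          (exists F : C -> C,
             laplace_extension (Omega M) f F /\
             exists B : R, forall lambda : C, Omega M lambda ->
               Cmod (lambda * F lambda)%C / K (Rabs (Im lambda)) <= B) ->
          bigO_infty (fun t => Cmod (f t)) (fun t => / r t)) ->
       bigO_infty r (fun t => MK_inv M K ((1 + / beta) * t))).
Proof.
  intros M K r alpha HM0 HK0 Hr0 HMm HKm _ HMc HKc Halpha HMg HKg. split.
  - intros Hclass.
    destruct (optimality M K r alpha HM0 HK0 HMm HKm HMc HKc Halpha HMg HKg 1 (fun _ => 1%C))
      as (A & HA); auto.
    + lra.
    + apply transform_estimate; assumption.
    + intros f Hb HL _ (F & HF & B & HB). apply Hclass; auto.
      exists F; split; [exact HF|]. exists B. intros lam Hlam.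
      specialize (HB lam Hlam). rewrite Cmult_1_l in HB. exact HB.
    + destruct HA as [T HT]. exists A, T. intros t Ht.
      specialize (HT t Ht). cbv beta in HT. rewrite Rmult_1_l in HT. exact HT.
  - intros b beta Hb Hbeta HKb Hclass.
    apply (optimality M K r alpha HM0 HK0 HMm HKm HMc HKc Halpha HMg HKg (1 + / beta) (fun lam => lam)); auto.
    + assert (H := Rinv_0_lt_compat _ Hbeta). lra.
    + apply (multiplied_transform_estimate M K HM0 HK0 HKm b beta); assumption.
Qed.
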